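(* Let the setting, notation and objects $H,U,\mathbb{H},\mathbb{U},T,\gamma,\delta,\lambda,(\Omega,\mathcal{F},\mathbb{P},(\mathcal{F}_t)_{t\in[0,T]}),W,A,H_r,\xi,F,B,D=(D^I_h),P_I,\hat P_J$ be as fixed in the context. Let $\vartheta\in\mathbb{R}$ with $\vartheta\ge\sup_{x\in H_\gamma}\|B(x)\|_{\mathrm{HS}(U,H)}^2$ (so this supremum is finite), $b_1,b_2\in[0,\infty)$, $\varepsilon\in(0,\infty)$, $\varsigma\in\big(0,\tfrac{1-14\delta}{4}\big)$, $c\in[2\max\{1,\varepsilon b_1,\varepsilon\sqrt\vartheta,\varepsilon\},\infty)$. Assume $\mathbb{E}[e^{\varepsilon\|\xi\|_H^2}]<\infty$, and assume for all $h\in(0,T]$, $I\in\mathcal{P}_0(\mathbb{H})$, $J\in\mathcal{P}_0(\mathbb{U})$, $x\in D^I_h$ that $D^I_h\subseteq\{v\in H:\sqrt\vartheta+\varepsilon\|v\|_H^2\le c\,h^{-\varsigma}\}$, $\max\{\|P_IF(x)\|_H,\|P_IB(x)\hat P_J\|_{\mathrm{HS}(U,H)}\}\le c\,h^{-\delta}$, and $\langle x,P_IF(x)\rangle_H\le b_1+b_2\|x\|_H^2$. Let $Y^{\theta,I,J}\colon[0,T]\times\Omega\to P_I(H_\gamma)$, $\theta\in\varpi_T$, $I\in\mathcal{P}_0(\mathbb{H})$, $J\in\mathcal{P}_0(\mathbb{U})$, be $(\mathcal{F}_t)_{t\in[0,T]}$-adapted stochastic processes with continuous sample paths which satisfy for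 all $\theta\in\varpi_T$, $I\in\mathcal{P}_0(\mathbb{H})$, $J\in\mathcal{P}_0(\mathbb{U})$, $t\in(0,T]$ that $Y^{\theta,I,J}_0=P_I(\xi)$ and, $\mathbb{P}$-almost surely, $$Y^{\theta,I,J}_t=e^{(t-\llcorner t\lrcorner_\theta)A}\Big(Y^{\theta,I,J}_{\llcorner t\lrcorner_\theta}+\mathbf 1_{D^I_{|\theta|_T}}(Y^{\theta,I,J}_{\llcorner t\lrcorner_\theta})\,P_IF(Y^{\theta,I,J}_{\llcorner t\lrcorner_\theta})\,(t-\llcorner t\lrcorner_\theta)\Big)+\frac{\int_{\llcorner t\lrcorner_\theta}^t e^{(t-\llcorner t\lrcorner_\theta)A}\,\mathbf 1_{D^I_{|\theta|_T}}(Y^{\theta,I,J}_{\llcorner t\lrcorner_\theta})\,P_IB(Y^{\theta,I,J}_{\llcorner t\lrcorner_\theta})\hat P_J\,dW_s}{1+\big\|\int_{\llcorner t\lrcorner_\theta}^tP_IB(Y^{\theta,I,J}_{\llcorner t\lrcorner_\theta})\hat P_J\,dW_s\big\|_H^2}.$$ Then, writing $$\mathcal{E}^{\theta,I,J}_t=\mathbb{E}\Big[\exp\Big(\tfrac{\sqrt\vartheta+\varepsilon\|Y^{\theta,I,J}_t\|_H^2}{e^{2(b_2+\varepsilon\vartheta)t}}-\int_0^t\mathbf 1_{D^I_{|\theta|_T}}(Y^{\theta,I,J}_{\lfloor s\rfloor_\theta})\tfrac{\varepsilon(2b_1+\vartheta)}{e^{2(b_2+\varepsilon\vartheta)s}}\,ds\Big)\Big],$$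 it holds that $$\limsup_{|\theta|_T\searrow0}\sup_{I\in\mathcal{P}_0(\mathbb{H})}\sup_{J\in\mathcal{P}_0(\mathbb{U})}\sup_{t\in[0,T]}\mathcal{E}^{\theta,I,J}_t\le\mathbb{E}\big[e^{\sqrt\vartheta+\varepsilon\|\xi\|_H^2}\big]\le\sup_{\theta\in\varpi_T}\sup_{I\in\mathcal{P}_0(\mathbb{H})}\sup_{J\in\mathcal{P}_0(\mathbb{U})}\sup_{t\in[0,T]}\mathcal{E}^{\theta,I,J}_t$$ $$\le e^{\sqrt\vartheta}\sup_{\theta\in\varpi_T}\sup_{I\in\mathcal{P}_0(\mathbb{H})}\sup_{J\in\mathcal{P}_0(\mathbb{U})}\sup_{t\in[0,T]}\mathbb{E}\Big[\exp\Big(\tfrac{\varepsilon\|Y^{\theta,I,J}_t\|_H^2}{e^{2(b_2+\varepsilon\vartheta)t}}\Big)\Big]<\infty.$$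
   Context: Setting. $(H,\langle\cdot,\cdot\rangle_H,\|\cdot\|_H)$ and $(U,\langle\cdot,\cdot\rangle_U,\|\cdot\|_U)$ are separable real Hilbert spaces; $\mathbb{H}\subseteq H$ and $\mathbb{U}\subseteq U$ are non-empty orthonormal bases of $H$ and $U$. $T\in(0,\infty)$, $\gamma\in[0,\infty)$, $\delta\in[0,\tfrac1{14})$, and $\lambda\colon\mathbb{H}\to\mathbb{R}$, $h\mapsto\lambda_h$, satisfies $\sup_{h\in\mathbb{H}}\lambda_h<0$. $(\Omega,\mathcal{F},\mathbb{P},(\mathcal{F}_t)_{t\in[0,T]})$ is a filtered probability space and $(W_t)_{t\in[0,T]}$ is an $\mathrm{Id}_U$-cylindrical $(\mathcal{F}_t)_{t\in[0,T]}$-Wiener process. $A\colon D(A)\subseteq H\to H$ is the linear operator with $D(A)=\{w\in H:\sum_{h\in\mathbb{H}}|\lambda_h\langle h,w\rangle_H|^2<\infty\}$ and $Av=\sum_{h\in\mathbb{H}}\lambda_h\langle h,v\rangle_Hh$ for $v\in D(A)$. $(H_r,\langle\cdot,\cdot\rangle_{H_r},\|\cdot\|_{H_r})$, $r\in\mathbb{R}$, is the family of interpolation spaces associated to $-A$; for $r\ge0$: $H_r=D((-A)^r)=\{v\in H:\sum_{h\in\mathbb{H}}|\lambda_h|^{2r}|\langle h,v\rangle_H|^2<\infty\}$ and $\|v\|_{H_r}=\|(-A)^rv\|_H$. $\xi\colon\Omega\to H_\gamma$ is $\mathcal{F}_0/\mathcal{B}(H_\gamma)$-measurable; $F\colon H_\gamma\to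 H$ and $B\colon H_\gamma\to\mathrm{HS}(U,H)$ are Borel measurable; $D^I_h\in\mathcal{B}(H_\gamma)$ for every subset $I\subseteq\mathbb{H}$ and $h\in(0,T]$. For $I\subseteq\mathbb{H}$, $J\subseteq\mathbb{U}$: $P_I\in L(H)$, $P_I(x)=\sum_{h\in I}\langle h,x\rangle_Hh$, and $\hat P_J\in L(U)$, $\hat P_J(y)=\sum_{u\in J}\langle u,y\rangle_Uu$. Notation. $\mathrm{HS}(U,H)$: Hilbert–Schmidt operators from $U$ to $H$ with the Hilbert–Schmidt norm. $\mathcal{B}(X)$: Borel sigma-algebra of $X$. $\mathcal{P}_0(X)$: the set of all finite subsets of $X$. $\mathbf 1_A(x)=1$ if $x\in A$, and $0$ otherwise. $\varpi_T$: the set of all finite $\theta\subseteq[0,T]$ with $\{0,T\}\subseteq\theta$; $|\theta|_T\in(0,T]$ is the maximal distance between two consecutive points of $\theta$. For $t\in(0,T]$: $\lfloor t\rfloor_\theta=\max([0,t]\cap\theta)$, $\llcorner t\lrcorner_\theta=\max([0,t)\cap\theta)$, and $\lfloor0\rfloor_\theta=\llcorner0\lrcorner_\theta=0$. *)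

(* Defs.v *)
From HB Require Import structures.
From mathcomp Require Import all_boot all_order all_algebra.
From mathcomp Require Import all_classical all_reals all_analysis.
From mathcomp Require Import sesquilinear summability.
Import Order.TTheory GRing.Theory Num.Theory.
Import numFieldNormedType.Exports.

Set Implicit Arguments.
Unset Strict Implicit.
Unset Printing Implicit Defensive.

Local Open Scope classical_set_scope.
Local Open Scope ring_scope.

Section hilbert.
Context {R : realType}.

(* A real Hilbert space is a complete normed space V together with an inner
   product (a {dot V for idfun}) that induces its norm. *)
Definition hilbert (V : completeNormedModType R) (ip : {dot V for idfun}) :=
  forall x : V, ip x x = `|x| ^+ 2.

Definition separable_space (V : topologicalType) :=
  exists2 S : set V, countable S & dense S.

(* Unconditional sum over an arbitrary index set: limit of the partial sums
   along the directed set of finite subsets. *)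
Definition hsum (V : completeNormedModType R) (S : set V) (f : V -> V) : V :=
  summability.sum (fun h => if h \in S then f h else 0).

Definition lin_span (V : lmodType R) (S : set V) : set V :=
  [set v | exists2 J, fsets S J & exists a : V -> R, v = \sum_(h \in J) a h *: h].

Definition orthonormal_basis (V : completeNormedModType R)
    (ip : {dot V for idfun}) (S : set V) :=
  [/\ forall h k, S h -> S k -> ip h k = (h == k)%:R
    & closure (lin_span S) = setT].

Definition onb_proj (V : completeNormedModType R) (ip : {dot V for idfun})
    (I : set V) (x : V) : V := hsum I (fun h => ip h x *: h).

(* Functional calculus of the diagonal operator with eigenbasis S and
   eigenvalues lam: phi(A) v = \sum_(h in S) phi(lam h) <h, v> h. *)
Section diagonal.
Context (V : completeNormedModType R) (ip : {dot V for idfun}) (S : set V)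
        (lam : V -> R).

Definition diag_dom (phi : R -> R) : set V :=
  [set v | (\esum_(h in S) ((phi (lam h) * ip h v) ^+ 2)%:E < +oo)%E].

Definition diag_op (phi : R -> R) (v : V) : V :=
  hsum S (fun h => (phi (lam h) * ip h v) *: h).

(* The operator A itself is diag_op idfun, with domain diag_dom idfun. *)

Definition semigroup (t : R) : V -> V := diag_op (fun l => expR (t * l)).

(* H_r = D((-A)^r) as a subset of H; only meant for r >= 0. *)
Definition interp_space (r : R) : set V := diag_dom (fun l => (- l) `^ r).

Definition interp_norm (r : R) (v : V) : R :=
  `|diag_op (fun l => (- l) `^ r) v|.

End diagonal.

(* Hilbert-Schmidt operators, with the norm computed in a fixed orthonormal
   basis S of the domain (its value does not depend on S). *)
Section hilbert_schmidt.
Context (U H : completeNormedModType R) (S : set U).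

Definition hs_normsq (L : U -> H) : \bar R :=
  (\esum_(u in S) (`|L u| ^+ 2)%:E)%E.

Definition hs_op : set (U -> H) :=
  [set L | [/\ linear L, continuous L & (hs_normsq L < +oo)%E]].

(* Only meaningful on hs_op, because fine +oo = 0. *)
Definition hs_norm (L : U -> H) : R := Num.sqrt (fine (hs_normsq L)).

End hilbert_schmidt.

(* Borel sigma-algebra of the normed space (X, N), where X is a linear subspace
   of V and N a norm on X; its members are subsets of V contained in X. *)
Definition norm_open (V : zmodType) (X : set V) (N : V -> R) : set_system V :=
  [set O | O `<=` X /\
     forall x, O x -> exists2 e : R, 0 < e & forall y, X y -> N (y - x) < e -> O y].

Definition norm_borel (V : zmodType) (X : set V) (N : V -> R) : set_system V :=
  <<s X, norm_open X N >>.

End hilbert.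

Definition measurable_wrt {aT rT : Type} (X : set aT) (SA : set_system aT)
    (SB : set_system rT) (f : aT -> rT) :=
  preimage_set_system X f SB `<=` SA.

Section stochastic.
Context {R : realType} {d : measure_display} {Omega : measurableType d}.
Context (P : probability Omega R) (T : R) (Ft : R -> set_system Omega).

(* No completeness or right-continuity is required. *)
Definition filtration :=
  (forall t : R, 0 <= t <= T ->
     sigma_algebra setT (Ft t) /\ Ft t `<=` measurable) /\
  (forall s t : R, 0 <= s -> s <= t -> t <= T -> Ft s `<=` Ft t).

(* Id_U-cylindrical Wiener process: W t u is the (linear in u) real random
   variable usually written <u, W_t>, and for every u the process W _ u is a
   Brownian motion with respect to Ft with variance `|u| ^+ 2 per unit of time.
   The law of the increments is only prescribed for u != 0 and s < t because
   normal_prob takes an arbitrary value at standard deviation 0. *)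
Record cylindrical_wiener (U : normedModType R) (W : R -> U -> Omega -> R) :
    Prop := CylindricalWiener {
  cw_start : forall u, {ae P, forall w, W 0 u w = 0};
  cw_linear : forall t : R, 0 <= t <= T -> forall (a : R) (u v : U),
    {ae P, forall w, W t (a *: u + v) w = a * W t u w + W t v w};
  cw_adapted : forall t : R, 0 <= t <= T -> forall u,
    measurable_wrt setT (Ft t) measurable (W t u);
  cw_continuous : forall u,
    {ae P, forall w, {within `[0, T], continuous (fun t : R => W t u w)}};
  cw_normal : forall s t : R, 0 <= s -> s < t -> t <= T -> forall u : U, u != 0 ->
    forall S : set R, measurable S ->
    P ((fun w => W t u w - W s u w) @^-1` S) =
    normal_prob 0 (Num.sqrt (t - s) * `|u|) S;
  cw_indep : forall s t : R, 0 <= s -> s < t -> t <= T -> forall u : U,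
    forall (E : set Omega) (S : set R), Ft s E -> measurable S ->
    P (E `&` (fun w => W t u w - W s u w) @^-1` S) =
    mule (P E) (P ((fun w => W t u w - W s u w) @^-1` S)) }.

(* Stochastic integral \int_a^b Phi dW of an integrand Phi that is constant in
   time on (a, b] (and measurable with respect to Ft a) and vanishes on all but
   finitely many elements of the orthonormal basis S of U:
     \sum_(u in S) Phi(u) (<u, W_b> - <u, W_a>).
   The sum \sum_(u \in S) is the sum over the finite support in S of the
   summand. *)
Definition step_integral (U : normedModType R) (H : normedModType R)
    (S : set U) (W : R -> U -> Omega -> R) (a b : R) (Phi : Omega -> U -> H)
    (w : Omega) : H :=
  \sum_(u \in S) (W b u w - W a u w) *: Phi w u.

End stochastic.

Section time_grids.
Context {R : realType}.

Definition grid (T : R) : set (set R) :=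
  [set th | [/\ finite_set th, th `<=` `[0, T], th 0 & th T]].

Definition mesh (th : set R) : R :=
  sup [set x | exists a b, [/\ th a, th b, 0 < x, x = b - a
                             & th `&` `]a, b[ = set0]].

Definition grid_le (th : set R) (t : R) : R :=
  if t == 0 then 0 else sup (`[0, t] `&` th).

Definition grid_lt (th : set R) (t : R) : R :=
  if t == 0 then 0 else sup (`[0, t[ `&` th).

(* limsup of f th as mesh th decreases to 0 over the grids of [0, T] *)
Definition limsup_mesh (T : R) (f : set R -> \bar R) : \bar R :=
  ereal_inf [set ereal_sup [set f th | th in [set th | grid T th /\ mesh th <= r]]
            | r in [set r : R | 0 < r]].

Definition esup_grid (H U : Type) (T : R) (HH : set (set H)) (UU : set (set U))
    (f : set R -> set H -> set U -> R -> \bar R) (th : set R) : \bar R :=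
  ereal_sup [set ereal_sup [set ereal_sup [set f th I J t
    | t in `[0, T]] | J in UU] | I in HH].

End time_grids.

(* Main.v *)
(* Between neighbouring grid points s < t the squared norm of the scheme is, up
   to the contraction e^{(t-s)A}, equal to |v + Z / (1 + |Z|^2)|^2, where
   v = y + (t-s) P_I F(y) is F_s-measurable and Z is, given F_s, Gaussian with
   total variance at most (t-s) vtheta. By convexity of the exponential
   the factor exp(2q<v,Z> / (1+r) + q r / (1+r)^2) with r = |Z|^2 is at most
   exp(2q<v,Z>) + q r plus an error of order r^{3/2}, whose conditional mean is
   controlled by Gaussian integrals. The terms of first order in t-s are absorbed
   by the decay of e^{-2(b2 + eps vtheta)t} and by the integral in the exponent.
   On the truncation sets |y| and |P_I F(y)| are of order |theta|^{-1/8}, so one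
   step costs at most a factor exp(C (t-s) |theta|^{1/8}), and iterating over the
   grid gives E_t <= exp(C t |theta|^{1/8}) E_0. The lower bound is attained at
   t = 0 along finite projections P_I xi -> xi, by Fatou's lemma. *)

Require Import Defs.
From mathcomp Require Import all_boot all_order all_algebra.
From mathcomp Require Import finmap.
From mathcomp Require Import all_classical all_reals all_analysis.
From mathcomp Require Import measurable_realfun sesquilinear summability.
From mathcomp Require Import ring lra.
Import Order.TTheory GRing.Theory Num.Theory.
Import numFieldNormedType.Exports.

Set Implicit Arguments.
Unset Strict Implicit.
Unset Printing Implicit Defensive.

Local Open Scope classical_set_scope.
Local Open Scope ring_scope.

(** * Orthonormal families in Hilbert spaces *)

(** The one-step estimate is conditional on F_s, while the Wiener process is described only by its
    increments in one direction at a time. No conditional expectation is built: a bound given F_s is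
    an inequality between integrals over all events of F_s. It is proved for deterministic
    coefficients and carried over to random ones by rounding them to countably many values. Since I
    and J are finite, everything happens in coordinates: the scheme is a vector indexed by I and the
    noise a finite sum over J. The coordinates of Z are correlated; Jensen's inequality with weights
    proportional to their variances separates them, so that only one-dimensional Gaussian integrals
    occur.

    The eighth root tau of the mesh arises as follows. From 2 delta <= 1/4 and vsig <= 1/4, both
    |y|^2 and |P_I F(y)|^2 are at most a constant times tau^(-2) on the truncation sets. The taming
    error is of order (t-s)^(3/2) / tau, and (t-s)^(1/2) <= tau^4, so a spare factor tau remains.
    The constants depend neither on the grid nor on I and J, which gives the uniformity of the
    suprema. *)

Section inner_product.
Context {R : realType} (V : completeNormedModType R) (ip : {dot V for idfun}).
Hypothesis hilb : hilbert ip.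

Lemma ipC x y : ip x y = ip y x.
Proof. by rewrite hermC expr0 mul1r. Qed.

Lemma normD_sq x y : `|x + y| ^+ 2 = `|x| ^+ 2 + 2 * ip x y + `|y| ^+ 2.
Proof.
rewrite -!hilb hnormD expr0 mul1r /=.
by rewrite -addrA [X in _ + X = _]addrC addrA mulr_natl mulr2n.
Qed.

Lemma ip_le_norm x y : `|ip x y| <= `|x| * `|y|.
Proof.
have [->|x0] := eqVneq x 0; first by rewrite linear0l normr0 normr0 mul0r.
have nx : 0 < `|x| ^+ 2 by rewrite exprn_gt0// normr_gt0.
rewrite -ler_sqr ?nnegrE ?mulr_ge0//.
(* The vector is the residual of [y] after projection onto the line through [x]. *)
have := sqr_ge0 `|(- (ip x y / `|x| ^+ 2)) *: x + y|.
rewrite normD_sq normrZ linearZl_LR /= exprMn real_normK ?num_real//.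
set p := ip x y; set n := `|x| ^+ 2 => H.
rewrite real_normK ?num_real// exprMn -/n.
have : 0 <= n * ((- (p / n)) ^+ 2 * n + 2 * (- (p / n) * p) + `|y| ^+ 2).
  by rewrite mulr_ge0// ltW.
have -> : n * ((- (p / n)) ^+ 2 * n + 2 * (- (p / n) * p) + `|y| ^+ 2)
  = n * `|y| ^+ 2 - p ^+ 2 by field; rewrite gt_eqF.
by rewrite subr_ge0.
Qed.

Lemma ip_continuous x : continuous (ip x : V -> R).
Proof.
move=> y; apply/cvgrPdist_le => e e0.
have d0 : 0 < e / (`|x| + 1) by rewrite divr_gt0// ltr_wpDl.
near=> z.
rewrite -linearBr (le_trans (ip_le_norm _ _))//.
have : `|y - z| <= e / (`|x| + 1).
  near: z; apply: cvgr_dist_le => //; exact: cvg_id.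
rewrite ler_pdivlMr ?ltr_wpDl// => H; apply: le_trans H.
by rewrite mulrC ler_wpM2l// lerDl.
Unshelve. all: by end_near. Qed.

Section orthonormal.
Context (I : finType) (e : I -> V).
Hypothesis oe : forall i j, ip (e i) (e j) = (i == j)%:R.

Lemma ip_sum_orthonormal (a : I -> R) j : ip (e j) (\sum_i a i *: e i) = a j.
Proof.
rewrite linear_sumr (bigD1 j)//= linearZr_LR /= oe eqxx mulr1 big1 ?addr0//.
by move=> i ij; rewrite linearZr_LR /= oe eq_sym (negbTE ij) mulr0.
Qed.

Lemma norm_sum_orthonormal (a : I -> R) :
  `|\sum_i a i *: e i| ^+ 2 = \sum_i a i ^+ 2.
Proof.
rewrite -hilb linear_sumlz; apply: eq_bigr => i _.
by rewrite linearZl_LR /= ip_sum_orthonormal -expr2.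
Qed.

Lemma norm_sub_proj (x : V) :
  `|x - \sum_i ip (e i) x *: e i| ^+ 2
  = `|x| ^+ 2 - \sum_i ip (e i) x ^+ 2.
Proof.
rewrite normD_sq normrN norm_sum_orthonormal linearNr linear_sumr /=.
under eq_bigr do rewrite linearZr_LR /= (ipC x) -expr2.
by ring.
Qed.

Lemma bessel (x : V) : \sum_i ip (e i) x ^+ 2 <= `|x| ^+ 2.
Proof. by rewrite -subr_ge0 -norm_sub_proj sqr_ge0. Qed.

(** The two squared norms differ by the sum of the squares of [ip (e i) x - a i]. *)
Lemma norm_sub_proj_le (x : V) (a : I -> R) :
  `|x - \sum_i ip (e i) x *: e i| <= `|x - \sum_i a i *: e i|.
Proof.
rewrite -ler_sqr ?nnegrE// norm_sub_proj normD_sq normrN norm_sum_orthonormal.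
rewrite linearNr linear_sumr /= -addrA lerD2l mulrN mulr_sumr -!sumrN -big_split.
apply: ler_sum => i _ /=; rewrite linearZr_LR /= (ipC x).
have := sqr_ge0 (ip (e i) x - a i); nra.
Qed.

End orthonormal.

Lemma hsum_fset (S : set V) (A : {fset V}) (f : V -> V) :
  (forall h, S h -> h \notin A -> f h = 0) ->
  hsum S f = \sum_(i : A) (if fsval i \in S then f (fsval i) else 0).
Proof.
move=> f0; rewrite /hsum /summability.sum.
apply/cvg_lim => //; first exact: totally_filter.
(* Beyond [A] the net of partial sums is constant. *)
have TF := @totally_filter V; apply: cvg_near_cst; exists A => // B /= AB.
rewrite /partial_sum.
rewrite -!(big_seq_fsetE _ _ predT (fun h => if h \in S then f h else 0)).
rewrite -(big_fset_incl _ AB)// => h hB hA.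
by case: ifPn => //; rewrite inE => Sh; exact: f0.
Qed.

Lemma onb_proj_fset (A : {fset V}) x :
  onb_proj ip [set` A] x = \sum_(i : A) ip (fsval i) x *: fsval i.
Proof.
rewrite /onb_proj (@hsum_fset _ A); last by move=> h /= ->.
by apply: eq_bigr => i _; rewrite mem_set//=; exact: fsvalP.
Qed.

Section basis.
Context (S : set V) (oS : forall h k, S h -> S k -> ip h k = (h == k)%:R).

Lemma orthonormal_fset (A : {fset V}) : [set` A] `<=` S ->
  forall i j : A, ip (fsval i) (fsval j) = (i == j)%:R.
Proof. by move=> AS i j; rewrite oS ?val_eqE//; apply: AS => /=; exact: fsvalP. Qed.

Section coefficients.
Context (a : V -> R).
Let F h := if h \in S then a h *: h else 0.

Let norm_partial (B : {fset V}) :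
  `|\sum_(h <- B) F h| ^+ 2 = \sum_(h <- B | h \in S) a h ^+ 2.
Proof.
rewrite -big_mkcond /= [in LHS]big_fset_condE [in RHS]big_fset_condE.
rewrite !big_seq_fsetE /= norm_sum_orthonormal//.
by apply: orthonormal_fset => h /=; rewrite !inE => /andP[_ /set_mem].
Qed.

Hypothesis a2 : (\esum_(h in S) ((a h) ^+ 2)%:E < +oo)%E.

(** By completeness a Cauchy argument suffices: once a finite [A] reaches the sum of squares up to
    [e ^+ 2], the terms of a larger partial sum outside [A] have norm below [e], by
    orthonormality. *)
Lemma hsum_cvg : cvg (partial_sum F @ totally).
Proof.
have TF := @totally_filter V.
have s0 : (0 <= \esum_(h in S) ((a h) ^+ 2)%:E)%E.
  by apply: esum_ge0 => h _; rewrite lee_fin sqr_ge0.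
have sfin : \esum_(h in S) ((a h) ^+ 2)%:E \is a fin_num.
  by rewrite ge0_fin_numE.
apply/cauchy_cvgP/cauchy_exP => e e0.
have e20 : 0 < e ^+ 2 by rewrite exprn_gt0.
have [_ [A [finA AS] <-]] := ub_ereal_sup_adherent e20 sfin.
rewrite -/(esum _ _) => sA.
pose X := fset_set A.
exists (partial_sum F X); exists X => // B /= XB.
rewrite -ball_normE /= /partial_sum distrC.
rewrite -!(big_seq_fsetE _ _ predT F) /=.
have XBE : [fset x in B | x \in X]%fset = X.
  apply/fsetP => x; rewrite !inE/=; apply/andP/idP => [[]//|xX]; split => //.
  exact: (fsubsetP XB).
rewrite (big_fsetID _ (mem X)) /= XBE addrAC subrr add0r.
rewrite -ltr_sqr ?nnegrE ?(ltW e0)// norm_partial.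
have : ((\sum_(h <- B | h \in S) a h ^+ 2)%:E <=
    \esum_(h in S) ((a h) ^+ 2)%:E)%E.
  apply: esum_ge; exists [set` [fset i in B | i \in S]%fset].
    by split => // h /=; rewrite !inE => /andP[_ /set_mem].
  by rewrite big_fset_condE fsbig_finite//= set_fsetK sumEFin.
rewrite (big_fsetIDcond _ (mem X)) /= XBE.
have -> : \sum_(i <- X | i \in S) a i ^+ 2 = \sum_(i <- X) a i ^+ 2.
  rewrite big_seq_cond [RHS]big_seq_cond; apply: eq_bigl => i.
  rewrite andbT; case: (boolP (i \in X)) => //=.
  by rewrite in_fset_set// => /set_mem /AS Si; rewrite mem_set.
move: sA; rewrite fsbig_finite//= -/X sumEFin.
rewrite -(fineK sfin) -EFinB lte_fin lee_fin => H1 H2.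
rewrite -(ltrD2l (\sum_(i <- X) a i ^+ 2)); apply: le_lt_trans H2 _.
by rewrite -ltrBlDr.
Qed.

Lemma ip_hsum k : S k -> ip k (hsum S (fun h => a h *: h)) = a k.
Proof.
move=> Sk; have TF := @totally_filter V.
have /(continuous_cvg _ (@ip_continuous k _)) H1 := hsum_cvg.
have H2 : ip k (partial_sum F B) @[B --> totally] --> a k.
  apply: cvg_near_cst; exists [fset k]%fset => // B /= kB.
  have kinB : k \in B by apply: (fsubsetP kB); rewrite inE.
  rewrite /partial_sum -(big_seq_fsetE _ _ predT F) /= linear_sumr.
  rewrite (big_fsetD1 k)//= /F mem_set//= linearZr_LR /= oS// eqxx mulr1.
  rewrite big_seq big1 ?addr0// => h; rewrite !inE => /andP[hk _].
  case: ifPn => [/set_mem Sh|_]; last by rewrite linear0r.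
  by rewrite linearZr_LR /= oS// eq_sym (negbTE hk) mulr0.
exact: cvg_unique H1 H2.
Qed.

End coefficients.
End basis.
End inner_product.

(** * Borel sets of interpolation and Hilbert-Schmidt spaces *)

Section measurability.
Context {R : realType}.

(** The Borel sets of the line have the open intervals as generators, and these are open sets. *)
Lemma measurable_sub_open_sigma :
  (@measurable _ (measurableTypeR R)) `<=` <<s (@open R) >>.
Proof.
rewrite measurable_realfun.RGenOpens.measurableE; apply: sub_sigma_algebra2 => A [x [y ->]].
exact: interval_open.
Qed.

Lemma measurable_wrt_trans (aT bT cT : Type) (X : set aT) (Y : set bT) SA SB SC
    (f : aT -> bT) (g : bT -> cT) :
  measurable_wrt X SA SB f -> measurable_wrt Y SB SC g ->
  (forall x, X x -> Y (f x)) -> measurable_wrt X SA SC (g \o f).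
Proof.
move=> mf mg XY _ [C SCC <-].
have -> : X `&` (g \o f) @^-1` C = X `&` f @^-1` (Y `&` g @^-1` C).
  by apply/seteqP; split=> x [Xx] /=; [split => //; split => //; exact: XY|case].
by apply: mf; exists (Y `&` g @^-1` C) => //; apply: mg; exists C.
Qed.

Lemma measurable_wrt_real (aT : Type) (X : set aT) (G : set_system aT)
    (f : aT -> R) :
  (forall O : set R, open O -> G (X `&` f @^-1` O)) ->
  measurable_wrt X <<s X, G >> (@measurable _ (measurableTypeR R)) f.
Proof.
move=> fO _ [A mA <-].
have sA := sigma_algebra_image f (smallest_sigma_algebra X G).
have /(_ _) sub : <<s (@open R) >> `<=` image_set_system X f <<s X, G >>.
  apply: smallest_sub => // O oO.
  by rewrite /image_set_system /=; apply: sub_sigma_algebra; exact: fO.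
exact: (sub _ (measurable_sub_open_sigma mA)).
Qed.

(** A function that is Lipschitz for [N] pulls open sets back to members of [norm_open]. This
    reduces measurability for the norms of H_gamma and of HS(U,H) to that of real coordinates. As
    [C] may vanish, the radius is divided by [C + 1]. *)
Lemma measurable_wrt_normL (V : zmodType) (X : set V) (N : V -> R) (f : V -> R)
    (C : R) : 0 <= C -> (forall x, 0 <= N x) ->
  (forall x y, X x -> X y -> `|f y - f x| <= C * N (y - x)) ->
  measurable_wrt X (norm_borel X N) (@measurable _ (measurableTypeR R)) f.
Proof.
move=> C0 N0 fC; apply: measurable_wrt_real => O oO; split; first by move=> x [].
move=> x [Xx /= Ofx].
have /nbhs_ballP[e /= e0 He] : nbhs (f x) O by exact: open_nbhs_nbhs.
have C1 : 0 < C + 1 by rewrite ltr_wpDl.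
exists (e / (C + 1)); first by rewrite divr_gt0.
move=> y Xy Nyx; split => //; apply: He; rewrite -ball_normE /= distrC.
apply: le_lt_trans (fC _ _ Xx Xy) _; rewrite ltr_pdivlMr// in Nyx.
by apply: le_lt_trans Nyx; rewrite mulrC ler_wpM2l// lerDl.
Qed.

Lemma measurable_wrt_continuous (T : topologicalType) (f : T -> R) :
  continuous f ->
  measurable_wrt setT <<s (@open T) >> (@measurable _ (measurableTypeR R)) f.
Proof.
move=> /continuousP cf; apply: measurable_wrt_real => O oO.
by rewrite setTI; exact: cf.
Qed.

End measurability.

Section square_summable.
Context {R : realType} (T : choiceType) (S : set T).

Lemma esum_sqrB_lty (a b : T -> R) :
  (\esum_(h in S) (a h ^+ 2)%:E < +oo)%E ->
  (\esum_(h in S) (b h ^+ 2)%:E < +oo)%E ->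
  (\esum_(h in S) ((a h - b h) ^+ 2)%:E < +oo)%E.
Proof.
move=> a2 b2.
apply: (@le_lt_trans _ _ (\esum_(h in S)
   (((a h ^+ 2)%:E + (a h ^+ 2)%:E) + ((b h ^+ 2)%:E + (b h ^+ 2)%:E)))%E).
  apply: le_esum => h _; rewrite -!EFinD lee_fin.
  by have := sqr_ge0 (a h + b h); nra.
have p (c : T -> R) h : S h -> (0 <= (c h ^+ 2)%:E)%E.
  by rewrite lee_fin sqr_ge0.
have pp (c : T -> R) h : S h -> (0 <= (c h ^+ 2)%:E + (c h ^+ 2)%:E)%E.
  by move=> Sh; rewrite adde_ge0//; exact: p.
rewrite esumD//; [|exact: pp|exact: pp].
rewrite !esumD//; do ?by exact: p.
by rewrite !lte_add_pinfty.
Qed.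

Lemma esum_finite_lty (A : {fset T}) (a : T -> R) :
  (forall h, S h -> h \notin A -> a h = 0) ->
  (\esum_(h in S) (a h ^+ 2)%:E < +oo)%E.
Proof.
move=> a0; rewrite (esumID [set` A]); last first.
  by move=> i _; rewrite lee_fin sqr_ge0.
rewrite [X in (_ + X)%E]esum1; last first.
  by move=> h [Sh /= /negP hA]; rewrite a0// expr0n.
rewrite adde0 esum_fset; last first.
- by move=> i _; rewrite lee_fin sqr_ge0.
- by apply: finite_setIr; exact: finite_fset.
rewrite fsbig_finite/=; last by apply: finite_setIr; exact: finite_fset.
by rewrite sumEFin ltry.
Qed.

End square_summable.

Section diagonal_operators.
Context {R : realType} (V : completeNormedModType R) (ip : {dot V for idfun}).
Hypothesis hilb : hilbert ip.
Context (S : set V) (oS : forall h k, S h -> S k -> ip h k = (h == k)%:R).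
Context (lam : V -> R).

Lemma diag_domB (phi : R -> R) x y :
  diag_dom ip S lam phi x -> diag_dom ip S lam phi y ->
  diag_dom ip S lam phi (x - y).
Proof.
move=> xd yd; rewrite /diag_dom /=.
under eq_esum do rewrite linearBr mulrBr.
exact: esum_sqrB_lty.
Qed.

Lemma diag_dom_span (phi : R -> R) (A : {fset V}) x :
  (forall h, S h -> h \notin A -> ip h x = 0) -> diag_dom ip S lam phi x.
Proof.
move=> x0; apply: (@esum_finite_lty _ _ _ A) => h Sh hA.
by rewrite x0// mulr0.
Qed.

Lemma diag_op_coord (phi : R -> R) x k : S k -> diag_dom ip S lam phi x ->
  `|phi (lam k) * ip k x| <= `|diag_op ip S lam phi x|.
Proof.
move=> Sk xd; rewrite -(ip_hsum hilb oS xd Sk).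
apply: le_trans (ip_le_norm hilb _ _) _.
suff -> : `|k| = 1 by rewrite mul1r.
by apply/eqP; rewrite -sqrp_eq1// -hilb oS// eqxx.
Qed.

Lemma diag_op_span (phi : R -> R) (A : {fset V}) x : [set` A] `<=` S ->
  (forall h, S h -> h \notin A -> ip h x = 0) ->
  diag_op ip S lam phi x =
  \sum_(i : A) (phi (lam (fsval i)) * ip (fsval i) x) *: fsval i.
Proof.
move=> AS x0; rewrite /diag_op (@hsum_fset _ _ _ A).
  by apply: eq_bigr => i _; rewrite mem_set//; apply: AS; exact: fsvalP.
by move=> h Sh hA; rewrite x0// mulr0 scale0r.
Qed.

Section interpolation_space.
Context (r : R) (lam_lt0 : forall h, S h -> lam h < 0).
Local Notation Hr := (interp_space ip S lam r).
Local Notation Nr := (interp_norm ip S lam r).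

(** The Lipschitz constant is the reciprocal of the eigenvalue of (-A)^r at [k], which is positive
    because [lam k < 0]. *)
Lemma measurable_ip_interp k : S k ->
  measurable_wrt Hr (norm_borel Hr Nr) (@measurable _ (measurableTypeR R))
    (ip k).
Proof.
move=> Sk; apply: (@measurable_wrt_normL _ _ _ _ _ ((- lam k) `^ r)^-1).
- by rewrite invr_ge0 powR_ge0.
- by move=> x; rewrite normr_ge0.
move=> x y Hx Hy; rewrite -linearBr.
have p : 0 < (- lam k) `^ r by rewrite powR_gt0// oppr_gt0 lam_lt0.
rewrite ler_pdivlMl//.
have := diag_op_coord Sk (diag_domB Hy Hx).
by rewrite normrM (gtr0_norm p).
Qed.

End interpolation_space.
End diagonal_operators.

Lemma measurable_ip_hs {R : realType} (U V : completeNormedModType R)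
    (ip : {dot V for idfun}) (hilb : hilbert ip) (UU : set U) k u : UU u ->
  measurable_wrt (hs_op (H := V) UU) (norm_borel (hs_op UU) (hs_norm UU))
    (@measurable _ (measurableTypeR R)) (fun L => ip k (L u)).
Proof.
move=> UUu; apply: (@measurable_wrt_normL _ _ _ _ _ `|k|) => //.
  by move=> L; exact: sqrtr_ge0.
move=> L M [_ _ L2] [_ _ M2].
rewrite -linearBr; apply: le_trans (ip_le_norm hilb _ _) _.
rewrite ler_wpM2l// -ler_sqr ?nnegrE ?sqrtr_ge0//.
set N : U -> V := M - L; rewrite -[M u - L u]/(N u).
have N0 : (0 <= hs_normsq UU N)%E.
  by apply: esum_ge0 => v _; rewrite lee_fin sqr_ge0.
(* Finiteness matters because [hs_norm] reads [+oo] as 0. The minus sign in front of the norm of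
   [L v] turns the bound for differences into one for the sum of the two norms. *)
have fin : (hs_normsq UU N < +oo)%E.
  have H := @esum_sqrB_lty _ _ UU (fun v => `|M v|) (fun v => - `|L v|) M2.
  apply: le_lt_trans (H _); last by under eq_esum do rewrite sqrrN.
  apply: le_esum => v _; rewrite lee_fin ler_sqr ?nnegrE ?opprK ?addr_ge0//.
  exact: ler_normB.
rewrite sqr_sqrtr ?fine_ge0// -lee_fin fineK ?ge0_fin_numE//.
apply: esum_ge; exists [set u]; last by rewrite fsbig_set1.
by split => // v ->.
Qed.
(** * Gaussian integrals and Wiener increments *)

Section density.
Context d (T : measurableType d) (R : realType).
Variables (mu nu : {measure set T -> \bar R}) (g : T -> R).
Hypotheses (mg : measurable_fun setT g) (g0 : forall x, 0 <= g x).
Hypothesis nuE : forall A, measurable A -> nu A = (\int[mu]_(x in A) (g x)%:E)%E.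
Local Open Scope ereal_scope.
Import HBNNSimple.

Let integral_density_nnsfun (h : {nnsfun T >-> R}) :
  \int[nu]_x (h x)%:E = \int[mu]_x ((h x)%:E * (g x)%:E).
Proof.
rewrite integralT_nnsfun sintegralE.
transitivity (\int[mu]_x (\sum_(y \in range h)
    (y * \1_(h @^-1` [set y]) x)%:E * (g x)%:E)).
  rewrite ge0_integral_fsum//; last 2 first.
  - move=> y; apply: emeasurable_funM; apply/measurable_EFinP => //.
    by apply: measurable_funM => //; exact: measurable_indic.
  - move=> y x _; rewrite mule_ge0// ?lee_fin//.
    exact: nnfun_muleindic_ge0.
  apply: eq_fsbigr => y /set_mem [x _ <-].
  under eq_integral do rewrite EFinM -muleA.
  rewrite ge0_integralZl//; last 3 first.
  - by apply: emeasurable_funM; apply/measurable_EFinP.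
  - by move=> z _; rewrite mule_ge0// lee_fin.
  - by rewrite lee_fin.
  congr (_ * _); rewrite nuE// integral_mkcond.
  apply: eq_integral => z _; rewrite patchE indicE.
  by case: ifPn => hz; rewrite ?mul1e ?mul0e.
apply: eq_integral => x _.
rewrite -ge0_mule_fsuml => [|y]; last exact: nnfun_muleindic_ge0.
by rewrite fsumEFin// -fimfunE.
Qed.

(** Serves twice as a change of measure: with a Gaussian density, and with the indicator of an event
    as density of the restricted measure. *)
Lemma integral_density (f : T -> \bar R) : (forall x, 0 <= f x) ->
  measurable_fun setT f ->
  \int[nu]_x f x = \int[mu]_x (f x * (g x)%:E).
Proof.
move=> f0 mf; pose h := nnsfun_approx measurableT mf.
have -> : \int[nu]_x f x = lim (\int[nu]_x (EFin \o h n) x @[n --> \oo]).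
  have fE x : f x = lim ((EFin \o h n) x @[n --> \oo]).
    by apply/esym/cvg_lim => //; exact: cvg_nnsfun_approx.
  under eq_integral => x _ do rewrite fE.
  apply: monotone_convergence => //.
  - by move=> n; apply/measurable_EFinP.
  - by move=> n x _ /=; rewrite lee_fin.
  - by move=> x _ a b ab; rewrite lee_fin; exact/lefP/nd_nnsfun_approx.
have -> : \int[mu]_x (f x * (g x)%:E) =
    lim (\int[mu]_x ((EFin \o h n) x * (g x)%:E) @[n --> \oo]).
  have fg x : f x * (g x)%:E = lim ((EFin \o h n) x * (g x)%:E @[n --> \oo]).
    by apply/esym/cvg_lim => //; apply: cvgeZr => //; exact: cvg_nnsfun_approx.
  under eq_integral => x _ do rewrite fg.
  apply: monotone_convergence => //.
  - by move=> n; apply/emeasurable_funM; apply/measurable_EFinP.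
  - by move=> n x _ /=; rewrite mule_ge0 ?lee_fin.
  - move=> x _ a b ab/=; rewrite lee_wpmul2r ?lee_fin//.
    exact/lefP/nd_nnsfun_approx.
by under eq_fun do rewrite /= integral_density_nnsfun.
Qed.

End density.

Section normal_integrals.
Context {R : realType} (s : R) (s0 : 0 < s).
Local Notation N := (normal_prob 0 s).
Local Notation mu := (@lebesgue_measure R).

Lemma integral_normal_prob (f : R -> R) : (forall x, 0 <= f x) ->
  measurable_fun setT f ->
  (\int[N]_x (f x)%:E = \int[mu]_x (f x * normal_pdf 0 s x)%:E)%E.
Proof.
move=> f0 mf.
rewrite (@integral_density _ _ _ mu _ (normal_pdf 0 s))//.
- exact: measurable_normal_pdf.
- by move=> x; exact: normal_pdf_ge0.
- by apply/measurable_EFinP.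
Qed.

Let mul_integral_pdf (c m s' : R) : 0 <= c ->
  (\int[mu]_x (c * normal_pdf m s' x)%:E = c%:E)%E.
Proof.
move=> c0; under eq_integral do rewrite EFinM.
rewrite ge0_integralZl//.
- by rewrite integral_normal_pdf mule1.
- by apply/measurable_EFinP; exact: measurable_normal_pdf.
- by move=> x _; rewrite lee_fin normal_pdf_ge0.
Qed.

Lemma normal_exp : (\int[N]_x (expR x)%:E = (expR (s ^+ 2 / 2))%:E)%E.
Proof.
rewrite integral_normal_prob; [|by move=> x; exact: expR_ge0|by []].
(* Completing the square: the integrand is exp(s^2/2) times the density with mean s^2 and standard
   deviation s. *)
rewrite -(mul_integral_pdf (s ^+ 2) s (expR_ge0 _)).
apply: eq_integral => x _; congr EFin.
rewrite !normal_pdfE ?gt_eqF// /normal_fun !mulrA ![_ * normal_peak _]mulrC.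
rewrite -!mulrA -!expRD; congr (_ * expR _).
by field; rewrite gt_eqF.
Qed.

(* Tilting by exp (th x^2 / s^2) turns N(0, s^2) into a multiple of
   N(0, s^2 / (1 - 2 th)). *)
Lemma normal_exp_sq (th : R) : th < 1 / 2 ->
  (\int[N]_x (expR (th * (x / s) ^+ 2))%:E = ((Num.sqrt (1 - 2 * th))^-1)%:E)%E.
Proof.
move=> th2; have t0 : 0 < 1 - 2 * th by lra.
set r := Num.sqrt (1 - 2 * th); have r0 : 0 < r by rewrite sqrtr_gt0.
have r2 : r ^+ 2 = 1 - 2 * th by rewrite sqr_sqrtr// ltW.
rewrite integral_normal_prob; last 2 first.
- by move=> x; exact: expR_ge0.
- apply: measurableT_comp => //; apply: measurable_funM => //.
  by apply: measurable_funX; exact: measurable_funM.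
have r1 : 0 <= r^-1 by rewrite invr_ge0 ltW.
apply: (etrans _ (mul_integral_pdf 0 (s / r) r1)).
apply: eq_integral => x _; congr EFin.
rewrite !normal_pdfE ?gt_eqF ?divr_gt0// /normal_fun.
rewrite mulrCA -expRD [RHS]mulrA; congr (_ * expR _).
  rewrite /normal_peak -invfM; congr (_^-1).
  have e : s ^+ 2 * pi *+ 2 = r ^+ 2 * ((s / r) ^+ 2 * pi *+ 2).
    by field; rewrite gt_eqF.
  by rewrite e sqrtrM ?sqr_ge0// sqrtr_sqr (gtr0_norm r0).
have -> : th = (1 - r ^+ 2) / 2 by rewrite r2; field.
by field; rewrite !gt_eqF.
Qed.

(** At th = 1/4 the exact value is the square root of 2, rounded up to 2. *)
Lemma normal_exp_sq4_le : (\int[N]_x (expR ((x / s) ^+ 2 / 4))%:E <= 2%:E)%E.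
Proof.
under eq_integral do rewrite mulrC.
rewrite normal_exp_sq; last lra.
have -> : 1 - 2 * 4^-1 = 2^-1 :> R by field.
rewrite sqrtrV ?invrK ?lee_fin// -ler_sqr ?nnegrE ?sqrtr_ge0//.
by rewrite sqr_sqrtr//; lra.
Qed.

(** The variance is the first-order term in th of the tilted integral: 1 + th x^2/s^2 <= exp(th
    x^2/s^2), whose mean (1 - 2 th)^(-1/2) is at most 1 + th + 3 th^2 for th <= 1/4. Dividing by th
    leaves the error 3 th s^2, and th is chosen to keep it below e. *)
Lemma normal_sq_le : (\int[N]_x (x ^+ 2)%:E <= (s ^+ 2)%:E)%E.
Proof.
apply/lee_addgt0Pr => e e0.
pose th := Num.min (1 / 4) (e / (3 * s ^+ 2)).
have s2 : 0 < s ^+ 2 by rewrite exprn_gt0.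
have th0 : 0 < th by rewrite lt_min; apply/andP; split; [lra|rewrite divr_gt0// mulr_gt0].
have th4 : th <= 1 / 4 by rewrite ge_min lexx.
have the : 3 * s ^+ 2 * th <= e.
  by rewrite mulrC -ler_pdivlMr ?mulr_gt0// ge_min lexx orbT.
set M := (\int[N]_x (x ^+ 2)%:E)%E.
have mx2 : measurable_fun [set: R] (fun x : R => (x ^+ 2)%:E).
  by apply/measurable_EFinP; exact: measurable_funX.
have M0 : (0 <= M)%E by apply: integral_ge0 => x _; rewrite lee_fin sqr_ge0.
have c0 : 0 < th / s ^+ 2 by rewrite divr_gt0.
have H : (1 + (th / s ^+ 2)%:E * M <= (1 + th + 3 * th ^+ 2)%:E)%E.
  apply: (@le_trans _ _ (\int[N]_x (expR (th * (x / s) ^+ 2))%:E)%E).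
    have -> : 1%E = (\int[N]_x (cst 1%E) x)%E.
      by rewrite integral_cst//= mul1e probability_setT.
    rewrite -ge0_integralZl ?lee_fin ?(ltW c0)//; last first.
      by move=> x _; rewrite lee_fin sqr_ge0.
    rewrite -ge0_integralD//; last 2 first.
    - by move=> x _; rewrite mule_ge0 ?lee_fin ?sqr_ge0 ?(ltW c0).
    - by apply: emeasurable_funM.
    apply: ge0_le_integral => //.
    - move=> x _; rewrite adde_ge0// mule_ge0 ?lee_fin ?sqr_ge0 ?(ltW c0)//.
    - by apply: emeasurable_funD => //; exact: emeasurable_funM.
    - apply/measurable_EFinP; apply: measurableT_comp => //.
      apply: measurable_funM => //; apply: measurable_funX.
      exact: measurable_funM.
    - move=> x _; rewrite -EFinM -EFinD lee_fin.
      apply: le_trans (expR_ge1Dx _); rewrite lerD2l expr_div_n.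
      by rewrite le_eqVlt; apply/orP; left; apply/eqP; field; rewrite gt_eqF.
  rewrite normal_exp_sq; last lra.
  have t0 : 0 < 1 - 2 * th by lra.
  rewrite lee_fin invf_ple ?posrE ?sqrtr_gt0//; last by nra.
  rewrite -ler_sqr ?nnegrE ?sqrtr_ge0 ?invr_ge0//; last by nra.
  rewrite sqr_sqrtr ?(ltW t0)// exprVn invf_ple ?posrE//; last by nra.
  rewrite -[leLHS]mul1r ler_pdivrMr//.
  (* This product equals (1 + th + 3 th^2)^2 (1 - 2 th) - 1. *)
  suff : 0 <= th ^+ 2 * (3 - 8 * th - 3 * th ^+ 2 - 18 * th ^+ 3) by nra.
  by rewrite mulr_ge0 ?sqr_ge0//; nra.
have Mfin : M \is a fin_num.
  rewrite ge0_fin_numE// ltNge leye_eq; apply/negP => /eqP My; move: H.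
  by rewrite My gt0_muley ?lte_fin// addey.
rewrite -(fineK Mfin) -EFinD lee_fin; move: H.
rewrite -(fineK Mfin) -EFinM -EFinD lee_fin; set m := fine M => H.
have {}H : th * (m - s ^+ 2) <= th * e.
  have : th / s ^+ 2 * m <= th + 3 * th ^+ 2 by lra.
  rewrite mulrAC ler_pdivrMr// => H1; nra.
by move: H; rewrite ler_pM2l// lerBlDl.
Qed.

End normal_integrals.

Section wiener_increments.
Context {R : realType} {d : measure_display} {Omega : measurableType d}.
Context (P : probability Omega R) (T : R) (Ft : R -> set_system Omega).
Hypothesis filtF : filtration T Ft.
Context (U : completeNormedModType R) (ipU : {dot U for idfun}).
Hypothesis hilbU : hilbert ipU.
Context (W : R -> U -> Omega -> R) (wienerW : cylindrical_wiener P T Ft W).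
Context (s t : R) (s0 : 0 <= s) (st : s < t) (tT : t <= T).

Let sT : 0 <= s <= T. Proof. by rewrite s0 (le_trans (ltW st)). Qed.
Let tT' : 0 <= t <= T. Proof. by rewrite tT (le_trans s0 (ltW st)). Qed.

Lemma filtration_measurable r : 0 <= r <= T -> Ft r `<=` measurable.
Proof. by move=> rT; have [/(_ r rT)[]] := filtF. Qed.

Lemma measurable_wiener r u : 0 <= r <= T -> measurable_fun setT (W r u).
Proof.
move=> rT _ A mA; apply: (filtration_measurable rT).
have mW := @cw_adapted _ _ _ _ _ _ _ _ wienerW _ rT u.
by apply: mW; exists A.
Qed.

Lemma wiener_sum (J : finType) (u : J -> U) (a : J -> R) r : 0 <= r <= T ->
  {ae P, forall w, W r (\sum_j a j *: u j) w = \sum_j a j * W r (u j) w}.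
Proof.
move=> rT; elim: (index_enum J) => [|j l IH].
  (* Linearity at 1, 0, 0 reads W(0) = W(0) + W(0) almost surely, so the empty sum gives 0. *)
  have := cw_linear wienerW rT 1 0 0; apply: filterS => w.
  rewrite !big_nil scaler0 addr0 mul1r => /eqP.
  by rewrite -subr_eq0 opprD addNKr oppr_eq0 => /eqP.
have := cw_linear wienerW rT (a j) (u j) (\sum_(i <- l) a i *: u i).
move: IH; apply: filterS2 => w IH.
by rewrite !big_cons => ->; rewrite IH.
Qed.

Section combination.
Context (J : finType) (u : J -> U).
Hypothesis ou : forall i j, ipU (u i) (u j) = (i == j)%:R.

Definition increment (a : J -> R) w := \sum_j a j * (W t (u j) w - W s (u j) w).

Lemma measurable_increment a : measurable_fun setT (increment a).
Proof.
apply: measurable_sum => j; apply: measurable_funM => //.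
by apply: measurable_funB; exact: measurable_wiener.
Qed.

Let s_ (a : J -> R) := Num.sqrt (t - s) * Num.sqrt (\sum_j a j ^+ 2).

Let increment_ae a : {ae P, forall w, increment a w =
  W t (\sum_j a j *: u j) w - W s (\sum_j a j *: u j) w}.
Proof.
move: (wiener_sum u a tT') (wiener_sum u a sT); apply: filterS2 => w -> ->.
by rewrite /increment -sumrB; apply: eq_bigr => j _; rewrite mulrBr.
Qed.

(** This takes the place of conditioning on [Ft s]. Law and independence are given for a single
    direction only, so the combination of increments is first identified almost surely with the
    increment along the vector with coordinates [a]. That vector has to be nonzero for its law to be
    prescribed. *)
Lemma integral_increment a (E : set Omega) (f : R -> R) : Ft s E ->
  0 < \sum_j a j ^+ 2 -> (forall x, 0 <= f x) -> measurable_fun setT f ->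
  (\int[P]_(w in E) (f (increment a w))%:E =
   P E * \int[normal_prob 0 (s_ a)]_x (f x)%:E)%E.
Proof.
move=> FE a0 f0 mf; have mE := filtration_measurable sT FE.
set v := \sum_j a j *: u j; set X := fun w => W t v w - W s v w.
have mX : measurable_fun setT X.
  by apply: measurable_funB; exact: measurable_wiener.
have nv : `|v| = Num.sqrt (\sum_j a j ^+ 2).
  by rewrite -(norm_sum_orthonormal hilbU ou) sqrtr_sqr ger0_norm.
have v0 : v != 0 by rewrite -normr_eq0 nv gt_eqF// sqrtr_gt0.
transitivity (\int[P]_(w in E) (f (X w))%:E)%E.
  apply: ae_eq_integral => //.
  - apply/measurable_EFinP/measurable_funTS; apply: measurableT_comp => //.
    exact: measurable_increment.
  - by apply/measurable_EFinP/measurable_funTS; exact: measurableT_comp.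
  - by move: (increment_ae a); apply: filterS => w + _; rewrite /= => ->.
pose PE : {measure set Omega -> \bar R} := mrestr P mE.
have PEE A : measurable A -> PE A = (\int[P]_(w in A) (\1_E w)%:E)%E.
  by move=> mA; rewrite integral_indic// /PE/= /mrestr setIC.
transitivity (\int[PE]_w (f (X w))%:E)%E.
  have mE1 : measurable_fun setT (\1_E : Omega -> R) by exact: measurable_indic.
  have mfX : measurable_fun setT (fun w => (f (X w))%:E).
    by apply/measurable_EFinP; exact: measurableT_comp.
  have fX0 w : (0 <= (f (X w))%:E)%E by rewrite lee_fin.
  have E0 w : 0 <= (\1_E w : R) by [].
  rewrite (@integral_density _ _ _ P PE _ mE1 E0 PEE _ fX0 mfX).
  transitivity (\int[P]_w ((fun w => (f (X w))%:E) \_ E) w)%E.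
    exact: integral_mkcond.
  apply: eq_integral => w _; rewrite patchE indicE.
  by case: ifPn; rewrite ?mule1 ?mule0.
pose X' : Omega -> measurableTypeR R := X.
have mX' : measurable_fun setT X' := mX.
have := @ge0_integral_pushforward _ _ _ _ _ X' mX' PE setT (fun x => (f x)%:E).
rewrite preimage_setT => <-//; last 2 first.
- exact/measurable_EFinP.
- by move=> x _; rewrite lee_fin.
have PE0 : 0 <= fine (P E) by rewrite fine_ge0.
have PEfin : P E \is a fin_num by exact: fin_num_measure.
(* Independence and normality identify the image under [X] of [P] restricted to [E] with [P E] times
   the Gaussian law. *)
transitivity (\int[mscale (NngNum PE0) (normal_prob 0 (s_ a))]_x (f x)%:E)%E.
  pose M := (pushforward PE X' : {measure set (measurableTypeR R) -> \bar R}).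
  apply: (@eq_measure_integral _ _ _ _ _ (M mX')) => A mA _.
  have -> : M mX' A = P (E `&` X @^-1` A).
    by rewrite /M /= /pushforward /PE /= /mrestr setIC.
  rewrite [RHS]/= /mscale /= fineK//.
  have := @cw_indep _ _ _ _ _ _ _ _ wienerW s t s0 st tT v E A FE mA.
  have := @cw_normal _ _ _ _ _ _ _ _ wienerW s t s0 st tT v v0 A mA.
  by rewrite nv => -> ->.
rewrite ge0_integral_mscale//=; first by rewrite fineK.
- exact/measurable_EFinP.
- by move=> x _; rewrite lee_fin.
Qed.

Let s_gt0 a : 0 < \sum_j a j ^+ 2 -> 0 < s_ a.
Proof. by move=> a0; rewrite mulr_gt0// sqrtr_gt0// subr_gt0. Qed.

Let s_sq a : s_ a ^+ 2 = (t - s) * \sum_j a j ^+ 2.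
Proof.
rewrite exprMn !sqr_sqrtr//; last by rewrite subr_ge0 ltW.
by rewrite sumr_ge0// => j _; rewrite sqr_ge0.
Qed.

Let increment0 a : \sum_j a j ^+ 2 <= 0 -> increment a = cst 0.
Proof.
move=> a0; apply/funext => w; rewrite /increment big1// => j _.
suff -> : a j = 0 by rewrite mul0r.
apply/eqP; rewrite -sqrf_eq0 eq_le sqr_ge0 andbT; apply: le_trans a0.
by rewrite (bigD1 j)//= lerDl sumr_ge0// => i _; rewrite sqr_ge0.
Qed.

Lemma increment_exp_le a E : Ft s E ->
  (\int[P]_(w in E) (expR (increment a w))%:E <=
   P E * (expR ((t - s) * (\sum_j a j ^+ 2) / 2))%:E)%E.
Proof.
move=> FE; have mE := filtration_measurable sT FE.
(* The case [a = 0] is split off, since the Gaussian law is prescribed in nonzero directions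
   only. *)
have [a0|a0] := leP (\sum_j a j ^+ 2) 0.
  rewrite increment0//= expR0 integral_cst// mul1e -[leLHS]mule1.
  rewrite lee_wpmul2l// lee_fin -expR0 ler_expR -s_sq divr_ge0// sqr_ge0//.
rewrite integral_increment//.
by rewrite normal_exp ?s_gt0// s_sq.
Qed.

Lemma increment_sq_le a E : Ft s E ->
  (\int[P]_(w in E) (increment a w ^+ 2)%:E <=
   P E * ((t - s) * (\sum_j a j ^+ 2))%:E)%E.
Proof.
move=> FE; have mE := filtration_measurable sT FE.
have [a0|a0] := leP (\sum_j a j ^+ 2) 0.
  rewrite increment0//= expr0n/= integral0.
  by rewrite mule_ge0// lee_fin -s_sq sqr_ge0.
rewrite (@integral_increment _ _ (fun x => x ^+ 2))//; last by exact: sqr_ge0.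
by rewrite lee_wpmul2l// -s_sq; apply: normal_sq_le; exact: s_gt0.
Qed.

(* For [a = 0] the quotient is [0 / 0 = 0], so the bound still holds. *)
Lemma increment_exp_sq_le a E : Ft s E ->
  (\int[P]_(w in E)
     (expR (increment a w ^+ 2 / (4 * ((t - s) * \sum_j a j ^+ 2))))%:E <=
   P E * 2%:E)%E.
Proof.
move=> FE; have mE := filtration_measurable sT FE.
have [a0|a0] := leP (\sum_j a j ^+ 2) 0.
  under eq_integral do rewrite increment0//= expr0n/= mul0r expR0.
  by rewrite integral_cst// mul1e -[leLHS]mule1 lee_wpmul2l// lee_fin; lra.
rewrite -s_sq; set f := fun x : R => expR ((x / s_ a) ^+ 2 / 4).
have -> : (\int[P]_(w in E) (expR (increment a w ^+ 2 / (4 * s_ a ^+ 2)))%:E =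
    \int[P]_(w in E) (f (increment a w))%:E)%E.
  apply: eq_integral => w _; rewrite /f; congr (expR _)%:E.
  by field; rewrite gt_eqF ?s_gt0.
rewrite integral_increment//; last 2 first.
- by move=> x; exact: expR_ge0.
- apply: measurableT_comp => //; apply: measurable_funM => //.
  by apply: measurable_funX; exact: measurable_funM.
by rewrite lee_wpmul2l//; apply: normal_exp_sq4_le; exact: s_gt0.
Qed.

End combination.
End wiener_increments.

(** * Pathwise bounds on the tamed exponential *)

Section one_step_inequalities.
Context {R : realType}.

Lemma sum_cauchy_schwarz (I : finType) (x y : I -> R) :
  (\sum_i x i * y i) ^+ 2 <= (\sum_i x i ^+ 2) * (\sum_i y i ^+ 2).
Proof.
set a := \sum_i x i ^+ 2; set b := \sum_i y i ^+ 2; set c := \sum_i x i * y i.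
have [a0|a0] := leP a 0.
  have x0 i : x i = 0.
    apply/eqP; rewrite -sqrf_eq0 eq_le sqr_ge0 andbT; apply: le_trans a0.
    by rewrite /a (bigD1 i)//= lerDl sumr_ge0// => j _; rewrite sqr_ge0.
  rewrite /a /c !big1 ?expr0n/= ?mul0r// => i _; rewrite x0 ?mul0r//.
  by rewrite expr0n.
have : 0 <= \sum_i (a * y i - c * x i) ^+ 2.
  by rewrite sumr_ge0// => i _; rewrite sqr_ge0.
have -> : \sum_i (a * y i - c * x i) ^+ 2 = a * (a * b - c ^+ 2).
  transitivity (\sum_i (a ^+ 2 * y i ^+ 2 - 2 * a * c * (x i * y i) +
      c ^+ 2 * x i ^+ 2)); first by apply: eq_bigr => i _; ring.
  rewrite big_split sumrB /= -!mulr_sumr -/a -/b -/c.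
  by ring.
by rewrite pmulr_rge0// subr_ge0.
Qed.

Lemma cube_le_expR (x : R) : 0 <= x -> x ^+ 3 <= 6 * expR x.
Proof.
move=> x0; have := expR_ge1Dxn 2 x0.
have -> : 3`!%:R = 6 :> R by [].
by rewrite -lerBrDl ler_pdivrMr// => H; lra.
Qed.

Lemma expR_tangent (x y : R) : expR x * (1 + (y - x)) <= expR y.
Proof.
by rewrite -[in leRHS](subrKC x y) expRD ler_wpM2l ?expR_ge0// expR_ge1Dx.
Qed.

Lemma expR_sum_le (I : finType) (p y : I -> R) :
  (forall i, 0 <= p i) -> \sum_i p i <= 1 ->
  expR (\sum_i p i * y i) <= \sum_i p i * expR (y i) + (1 - \sum_i p i).
Proof.
move=> p0 p1; set m := \sum_i p i * y i.
apply: (@le_trans _ _ (\sum_i p i * (expR m * (1 + (y i - m))) +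
    (1 - \sum_i p i) * (expR m * (1 + (0 - m))))).
  have -> : \sum_i p i * (expR m * (1 + (y i - m))) =
      expR m * ((1 - m) * \sum_i p i + m).
    rewrite {3}/m mulr_sumr -big_split mulr_sumr /=.
    by apply: eq_bigr => i _; ring.
  by rewrite le_eqVlt; apply/orP; left; apply/eqP; ring.
apply: lerD; first by apply: ler_sum => i _; rewrite ler_wpM2l// expR_tangent.
by rewrite -[leRHS]mulr1 ler_wpM2l ?subr_ge0// (le_trans (expR_tangent _ _))// expR0.
Qed.

Section truncated_exponential.
Context (I : finType) (v z : I -> R) (q V : R).
Hypotheses (q0 : 0 <= q) (V0 : 0 <= V) (vV : \sum_i v i ^+ 2 <= V ^+ 2).
Let r := \sum_i z i ^+ 2.
Let a := 2 * q * \sum_i v i * z i.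
Let L := 2 * q * V + q.

Let r0 : 0 <= r. Proof. by rewrite sumr_ge0// => i _; rewrite sqr_ge0. Qed.

(** With x the exponent on the left, the tangent at x gives e^x <= e^a + (x - a) e^x, and x - a <=
    |a| r + q r. The term q r has to keep the coefficient 1, because its mean is cancelled exactly
    by the integral in the exponent. Hence e^x is estimated there by 1 + m e^m with m = L sqrt(r),
    whereas e^m is enough next to |a| r. *)
Lemma expR_truncated_le :
  expR (q * \sum_i (2 * v i * (z i / (1 + r)) + (z i / (1 + r)) ^+ 2)) <=
  expR a + q * r + (1 + q) * L * Num.sqrt r ^+ 3 * expR (L * Num.sqrt r).
Proof.
set x := q * _; set rho := Num.sqrt r.
have rho0 : 0 <= rho by rewrite sqrtr_ge0.
have rhoE : rho ^+ 2 = r by rewrite sqr_sqrtr.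
have r1 : 0 < 1 + r by rewrite ltr_wpDr.
have xE : x = a / (1 + r) + q * (r / (1 + r) ^+ 2).
  rewrite /x big_split /= mulrDr; congr (_ + _).
    rewrite /a -!mulrA mulrCA; congr (_ * _).
    rewrite mulr_suml mulr_sumr; apply: eq_bigr => i _.
    by ring.
  by congr (_ * _); rewrite /r mulr_suml; apply: eq_bigr => i _; rewrite expr_div_n.
have a_le : `|a| <= 2 * q * V * rho.
  rewrite -ler_sqr ?nnegrE ?mulr_ge0// real_normK ?num_real// /a !exprMn rhoE.
  rewrite -[leRHS]mulrA ler_wpM2l ?mulr_ge0 ?sqr_ge0//.
  by apply: le_trans (sum_cauchy_schwarz v z) _; rewrite ler_wpM2r.
have rr : r / (1 + r) ^+ 2 <= rho.
  rewrite ler_pdivrMr ?exprn_gt0// -[leLHS]rhoE expr2 ler_wpM2l//.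
  have : 2 * rho <= 1 + r by have := sqr_ge0 (rho - 1); rewrite -rhoE; nra.
  nra.
have rr1 : 0 <= r / (1 + r) ^+ 2 <= r.
  rewrite divr_ge0 ?sqr_ge0//= ler_pdivrMr ?exprn_gt0//; nra.
have ar : `|a / (1 + r)| <= `|a|.
  by rewrite normrM normfV (gtr0_norm r1) ler_pdivrMr// ler_peMr// lerDl.
have Lrho : `|a| <= L * rho by apply: le_trans a_le _; rewrite /L [leRHS]mulrDl lerDl mulr_ge0.
have x_le : `|x| <= L * rho.
  rewrite xE (le_trans (ler_normD _ _))// [X in _ + X]ger0_norm; last first.
    by rewrite mulr_ge0//; case/andP: rr1.
  by rewrite /L [leRHS]mulrDl lerD ?ler_wpM2l// (le_trans ar).
have L0 : 0 <= L by rewrite /L addr_ge0// !mulr_ge0.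
have e1 := expR_tangent x a.
have xa : x - a <= `|a| * r + q * r.
  have -> : x - a = - a * (r / (1 + r)) + q * (r / (1 + r) ^+ 2).
    by rewrite xE; field; rewrite gt_eqF.
  apply: lerD; last by rewrite ler_wpM2l//; case/andP: rr1.
  apply: le_trans (ler_norm _) _; rewrite normrM normrN ler_wpM2l//.
  rewrite ger0_norm ?divr_ge0// ?(ltW r1)// ler_pdivrMr//; nra.
set m := L * rho.
have m0 : 0 <= m by rewrite mulr_ge0.
have ex : expR x <= expR m by rewrite ler_expR (le_trans (ler_norm _)).
have ex1 : expR x <= 1 + m * expR m.
  apply: le_trans ex _.
  have := expR_tangent m 0; rewrite expR0; lra.
have eX0 := expR_ge0 x; have em0 := expR_ge0 m.
have H1 : `|a| * r * expR x <= m * r * expR m.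
  by apply: ler_pM => //; [rewrite mulr_ge0|rewrite ler_wpM2r].
have H2 : q * r * expR x <= q * r * (1 + m * expR m).
  by rewrite ler_wpM2l// mulr_ge0.
have H3 : (x - a) * expR x <= (`|a| * r + q * r) * expR x.
  by rewrite ler_wpM2r.
have -> : (1 + q) * L * rho ^+ 3 * expR m = (1 + q) * m * r * expR m.
  by rewrite -rhoE /m; ring.
nra.
Qed.

Context (h th : R) (h0 : 0 < h) (th0 : 0 < th).

(** What remains of the error of order r^(3/2) after domination by exp(r / (4 th h)). With y =
    sqrt(r/h), the 6 comes from y^3 <= 6 e^y, and the exponent is the part of (1 + L sqrt h) y not
    covered by y^2 / (4 th). The rate 1 / (4 th h) is one at which Gaussian exponential moments stay
    below 2. *)
Definition truncation_error :=
  6 * (1 + q) * L * Num.sqrt h ^+ 3 * expR ((1 + L * Num.sqrt h) ^+ 2 * th).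

Lemma truncation_error_ge0 : 0 <= truncation_error.
Proof.
rewrite /truncation_error /L !mulr_ge0 ?expR_ge0 ?exprn_ge0 ?sqrtr_ge0//.
  by rewrite addr_ge0.
by rewrite addr_ge0// !mulr_ge0.
Qed.

Lemma expR_truncated_le_gauss :
  expR (q * \sum_i (2 * v i * (z i / (1 + r)) + (z i / (1 + r)) ^+ 2)) <=
  expR a + q * r + truncation_error * expR (r / (4 * th * h)).
Proof.
apply: le_trans expR_truncated_le _; rewrite lerD2l.
set rho := Num.sqrt r; set k := Num.sqrt h.
have k0 : 0 < k by rewrite sqrtr_gt0.
have kE : k ^+ 2 = h by rewrite sqr_sqrtr// ltW.
have rho0 : 0 <= rho by rewrite sqrtr_ge0.
have rhoE : rho ^+ 2 = r by rewrite sqr_sqrtr.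
have L0 : 0 <= L by rewrite /L addr_ge0// !mulr_ge0.
pose y := rho / k; have y0 : 0 <= y by rewrite divr_ge0// ltW.
have -> : rho = k * y by rewrite /y; field; rewrite gt_eqF.
have -> : r / (4 * th * h) = y ^+ 2 / (4 * th).
  by rewrite -rhoE -kE /y; field; rewrite !gt_eqF.
rewrite /truncation_error -/k exprMn.
have -> : (1 + q) * L * (k ^+ 3 * y ^+ 3) * expR (L * (k * y)) =
  ((1 + q) * L * k ^+ 3) * (y ^+ 3 * expR (L * k * y)) by rewrite !mulrA; ring.
have -> : 6 * (1 + q) * L * k ^+ 3 * expR ((1 + L * k) ^+ 2 * th) *
    expR (y ^+ 2 / (4 * th)) =
  ((1 + q) * L * k ^+ 3) *
    (6 * (expR ((1 + L * k) ^+ 2 * th) * expR (y ^+ 2 / (4 * th)))) by ring.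
have C0 : 0 <= (1 + q) * L * k ^+ 3.
  by rewrite mulr_ge0 ?exprn_ge0 ?(ltW k0)// mulr_ge0// addr_ge0.
rewrite (ler_wpM2l C0)// -expRD.
apply: (@le_trans _ _ (6 * expR y * expR (L * k * y))).
  by rewrite ler_wpM2r ?expR_ge0// cube_le_expR.
rewrite -mulrA -expRD ler_wpM2l// ler_expR.
set b := 1 + L * k; have -> : y + L * k * y = b * y by rewrite /b; ring.
(* AM-GM: [b y <= b^2 th + y^2 / (4 th)] *)
have -> : b ^+ 2 * th + y ^+ 2 / (4 * th) =
  b * y + (2 * th * b - y) ^+ 2 / (4 * th) by field; rewrite gt_eqF.
by rewrite lerDl divr_ge0 ?sqr_ge0// mulr_ge0// ltW.
Qed.

End truncated_exponential.
End one_step_inequalities.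

(** In vector form this is exp(q (|v + z/(1+|z|^2)|^2 - |v|^2)), the relative growth caused by the
    tamed noise. *)
Definition truncated_exp {R : realType} (I : finType) (q : R) (v z : I -> R) :=
  expR (q * \sum_i (2 * v i * (z i / (1 + \sum_k z k ^+ 2)) +
                    (z i / (1 + \sum_k z k ^+ 2)) ^+ 2)).

Section measurable_truncated_exp.
Context {R : realType} d (X : measurableType d).

(** For positive values the reciprocal is exp(-ln), a composition of measurable functions. *)
Lemma measurable_funV_gt0 (f : X -> R) : (forall x, 0 < f x) ->
  measurable_fun setT f -> measurable_fun setT (fun x => (f x)^-1).
Proof.
move=> f0 mf; have -> : (fun x => (f x)^-1) = (fun x => expR (- ln (f x))).
  by apply/funext => x; rewrite expRN lnK// posrE.
apply: measurableT_comp => //; apply: measurableT_comp => //.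
exact: measurableT_comp.
Qed.

Lemma measurable_truncated_exp (I : finType) (q : R) (v z : X -> I -> R) :
  (forall i, measurable_fun setT (v ^~ i)) ->
  (forall i, measurable_fun setT (z ^~ i)) ->
  measurable_fun setT (fun x => truncated_exp q (v x) (z x)).
Proof.
move=> mv mz; apply: measurableT_comp => //; apply: measurable_funM => //.
have md : measurable_fun setT (fun x => (1 + \sum_k z x k ^+ 2)^-1).
  apply: measurable_funV_gt0.
    by move=> x; rewrite ltr_wpDr// sumr_ge0// => i _; rewrite sqr_ge0.
  apply: measurable_funD => //; apply: measurable_sum => i.
  exact: measurable_funX.
apply: measurable_sum => i; apply: measurable_funD.
  by apply: measurable_funM; apply: measurable_funM.
by apply: measurable_funX; exact: measurable_funM.
Qed.

End measurable_truncated_exp.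

(** * Conditional Gaussian bounds for one step *)

Section mean_le.
Context {R : realType} {d : measure_display} {X : measurableType d}.
Context (P : probability X R) (E : set X) (mE : measurable E).

(** Required for every event [E] of a sigma-algebra, the inequality says that the conditional mean
    of [f] is at most [c]. The product form also covers null events; measurability and nonnegativity
    are included so that the bounds can be added and scaled. *)
Definition mean_le (f : X -> R) (c : R) :=
  [/\ measurable_fun setT f, forall x, 0 <= f x
    & (\int[P]_(x in E) (f x)%:E <= P E * c%:E)%E].

Lemma mean_leD f g a b : mean_le f a -> mean_le g b ->
  mean_le (fun x => f x + g x) (a + b).
Proof.
move=> [mf f0 fa] [mg g0 gb]; split.
- exact: measurable_funD.
- by move=> x; rewrite addr_ge0.
- rewrite EFinD muleDr ?fin_num_measure// -?ge0_adde_def ?inE//.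
  under eq_integral do rewrite EFinD.
  rewrite ge0_integralD//.
  + exact: leeD.
  + by move=> x _; rewrite lee_fin.
  + by apply/measurable_EFinP/measurable_funTS.
  + by move=> x _; rewrite lee_fin.
  + by apply/measurable_EFinP/measurable_funTS.
Qed.

Lemma mean_leZ k f a : 0 <= k -> mean_le f a ->
  mean_le (fun x => k * f x) (k * a).
Proof.
move=> k0 [mf f0 fa]; split.
- exact: measurable_funM.
- by move=> x; rewrite mulr_ge0.
- under eq_integral do rewrite EFinM.
  rewrite EFinM muleCA ge0_integralZl//; last 2 first.
  + by apply/measurable_EFinP/measurable_funTS.
  + by move=> x _; rewrite lee_fin.
  by rewrite lee_wpmul2l// lee_fin.
Qed.

Lemma mean_le_cst k : 0 <= k -> mean_le (cst k) k.
Proof.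
move=> k0; split => //.
by rewrite -[X in (X <= _)%E]/(\int[P]_(x in E) (cst k%:E) x)%E integral_cst// muleC.
Qed.

Lemma mean_le_sum (I : finType) (f : I -> X -> R) (a : I -> R) :
  (forall i, mean_le (f i) (a i)) ->
  mean_le (fun x => \sum_i f i x) (\sum_i a i).
Proof.
move=> fa; elim: (index_enum I) => [|i l IH].
  rewrite big_nil (_ : (fun _ => _) = cst 0); first exact: mean_le_cst.
  by apply/funext => x; rewrite big_nil.
rewrite big_cons (_ : (fun _ => _) = fun x => f i x + \sum_(j <- l) f j x).
  exact: mean_leD.
by apply/funext => x; rewrite big_cons.
Qed.

Lemma mean_le_trans (f g : X -> R) a b : measurable_fun setT f -> (forall x, 0 <= f x <= g x) ->
  mean_le g a -> a <= b -> mean_le f b.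
Proof.
move=> mf fg [mg g0 ga] ab; split => //; first by move=> x; case/andP: (fg x).
apply: (@le_trans _ _ (P E * a%:E)%E); last by rewrite lee_wpmul2l// lee_fin.
apply: le_trans ga; apply: ge0_le_integral => //.
- by move=> x _; rewrite lee_fin; case/andP: (fg x).
- by apply/measurable_EFinP/measurable_funTS.
- by apply/measurable_EFinP/measurable_funTS.
- by move=> x _; rewrite lee_fin; case/andP: (fg x).
Qed.

End mean_le.

Section one_step_constant.
Context {R : realType} {d : measure_display} {Omega : measurableType d}.
Context (P : probability Omega R) (T : R) (Ft : R -> set_system Omega).
Hypothesis filtF : filtration T Ft.
Context (U : completeNormedModType R) (ipU : {dot U for idfun}).
Hypothesis hilbU : hilbert ipU.
Context (W : R -> U -> Omega -> R) (wienerW : cylindrical_wiener P T Ft W).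
Context (s t : R) (s0 : 0 <= s) (st : s < t) (tT : t <= T).
Context (J : finType) (u : J -> U).
Hypothesis ou : forall i j, ipU (u i) (u j) = (i == j)%:R.
Local Notation incr := (increment W s t u).
Local Notation h := (t - s).

Let h0 : 0 < h. Proof. by rewrite subr_gt0. Qed.

Context (I : finType) (q V theta : R).
Hypotheses (q0 : 0 <= q) (V0 : 0 <= V) (theta0 : 0 <= theta).
(** The shift by 1 keeps the divisor positive when [theta = 0]; the weights [p] then sum to at most
    1. *)
Let th := theta + 1.
Let th0 : 0 < th. Proof. by rewrite ltr_wpDl. Qed.
Let C := truncation_error q V h th.
Let C0 : 0 <= C. Proof. exact: truncation_error_ge0. Qed.

(** The summands stem from the Gaussian exponential of 2q<v,Z>, from the mean of q |Z|^2, and from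
    the truncation error multiplied by the moment bound 2. *)
Definition one_step_bound (n : R) :=
  expR (2 * q ^+ 2 * h * theta * n + q * h * theta + 2 * C).

Section fixed_coefficients.
Context (v : I -> R) (S : I -> J -> R).
Hypotheses (vV : \sum_i v i ^+ 2 <= V ^+ 2)
  (Stheta : \sum_i \sum_j S i j ^+ 2 <= theta).

Let Z i w := incr (S i) w.
Let m i := \sum_j S i j ^+ 2.
Let p i := m i / th.
(** The coefficients that make 2q<v,Z> a single Wiener increment, so that one scalar Gaussian
    integral controls its exponential. *)
Let alpha j := 2 * q * \sum_i v i * S i j.

Let m0 i : 0 <= m i.
Proof. by rewrite sumr_ge0// => j _; rewrite sqr_ge0. Qed.

Let p0 i : 0 <= p i.
Proof. by rewrite divr_ge0// ltW. Qed.

Let p1 : \sum_i p i <= 1.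
Proof.
by rewrite -mulr_suml ler_pdivrMr// mul1r (le_trans Stheta)// lerDl.
Qed.

Let alpha_sq : \sum_j alpha j ^+ 2 <= 4 * q ^+ 2 * theta * \sum_i v i ^+ 2.
Proof.
have -> : \sum_j alpha j ^+ 2 = 4 * q ^+ 2 * \sum_j (\sum_i v i * S i j) ^+ 2.
  by rewrite mulr_sumr; apply: eq_bigr => j _; rewrite /alpha; ring.
rewrite -[leRHS]mulrA ler_wpM2l ?mulr_ge0 ?sqr_ge0//.
apply: (@le_trans _ _ (\sum_j (\sum_i v i ^+ 2) * (\sum_i S i j ^+ 2))).
  by apply: ler_sum => j _; exact: sum_cauchy_schwarz.
rewrite -mulr_sumr mulrC ler_wpM2r//; last by rewrite exchange_big.
by rewrite sumr_ge0// => i _; rewrite sqr_ge0.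
Qed.

Let sum_vZ w : 2 * q * (\sum_i v i * Z i w) = incr alpha w.
Proof.
rewrite /Z /increment /alpha.
under eq_bigr do rewrite mulr_sumr.
rewrite exchange_big mulr_sumr; apply: eq_bigr => j _ /=.
rewrite -[RHS]mulrA mulr_suml; congr (_ * _); apply: eq_bigr => i _; ring.
Qed.

Let bound w := expR (incr alpha w) + \sum_i q * Z i w ^+ 2 +
  (\sum_i C * p i * expR (Z i w ^+ 2 / (4 * (h * m i))) + C * (1 - \sum_i p i)).

(** The exponent r / (4 th h) is a combination of the one-dimensional exponents of the [Z i] with
    the weights [p i]. Jensen's inequality takes the sum out of the exponential, so the dependence
    between the coordinates does not enter. *)
Let truncated_exp_le_bound w : truncated_exp q v (Z ^~ w) <= bound w.
Proof.
apply: le_trans (@expR_truncated_le_gauss _ _ v (Z ^~ w) q V q0 V0 vV h th h0 th0) _.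
rewrite sum_vZ mulr_sumr lerD2l.
rewrite -/C; under [X in _ <= X + _]eq_bigr do rewrite -mulrA.
rewrite -mulr_sumr -mulrDr ler_wpM2l//.
have -> : (\sum_i Z i w ^+ 2) / (4 * th * h) =
    \sum_i p i * (Z i w ^+ 2 / (4 * (h * m i))).
  rewrite mulr_suml; apply: eq_bigr => i _.
  (* For [m i = 0] the coordinate [Z i] vanishes, and both sides are 0 in spite of the division by
     zero. *)
  have [mi0|mi0] := eqVneq (m i) 0.
    rewrite /p mi0 !mul0r /Z /increment big1 ?expr0n/= ?mul0r// => j _.
    suff -> : S i j = 0 by rewrite mul0r.
    apply/eqP; rewrite -sqrf_eq0 eq_le sqr_ge0 andbT -mi0 /m (bigD1 j)//=.
    by rewrite lerDl sumr_ge0// => k _; rewrite sqr_ge0.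
  by rewrite /p; field; rewrite mi0 !gt_eqF.
exact: expR_sum_le.
Qed.

Let mincr a : measurable_fun setT (incr a).
Proof. exact: (measurable_increment filtF wienerW s0 st tT). Qed.

Lemma mean_le_truncated_exp E : Ft s E ->
  mean_le P E (fun w => truncated_exp q v (fun i => incr (S i) w))
    (one_step_bound (\sum_i v i ^+ 2)).
Proof.
move=> FE; have mE : measurable E.
  by apply: (filtration_measurable filtF _ FE); rewrite s0 (le_trans (ltW st)).
set n := \sum_i v i ^+ 2; have n0 : 0 <= n.
  by rewrite sumr_ge0// => i _; rewrite sqr_ge0.
have H1 : mean_le P E (fun w => expR (incr alpha w))
    (expR (2 * q ^+ 2 * h * theta * n)).
  split; [|by move=> w; exact: expR_ge0|].
    apply: measurableT_comp => //; exact: mincr.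
  apply: le_trans (increment_exp_le filtF hilbU wienerW s0 st tT ou alpha FE) _.
  rewrite lee_wpmul2l// lee_fin ler_expR.
  have -> : 2 * q ^+ 2 * h * theta * n = h * (4 * q ^+ 2 * theta * n) / 2.
    by field.
  by rewrite ler_wpM2r ?invr_ge0// ler_wpM2l// ltW.
have H2 : mean_le P E (fun w => \sum_i q * Z i w ^+ 2) (\sum_i q * (h * m i)).
  apply: mean_le_sum => // i; apply: mean_leZ => //; split.
  - by apply: measurable_funX; exact: mincr.
  - by move=> w; rewrite sqr_ge0.
  - exact: (increment_sq_le filtF hilbU wienerW s0 st tT ou).
have H3 : mean_le P E (fun w => \sum_i C * p i * expR (Z i w ^+ 2 / (4 * (h * m i))))
    (\sum_i C * p i * 2).
  apply: mean_le_sum => // i; apply: mean_leZ; [by []|exact: mulr_ge0|split].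
  - apply: measurableT_comp => //; apply: measurable_funM => //.
    by apply: measurable_funX; exact: mincr.
  - by move=> w; exact: expR_ge0.
  - exact: (increment_exp_sq_le filtF hilbU wienerW s0 st tT ou).
have H4 : mean_le P E (cst (C * (1 - \sum_i p i))) (C * (1 - \sum_i p i)).
  by apply: mean_le_cst => //; rewrite mulr_ge0// subr_ge0.
apply: (mean_le_trans mE _ _ (mean_leD mE (mean_leD mE H1 H2) (mean_leD mE H3 H4))).
- by apply: measurable_truncated_exp => // i; exact: mincr.
- by move=> w; rewrite expR_ge0 truncated_exp_le_bound.
rewrite -mulr_suml -!mulr_sumr /one_step_bound -/C.
rewrite -[in leRHS]addrA [leRHS]expRD -addrA.
set x := 2 * q ^+ 2 * h * theta * n.
have x0 : 0 <= x by rewrite /x !mulr_ge0 ?sqr_ge0// ltW.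
have ex : 1 <= expR x by rewrite -expR0 ler_expR.
set y := q * h * theta + 2 * C.
have hm : q * (h * \sum_i m i) <= q * h * theta.
  by rewrite -[leRHS]mulrA ler_wpM2l// ler_wpM2l// ltW.
have hp : C * \sum_i p i <= C by rewrite -[leRHS]mulr1 ler_wpM2l.
have y0 : 0 <= y.
  by rewrite /y addr_ge0//; [rewrite !mulr_ge0// ltW|exact: mulr_ge0].
(* Since e^x >= 1 and y >= 0, e^x + y <= e^x (1 + y) <= e^(x+y). The additive errors thus become a
   factor that can be multiplied along the grid. *)
apply: (@le_trans _ _ (expR x + y)); first by rewrite /y; lra.
have := expR_ge1Dx y; nra.
Qed.

End fixed_coefficients.
End one_step_constant.

(** * Freezing random coefficients *)

Section truncate.
Context {R : realType}.

(* Rounding towards 0 to a multiple of [n.+1%:R^-1]; [Num.truncn] is 0 on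
   negative numbers. *)
Definition truncate_code (n : nat) (x : R) : nat * nat :=
  (Num.truncn (n.+1%:R * x), Num.truncn (n.+1%:R * - x)).

Definition decode (n : nat) (c : nat * nat) : R :=
  (c.1%:R - c.2%:R) / n.+1%:R.

Let truncate_nonneg n x : 0 <= x ->
  decode n (truncate_code n x) <= x /\
  x <= decode n (truncate_code n x) + n.+1%:R^-1 /\
  0 <= decode n (truncate_code n x).
Proof.
move=> x0; have n0 : 0 < n.+1%:R :> R by [].
rewrite /decode /truncate_code /=.
have -> : Num.truncn (n.+1%:R * - x) = 0%N.
  apply/eqP; rewrite -leqn0 truncn_le_nat mulrN.
  by rewrite (@le_lt_trans _ _ 0)// oppr_le0 mulr_ge0.
have /andP[h1 h2] : ((Num.truncn (n.+1%:R * x))%:R <= n.+1%:R * x <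
    (Num.truncn (n.+1%:R * x)).+1%:R)%R by apply: truncn_itv; rewrite mulr_ge0.
rewrite subr0; split; first by rewrite ler_pdivrMr// [leRHS]mulrC.
split; last by rewrite divr_ge0.
rewrite -[X in _ + X]div1r -mulrDl ler_pdivlMr// [leLHS]mulrC natr1.
exact: ltW.
Qed.

Let truncateN n x : decode n (truncate_code n (- x)) = - decode n (truncate_code n x).
Proof. by rewrite /decode /truncate_code /= opprK -mulNr opprB. Qed.

(** The reason for rounding towards 0: constraints and bounds that are monotone in the absolute
    values of the coefficients survive the discretisation. *)
Lemma norm_truncate_le n x : `|decode n (truncate_code n x)| <= `|x|.
Proof.
have [x0|x0] := leP 0 x.
  have [? [? ?]] := truncate_nonneg n x0.
  by rewrite (ger0_norm x0) ger0_norm.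
have x1 : 0 <= - x by rewrite oppr_ge0 ltW.
have [? [? ?]] := truncate_nonneg n x1.
by rewrite -normrN -truncateN -(normrN x) (ger0_norm x1) ger0_norm.
Qed.

Lemma dist_truncate_le n x : `|x - decode n (truncate_code n x)| <= n.+1%:R^-1.
Proof.
have H y : 0 <= y -> `|y - decode n (truncate_code n y)| <= n.+1%:R^-1.
  move=> y0; have [? [? ?]] := truncate_nonneg n y0.
  by rewrite ger0_norm ?subr_ge0// lerBlDl.
have [|x0] := leP 0 x; first exact: H.
have /H : 0 <= - x by rewrite oppr_ge0 ltW.
by rewrite truncateN -opprD normrN.
Qed.

Lemma truncate_cvg x : decode n (truncate_code n x) @[n --> \oo] --> x.
Proof.
apply/cvgrPdist_le => e e0; near=> n.
apply: le_trans (dist_truncate_le _ _) _; apply: ltW.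
by near: n; exact: (near_infty_natSinv_lt (PosNum e0)).
Unshelve. all: by end_near. Qed.

Let mf n : measurable_fun setT (fun x : R => (Num.truncn (n.+1%:R * x))%:R : R).
Proof.
apply: nondecreasing_measurable => // x y xy; rewrite ler_nat.
by apply: le_truncn; rewrite ler_wpM2l.
Qed.

Let mg n : measurable_fun setT (fun x : R => (Num.truncn (n.+1%:R * - x))%:R : R).
Proof. exact: (measurableT_comp (mf n)). Qed.

Lemma measurable_truncate n :
  measurable_fun setT (fun x : R => decode n (truncate_code n x)).
Proof.
apply: measurable_funM => //=; apply: measurable_funB; [exact: mf|exact: mg].
Qed.

Lemma measurable_truncate_code n c :
  measurable [set x : R | truncate_code n x = c].
Proof.
have -> : [set x : R | truncate_code n x = c] =
    (setT `&` (fun x : R => (Num.truncn (n.+1%:R * x))%:R : R) @^-1` [set c.1%:R])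
    `&` (setT `&` (fun x : R => (Num.truncn (n.+1%:R * - x))%:R : R) @^-1` [set c.2%:R]).
  apply/seteqP; split => [x /= <-//|x /= [[_ /eqP +] [_ /eqP]]].
  by rewrite !eqr_nat /truncate_code => /eqP -> /eqP ->; rewrite -surjective_pairing.
by apply: measurableI; [exact: mf|exact: mg].
Qed.
End truncate.

Lemma integral_cvg_le {R : realType} {d : measure_display}
    {Omega : measurableType d} (P : probability Omega R)
    (X_ : nat -> Omega -> R) (X : Omega -> R) (M : \bar R) :
  (forall n, measurable_fun setT (X_ n)) -> (forall n w, 0 <= X_ n w) ->
  (forall w, X_ n w @[n --> \oo] --> X w) ->
  (forall n, (\int[P]_w (X_ n w)%:E <= M)%E) -> (\int[P]_w (X w)%:E <= M)%E.
Proof.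
move=> mX X0 XX XM.
have -> : (\int[P]_w (X w)%:E = \int[P]_w limn_einf (fun n => (X_ n w)%:E))%E.
  apply: eq_integral => w _; apply/esym.
  have H : (X_ n w)%:E @[n --> \oo] --> (X w)%:E.
    by apply: cvg_EFin; [exact: nearW|exact: XX].
  by have [] := cvg_limn_einf_sup H.
apply: le_trans (fatou _ measurableT _ _) _.
- by move=> n; exact/measurable_EFinP.
- by move=> n w _; rewrite lee_fin.
rewrite limn_einf_lim; apply: lime_le; first exact: is_cvg_einfs.
apply: nearW => n; apply: le_trans (XM n).
by apply: ereal_inf_lbound; exists n => /=.
Qed.

Section freezing.
Context {R : realType} {d : measure_display} {Omega : measurableType d}.
Context (P : probability Omega R) (G : set_system Omega).
Hypotheses (sG : sigma_algebra setT G) (Gm : G `<=` measurable).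
Context (K : finType) (zeta : Omega -> K -> R).
Hypothesis mzeta : forall k (A : set R), measurable A -> G ((zeta ^~ k) @^-1` A).
Context (C : set (K -> R)) (Phi : (K -> R) -> Omega -> R) (g : (K -> R) -> R).
Hypothesis C_shrink : forall a b, C a -> (forall k, `|b k| <= `|a k|) ->
  C b /\ g b <= g a.
Hypothesis Phi_le : forall a E, C a -> G E -> mean_le P E (Phi a) (g a).
Hypothesis Phi_cvg : forall w (a_ : nat -> K -> R) (a : K -> R),
  (forall k, a_ n k @[n --> \oo] --> a k) -> Phi (a_ n) w @[n --> \oo] --> Phi a w.
Hypothesis mPhi : forall b : Omega -> K -> R,
  (forall k, measurable_fun setT (b ^~ k)) -> measurable_fun setT (fun w => Phi (b w) w).
Hypothesis mg : measurable_fun setT (fun w => g (zeta w)).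
Hypothesis zetaC : forall w, C (zeta w).

Let code n w : {ffun K -> nat * nat} := [ffun k => truncate_code n (zeta w k)].
Let zeta_ n w k : R := decode n (truncate_code n (zeta w k)).
(** [choice.pickle] numbers the finite vectors of codes, so the pieces form a partition indexed by
    the natural numbers, ready for countable additivity. *)
Let piece n m := [set w | choice.pickle (code n w) = m].

Let measurable_piece n m : G (piece n m).
Proof.
have [[w0 w0m]|/forallNP no] := pselect (exists w, piece n m w); last first.
  by rewrite (_ : piece n m = set0); [case: sG|apply/seteqP; split => // w /no].
have -> : piece n m = \bigcap_(k in [set: K])
    ((zeta ^~ k) @^-1` [set x | truncate_code n x = code n w0 k]).
  apply/seteqP; split=> [w wm k _ /=|w wk].
    have : code n w = code n w0 by apply: (pcan_inj choice.pickleK); rewrite wm w0m.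
    by move=> <-; rewrite ffunE.
  rewrite /piece /= -w0m; congr choice.pickle; apply/ffunP => k.
  by rewrite ffunE; exact: wk.
rewrite -(sigma_algebra_id sG).
apply: (@fin_bigcap_measurable _ (g_sigma_algebraType G)).
  exact: finite_finset.
move=> k _; rewrite /measurable /= (sigma_algebra_id sG); apply: mzeta.
exact: measurable_truncate_code.
Qed.

Let mpiece n m : measurable (piece n m).
Proof. by apply: Gm; exact: measurable_piece. Qed.

Let bigcup_piece n : \bigcup_m piece n m = setT.
Proof. by apply/seteqP; split => // w _; exists (choice.pickle (code n w)). Qed.

Let trivIset_piece n : trivIset setT (piece n).
Proof.
apply/trivIsetP => i j _ _ /eqP ij; apply/seteqP; split => // w [wi wj].
by case: ij; rewrite -wi; exact: wj.
Qed.

Let zeta_const n m w0 w : piece n m w0 -> piece n m w -> zeta_ n w = zeta_ n w0.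
Proof.
move=> w0m wm; have : code n w = code n w0.
  by apply: (pcan_inj choice.pickleK); rewrite wm w0m.
move=> cw; apply/funext => k; rewrite /zeta_.
by move/ffunP: cw => /(_ k); rewrite !ffunE => ->.
Qed.

Let mzeta_real k : measurable_fun setT (zeta ^~ k).
Proof. by move=> _ A mA; rewrite setTI; apply: Gm; exact: mzeta. Qed.

Let mzeta_ n k : measurable_fun setT (fun w => zeta_ n w k).
Proof.
exact: (measurableT_comp (measurable_truncate n) (mzeta_real k)).
Qed.

Let zetaC_ n w : C (zeta_ n w) /\ g (zeta_ n w) <= g (zeta w).
Proof. by apply: C_shrink (zetaC w) _ => k; exact: norm_truncate_le. Qed.

(** Nonnegativity is a component of [mean_le]; testing on the empty event, which lies in [G],
    extracts it. *)
Let Phi_ge0 a w : C a -> 0 <= Phi a w.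
Proof. by move=> Ca; case: sG => G0 _ _; have [_ ->] := Phi_le Ca G0. Qed.

Let g_ge0 a : C a -> 0 <= g a.
Proof.
move=> Ca; have GT : G setT.
  by case: sG => G0 GD _; rewrite -(setD0 setT); exact: GD.
have [_ F0] := Phi_le Ca GT.
rewrite probability_setT mul1e => H; rewrite -lee_fin; apply: le_trans H.
by apply: integral_ge0 => w _; rewrite lee_fin.
Qed.

Let mPhi_ n : measurable_fun setT (fun w => (Phi (zeta_ n w) w)%:E).
Proof. by apply/measurable_EFinP; apply: mPhi => k; exact: mzeta_. Qed.

Let Phi__ge0 n w : (0 <= (Phi (zeta_ n w) w)%:E)%E.
Proof. by rewrite lee_fin; apply: Phi_ge0; have [] := zetaC_ n w. Qed.

Let integral_piece_le n m :
  (\int[P]_(w in piece n m) (Phi (zeta_ n w) w)%:E <=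
   \int[P]_(w in piece n m) (g (zeta w))%:E)%E.
Proof.
have [[w0 w0m]|/forallNP no] := pselect (exists w, piece n m w); last first.
  rewrite (_ : piece n m = set0) ?integral_set0//.
  by apply/seteqP; split => // w /no.
have [Cw0 _] := zetaC_ n w0.
have [mP P0 Ple] := Phi_le Cw0 (measurable_piece n m).
rewrite (eq_integral (fun w => (Phi (zeta_ n w0) w)%:E)); last first.
  by move=> w /set_mem wm; rewrite (zeta_const w0m wm).
apply: le_trans Ple _; rewrite muleC -integral_cst//.
apply: ge0_le_integral => //.
- by move=> w _; rewrite lee_fin; exact: g_ge0.
- by apply/measurable_EFinP/measurable_funTS.
- move=> w wm; rewrite lee_fin -(zeta_const w0m wm).
  by have [] := zetaC_ n w.
Qed.

Let integral_zeta_le n :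
  (\int[P]_w (Phi (zeta_ n w) w)%:E <= \int[P]_w (g (zeta w))%:E)%E.
Proof.
rewrite -(bigcup_piece n) !ge0_integral_bigcup//.
- apply: lee_nneseries => [m _ _|m _]; last exact: integral_piece_le.
  by apply: integral_ge0 => w _.
- by rewrite bigcup_piece; apply/measurable_EFinP.
- by move=> w _; rewrite lee_fin; exact: g_ge0.
- by rewrite bigcup_piece.
Qed.

(* The coefficients are frozen on the countably many pieces on which their
   discretisation is constant, and the limit is taken by Fatou's lemma. *)
Lemma integral_freezing_le :
  (\int[P]_w (Phi (zeta w) w)%:E <= \int[P]_w (g (zeta w))%:E)%E.
Proof.
apply: (@integral_cvg_le _ _ _ P (fun n w => Phi (zeta_ n w) w)).
- by move=> n; apply: mPhi => k; exact: mzeta_.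
- by move=> n w; apply: Phi_ge0; have [] := zetaC_ n w.
- by move=> w; apply: Phi_cvg => k; exact: truncate_cvg.
exact: integral_zeta_le.
Qed.
End freezing.

Lemma cvg_finsum {R : realType} (I : finType) (f : nat -> I -> R) (a : I -> R) :
  (forall i, f n i @[n --> \oo] --> a i) ->
  \sum_i f n i @[n --> \oo] --> \sum_i a i.
Proof.
move=> fa; elim: (index_enum I) => [|i l IH].
  by rewrite big_nil; under eq_fun do rewrite big_nil; exact: cvg_cst.
by rewrite big_cons; under eq_fun do rewrite big_cons; exact: cvgD.
Qed.

Lemma truncated_exp_cvg {R : realType} (I : finType) (q : R)
    (v_ z_ : nat -> I -> R) (v z : I -> R) :
  (forall i, v_ n i @[n --> \oo] --> v i) ->
  (forall i, z_ n i @[n --> \oo] --> z i) ->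
  truncated_exp q (v_ n) (z_ n) @[n --> \oo] --> truncated_exp q v z.
Proof.
move=> vv zz; apply: (continuous_cvg _ (@continuous_expR R _)).
apply: cvgM; first exact: cvg_cst.
have d0 : 1 + \sum_k z k ^+ 2 != 0.
  by rewrite gt_eqF// ltr_wpDr// sumr_ge0// => k _; rewrite sqr_ge0.
have cd : (1 + \sum_k z_ n k ^+ 2)^-1 @[n --> \oo] --> (1 + \sum_k z k ^+ 2)^-1.
  apply: cvgV => //; apply: cvgD; first exact: cvg_cst.
  by apply: cvg_finsum => k; rewrite expr2; under eq_fun do rewrite expr2; apply: cvgM.
have cz i : z_ n i / (1 + \sum_k z_ n k ^+ 2) @[n --> \oo] -->
    z i / (1 + \sum_k z k ^+ 2) by apply: cvgM.
apply: cvg_finsum => i; apply: cvgD.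
  by apply: cvgM => //; apply: cvgM => //; exact: cvg_cst.
by rewrite expr2; under eq_fun do rewrite expr2; apply: cvgM.
Qed.

Section one_step_random.
Context {R : realType} {d : measure_display} {Omega : measurableType d}.
Context (P : probability Omega R) (T : R) (Ft : R -> set_system Omega).
Hypothesis filtF : filtration T Ft.
Context (U : completeNormedModType R) (ipU : {dot U for idfun}).
Hypothesis hilbU : hilbert ipU.
Context (W : R -> U -> Omega -> R) (wienerW : cylindrical_wiener P T Ft W).
Context (s t : R) (s0 : 0 <= s) (st : s < t) (tT : t <= T).
Context (J : finType) (u : J -> U).
Hypothesis ou : forall i j, ipU (u i) (u j) = (i == j)%:R.
Context (I : finType) (q V theta : R).
Hypotheses (q0 : 0 <= q) (V0 : 0 <= V) (theta0 : 0 <= theta).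
Local Notation incr := (increment W s t u).
Local Notation bound := (one_step_bound s t q V theta).

(** The weight [g], the vector [v] and the matrix [S] are packed into one vector over a finite index
    type, so that they are frozen simultaneously. *)
Lemma integral_truncated_exp_le (g : Omega -> R) (v : Omega -> I -> R)
    (S : Omega -> I -> J -> R) :
  (forall A : set R, measurable A -> Ft s (g @^-1` A)) ->
  (forall i (A : set R), measurable A -> Ft s ((v ^~ i) @^-1` A)) ->
  (forall i j (A : set R), measurable A -> Ft s ((fun w => S w i j) @^-1` A)) ->
  (forall w, 0 <= g w) ->
  (forall w, \sum_i v w i ^+ 2 <= V ^+ 2) ->
  (forall w, \sum_i \sum_j S w i j ^+ 2 <= theta) ->
  (\int[P]_w (g w * truncated_exp q (v w) (fun i => incr (S w i) w))%:E <=
   \int[P]_w (g w * bound (\sum_i v w i ^+ 2))%:E)%E.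
Proof.
move=> mg mv mS g0 vV Sth.
have sT : 0 <= s <= T by rewrite s0 (le_trans (ltW st)).
have [sF FM] : sigma_algebra setT (Ft s) /\ Ft s `<=` measurable.
  by have [/(_ s sT)] := filtF.
have sq (x y : R) : `|x| <= `|y| -> x ^+ 2 <= y ^+ 2.
  move=> xy; rewrite -(real_normK (num_real x)) -(real_normK (num_real y)).
  by rewrite ler_sqr ?nnegrE.
pose K : finType := option (I + I * J).
pose zeta w (k : K) := match k with
  None => g w | Some (inl i) => v w i | Some (inr (i, j)) => S w i j end.
pose cv (a : K -> R) i := a (Some (inl i)).
pose cS (a : K -> R) i j := a (Some (inr (i, j))).
pose C := [set a : K -> R |
  \sum_i cv a i ^+ 2 <= V ^+ 2 /\ \sum_i \sum_j cS a i j ^+ 2 <= theta].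
(* The absolute value keeps the weight nonnegative for every admissible [a] and monotone under
   rounding; it changes nothing for [g >= 0]. *)
pose Phi (a : K -> R) w :=
  `|a None| * truncated_exp q (cv a) (fun i => incr (cS a i) w).
pose gK (a : K -> R) := `|a None| * bound (\sum_i cv a i ^+ 2).
have bound_ge0 n : 0 <= bound n by exact: expR_ge0.
have msum (b : Omega -> K -> R) : (forall k, measurable_fun setT (b ^~ k)) ->
  forall i, measurable_fun setT (fun w => incr (cS (b w) i) w).
  move=> mb i; apply: measurable_sum => j; apply: measurable_funM.
    exact: (mb (Some (inr (i, j)))).
  apply: measurable_funB; apply: (measurable_wiener filtF wienerW) => //.
  by rewrite tT (le_trans s0 (ltW st)).
rewrite (eq_integral (fun w => (Phi (zeta w) w)%:E)); last first.
  by move=> w _; rewrite /Phi /= ger0_norm.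
rewrite [leRHS](eq_integral (fun w => (gK (zeta w))%:E)); last first.
  by move=> w _; rewrite /gK /= ger0_norm.
apply: (@integral_freezing_le _ _ _ P (Ft s) sF FM K zeta _ C Phi gK) => //.
- by move=> [[i|[i j]]|] A mA; [exact: mv|exact: mS|exact: mg].
- move=> a b [av aS] ba; split; first split.
  + by apply: le_trans av; apply: ler_sum => i _; apply: sq; exact: ba.
  + apply: le_trans aS; apply: ler_sum => i _; apply: ler_sum => j _.
    by apply: sq; exact: ba.
  + apply: ler_pM => //; rewrite /one_step_bound ler_expR !lerD2r.
    rewrite ler_wpM2l ?mulr_ge0 ?sqr_ge0 ?subr_ge0 ?(ltW st)//.
    by apply: ler_sum => i _; apply: sq; exact: ba.
- move=> a E [av aS] FE; apply: mean_leZ => //; first exact: FM.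
  exact: (mean_le_truncated_exp filtF hilbU wienerW s0 st tT ou q0 V0 theta0 av aS FE).
- move=> w a_ a aa; apply: cvgM; first exact: cvg_norm.
  apply: truncated_exp_cvg => i; first exact: aa.
  by apply: cvg_finsum => j; apply: cvgM; [exact: aa|exact: cvg_cst].
- move=> b mb; apply: measurable_funM; first exact: measurableT_comp.
  apply: measurable_truncated_exp => i; first exact: mb.
  exact: msum.
- apply: measurable_funM.
    apply: measurableT_comp => //.
    by move=> _ A mA; rewrite setTI; apply: FM; exact: mg.
  rewrite /one_step_bound.
  apply: measurableT_comp => //; apply: measurable_funD => //.
  apply: measurable_funD => //; apply: measurable_funM => //.
  apply: measurable_sum => i; apply: measurable_funX.
  by move=> _ A mA; rewrite setTI; apply: FM; exact: mv.
- by move=> w; split; [exact: vV|exact: Sth].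
Qed.

End one_step_random.

(** * One step of the scheme *)

Section step_constant.
Context {R : realType}.

(** [K'] bounds tau times the constant L of the truncation error when V = K (1 + tau0^8) / tau. The
    three summands bound, after division by h tau, the quadratic drift term, the second-order part
    of the exponential moment of the noise, and twice the truncation error. *)
Definition step_constant (eps vth b1 b2 K tau0 : R) : R :=
  let K' := 2 * eps * (K * (1 + tau0 ^+ 8)) + eps * tau0 in
  eps * tau0 ^+ 5 * K ^+ 2 +
  2 * eps ^+ 2 * vth *
    (2 * b1 * tau0 ^+ 7 + 2 * b2 * tau0 ^+ 5 * K ^+ 2 + tau0 ^+ 13 * K ^+ 2) +
  2 * (6 * (1 + eps) * (K' * tau0 ^+ 2) *
    expR ((1 + K' * tau0 ^+ 3) ^+ 2 * (vth + 1))).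

Lemma step_constant_ge0 (eps vth b1 b2 K tau0 : R) : 0 <= eps -> 0 <= vth ->
  0 <= b1 -> 0 <= b2 -> 0 <= K -> 0 <= tau0 ->
  0 <= step_constant eps vth b1 b2 K tau0.
Proof.
move=> *; rewrite /step_constant.
by do ?[apply: addr_ge0|apply: mulr_ge0|apply: exprn_ge0|apply: expR_ge0|by []].
Qed.

(* [tau] stands for the eighth root of the mesh, so that every power of the
   mesh occurring in the error terms is a polynomial in [tau]. *)
Lemma step_exponent_le (eps vth b1 b2 K tau0 tau h q Q x2 f2 xf v2 : R) :
  0 <= vth -> 0 <= b1 -> 0 <= b2 -> 0 <= K ->
  0 < tau -> tau <= tau0 -> 0 < h -> h <= tau ^+ 8 ->
  0 <= q -> q <= eps -> q * (1 + h * (2 * (b2 + eps * vth))) <= Q ->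
  0 <= x2 -> x2 * tau ^+ 2 <= K ^+ 2 -> 0 <= f2 -> f2 * tau ^+ 2 <= K ^+ 2 ->
  xf <= b1 + b2 * x2 ->
  v2 = x2 + 2 * h * xf + h ^+ 2 * f2 ->
  q * v2 - q * h * (2 * b1 + vth) +
  (2 * q ^+ 2 * h * vth * v2 + q * h * vth +
   2 * truncation_error q (K * (1 + tau0 ^+ 8) / tau) h (vth + 1)) <=
  Q * x2 + step_constant eps vth b1 b2 K tau0 * h * tau.
Proof.
move=> vth0 b10 b20 K0 t0 tt0 h0 ht q0 qe qQ x20 x2K f20 f2K xfb v2E.
have e0 : 0 <= eps by apply: le_trans qe.
have t00 : 0 <= tau0 by apply: le_trans tt0; exact: ltW.
have t0' := ltW t0; have h0' := ltW h0.
have pw n : tau ^+ n <= tau0 ^+ n by rewrite lerXn2r ?nnegrE.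
have hf : h * f2 <= tau * (tau0 ^+ 5 * K ^+ 2).
  apply: (@le_trans _ _ (tau ^+ 6 * K ^+ 2)).
    apply: (@le_trans _ _ (tau ^+ 8 * f2)); first by rewrite ler_wpM2r.
    rewrite (_ : tau ^+ 8 * f2 = tau ^+ 6 * (f2 * tau ^+ 2)); last by ring.
    by rewrite ler_wpM2l ?exprn_ge0.
  rewrite (_ : tau ^+ 6 * K ^+ 2 = tau * (tau ^+ 5 * K ^+ 2)); last by ring.
  by rewrite ler_wpM2l// ler_wpM2r ?sqr_ge0.
have hx : h * x2 <= tau * (tau0 ^+ 5 * K ^+ 2).
  apply: (@le_trans _ _ (tau ^+ 6 * K ^+ 2)).
    apply: (@le_trans _ _ (tau ^+ 8 * x2)); first by rewrite ler_wpM2r.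
    rewrite (_ : tau ^+ 8 * x2 = tau ^+ 6 * (x2 * tau ^+ 2)); last by ring.
    by rewrite ler_wpM2l ?exprn_ge0.
  rewrite (_ : tau ^+ 6 * K ^+ 2 = tau * (tau ^+ 5 * K ^+ 2)); last by ring.
  by rewrite ler_wpM2l// ler_wpM2r ?sqr_ge0.
have h7 : h <= tau * tau0 ^+ 7.
  apply: le_trans ht _; rewrite exprS ler_wpM2l//.
have h8 : h <= tau0 ^+ 8 by apply: le_trans ht _.
pose D := 2 * h * (b1 + b2 * x2) + h ^+ 2 * f2.
have v2D : v2 <= x2 + D.
  by rewrite v2E /D addrA lerD2r lerD2l ler_wpM2l// mulr_ge0.
have D0 : 0 <= D.
  by rewrite /D addr_ge0// ?mulr_ge0 ?addr_ge0 ?mulr_ge0 ?sqr_ge0.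
have D_le : D <= tau * (2 * b1 * tau0 ^+ 7 + 2 * b2 * tau0 ^+ 5 * K ^+ 2 +
    tau0 ^+ 13 * K ^+ 2).
  have H1 : 2 * h * b1 <= tau * (2 * b1 * tau0 ^+ 7) by nra.
  have H2 : 2 * b2 * (h * x2) <= 2 * b2 * (tau * (tau0 ^+ 5 * K ^+ 2)).
    by rewrite ler_wpM2l// mulr_ge0.
  have H3 : h * (h * f2) <= tau0 ^+ 8 * (tau * (tau0 ^+ 5 * K ^+ 2)).
    by apply: ler_pM => //; rewrite mulr_ge0.
  by rewrite /D; lra.
set V := K * (1 + tau0 ^+ 8) / tau.
have V0 : 0 <= V by rewrite divr_ge0// mulr_ge0// addr_ge0// exprn_ge0.
have err_le : truncation_error q V h (vth + 1) <=
  6 * (1 + eps) * ((2 * eps * (K * (1 + tau0 ^+ 8)) + eps * tau0) * tau0 ^+ 2) *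
    expR ((1 + (2 * eps * (K * (1 + tau0 ^+ 8)) + eps * tau0) * tau0 ^+ 3) ^+ 2
      * (vth + 1)) * (h * tau).
  set K' := 2 * eps * (K * (1 + tau0 ^+ 8)) + eps * tau0.
  set L := 2 * q * V + q; set k := Num.sqrt h.
  have k0 : 0 <= k by rewrite sqrtr_ge0.
  have kE : k ^+ 2 = h by rewrite sqr_sqrtr.
  have k4 : k <= tau ^+ 4.
    by rewrite -ler_sqr ?nnegrE ?exprn_ge0// kE -exprM.
  have L0 : 0 <= L by rewrite /L addr_ge0// mulr_ge0// mulr_ge0.
  have KK : 0 <= K * (1 + tau0 ^+ 8) by rewrite mulr_ge0// addr_ge0// exprn_ge0.
  have K'0 : 0 <= K' by rewrite /K' addr_ge0// mulr_ge0// mulr_ge0.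
  have Lt : L * tau <= K'.
    rewrite /L /V /K' mulrDl; apply: lerD.
      rewrite (_ : 2 * q * (K * (1 + tau0 ^+ 8) / tau) * tau =
        2 * q * (K * (1 + tau0 ^+ 8))); last by field; rewrite gt_eqF.
      by rewrite ler_wpM2r// ler_wpM2l.
    exact: ler_pM.
  have Lk3 : L * k <= K' * tau ^+ 3.
    apply: (@le_trans _ _ (L * tau ^+ 4)); first by rewrite ler_wpM2l.
    rewrite (_ : L * tau ^+ 4 = L * tau * tau ^+ 3); last by ring.
    by rewrite ler_wpM2r ?exprn_ge0.
  have Lk : L * k <= K' * tau0 ^+ 3.
    by apply: le_trans Lk3 _; rewrite ler_wpM2l.
  have Lkt : L * k <= K' * tau0 ^+ 2 * tau.
    apply: le_trans Lk3 _; rewrite -mulrA ler_wpM2l// exprSr ler_wpM2r//.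
  rewrite /truncation_error -/k.
  (* Two of the three factors sqrt(h) make up h. The third is at most tau^4; it pays for L, of order
     1/tau, and leaves a factor tau. *)
  rewrite (_ : 6 * (1 + q) * (2 * q * V + q) * k ^+ 3 = 6 * (1 + q) * (L * k) * h);
    last by rewrite -kE /L; ring.
  rewrite (_ : 6 * (1 + eps) * (K' * tau0 ^+ 2) *
    expR ((1 + K' * tau0 ^+ 3) ^+ 2 * (vth + 1)) * (h * tau) =
    6 * (1 + eps) * (K' * tau0 ^+ 2 * tau) * h *
    expR ((1 + K' * tau0 ^+ 3) ^+ 2 * (vth + 1))); last by ring.
  apply: ler_pM; [|exact: expR_ge0| |].
  - by rewrite !mulr_ge0// addr_ge0.
  - rewrite ler_wpM2r//; apply: ler_pM => //; last by rewrite ler_wpM2l// lerD2l.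
      by rewrite mulr_ge0// addr_ge0.
    by rewrite mulr_ge0.
  - rewrite ler_expR ler_wpM2r ?addr_ge0// lerXn2r ?nnegrE ?lerD2l//.
      by rewrite addr_ge0// mulr_ge0.
    by rewrite addr_ge0// mulr_ge0// exprn_ge0.
have H1 : q * v2 <= q * (x2 + D) by rewrite ler_wpM2l.
have H2 : 2 * q ^+ 2 * h * vth * v2 <= 2 * q * eps * h * vth * x2 +
    2 * eps ^+ 2 * h * vth * D.
  apply: (@le_trans _ _ (2 * q ^+ 2 * h * vth * (x2 + D))).
    by rewrite ler_wpM2l// !mulr_ge0 ?sqr_ge0.
  rewrite mulrDr; apply: lerD; rewrite ler_wpM2r//.
    by rewrite ler_wpM2r// ler_wpM2r// -!mulrA ler_wpM2l// expr2 ler_wpM2l.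
  by rewrite ler_wpM2r// ler_wpM2r// ler_wpM2l// lerXn2r ?nnegrE.
(* The growth of the weight from [q] to [Q] absorbs the terms of order h in [x2]: 2 q h b2 x2 from
   the drift and 2 q eps h vth x2 from the noise. *)
have H3 : q * (1 + h * (2 * (b2 + eps * vth))) * x2 <= Q * x2.
  by rewrite ler_wpM2r.
have H4 : q * (h ^+ 2 * f2) <= eps * (h * (tau * (tau0 ^+ 5 * K ^+ 2))).
  rewrite expr2 -mulrA; apply: ler_pM => //; first by rewrite !mulr_ge0.
  by rewrite ler_wpM2l.
have H5 : 2 * eps ^+ 2 * h * vth * D <= 2 * eps ^+ 2 * h * vth *
   (tau * (2 * b1 * tau0 ^+ 7 + 2 * b2 * tau0 ^+ 5 * K ^+ 2 +
    tau0 ^+ 13 * K ^+ 2)) by rewrite ler_wpM2l// !mulr_ge0 ?sqr_ge0.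
rewrite /step_constant.
set E1 := 6 * (1 + eps) * _ * expR _ in err_le *.
rewrite /D in H1; lra.
Qed.

End step_constant.

Section generated_measurability.
Context {R : realType} {d : measure_display} {Omega : measurableType d}.
Context (G : set_system Omega) (sG : sigma_algebra setT G).

(** Turning [G] into a measurable type makes the closure properties of measurable functions
    available for adaptedness. *)
Definition measurable_for (f : Omega -> R) :=
  measurable_fun [set: g_sigma_algebraType G] (f : g_sigma_algebraType G -> R).

Lemma measurable_forP f :
  measurable_for f <-> forall A : set R, measurable A -> G (f @^-1` A).
Proof.
have e := sigma_algebra_id sG; split => [mf A mA|mf _ A mA].
  by rewrite -e -[X in _ X]setTI; exact: mf.
by rewrite setTI /measurable /= e; exact: mf.
Qed.

Lemma measurable_for_sub f : G `<=` measurable -> measurable_for f ->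
  measurable_fun setT f.
Proof.
by move=> Gm /measurable_forP mf _ A mA; rewrite setTI; apply: Gm; exact: mf.
Qed.

Lemma measurable_for_indic E : G E -> measurable_for (\1_E).
Proof.
move=> GE; apply: measurable_indic.
by rewrite /measurable /= (sigma_algebra_id sG).
Qed.

End generated_measurability.

Section one_step.
Context {R : realType} {d : measure_display} {Omega : measurableType d}.
Context (P : probability Omega R) (T : R) (Ft : R -> set_system Omega).
Hypothesis filtF : filtration T Ft.
Context (U : completeNormedModType R) (ipU : {dot U for idfun}).
Hypothesis hilbU : hilbert ipU.
Context (W : R -> U -> Omega -> R) (wienerW : cylindrical_wiener P T Ft W).
Context (s t : R) (s0 : 0 <= s) (st : s < t) (tT : t <= T).
Context (J : finType) (u : J -> U).
Hypothesis ou : forall i j, ipU (u i) (u j) = (i == j)%:R.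
Context (I : finType).
Local Notation incr := (increment W s t u).
Local Notation h := (t - s).
Context (eps vth b1 b2 K tau0 tau sg delta : R).
Hypotheses (eps0 : 0 <= eps) (vth0 : 0 <= vth) (b10 : 0 <= b1) (b20 : 0 <= b2).
Hypotheses (K0 : 0 <= K) (t0 : 0 < tau) (tt0 : tau <= tau0) (ht : h <= tau ^+ 8).
Hypothesis sg0 : 0 <= sg.
Local Notation kappa := (2 * (b2 + eps * vth)).
(** Here [delta] is the share of one step in the integral in the exponent. The integrand decreases
    in time on the step, hence the lower bound by its value at [t]. *)
Hypothesis delta_ge : eps * (2 * b1 + vth) * h / expR (kappa * t) <= delta.
Context (x f : Omega -> I -> R) (S : Omega -> I -> J -> R).
Context (A : set Omega) (acc nt : Omega -> R) (lamI : I -> R).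
Hypotheses (mx : forall i, measurable_for (Ft s) (x ^~ i))
  (mf : forall i, measurable_for (Ft s) (f ^~ i))
  (mS : forall i j, measurable_for (Ft s) (fun w => S w i j))
  (mA : Ft s A) (macc : measurable_for (Ft s) acc).
Hypotheses (mnt : measurable_fun setT nt) (lam0 : forall i, lamI i <= 0).
Hypotheses
  (xK : forall w, A w -> \sum_i x w i ^+ 2 * tau ^+ 2 <= K ^+ 2)
  (fK : forall w, A w -> \sum_i f w i ^+ 2 * tau ^+ 2 <= K ^+ 2)
  (xf : forall w, A w -> \sum_i x w i * f w i <= b1 + b2 * \sum_i x w i ^+ 2)
  (S_le : forall w, \sum_i \sum_j S w i j ^+ 2 <= vth).
Hypothesis ntE : {ae P, forall w, nt w =
  \sum_i (expR (h * lamI i) * (x w i + \1_A w * (h * f w i +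
    incr (S w i) w / (1 + \sum_k incr (S w k) w ^+ 2)))) ^+ 2}.

Let q := eps / expR (kappa * t).
Let V := K * (1 + tau0 ^+ 8) / tau.
(** The indicator makes the bound by [V] valid at every [w], as freezing demands. *)
Let v w i := \1_A w * (x w i + h * f w i).
Let Ms w := expR ((sg + eps * \sum_i x w i ^+ 2) / expR (kappa * s) - acc w).
Let Mt w := expR ((sg + eps * nt w) / expR (kappa * t) - (acc w + \1_A w * delta)).
Let g w := \1_A w * expR (sg / expR (kappa * s) - acc w -
  q * h * (2 * b1 + vth) + q * \sum_i v w i ^+ 2).
Let C := step_constant eps vth b1 b2 K tau0.

Let h0 : 0 < h. Proof. by rewrite subr_gt0. Qed.
Let kappa0 : 0 <= kappa.
Proof. by rewrite mulr_ge0// addr_ge0// mulr_ge0. Qed.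
Let q0 : 0 <= q. Proof. by rewrite divr_ge0// expR_ge0. Qed.
Let V0 : 0 <= V.
Proof.
rewrite divr_ge0 ?(ltW t0)// mulr_ge0// addr_ge0// exprn_ge0//.
exact: le_trans (ltW t0) tt0.
Qed.

Let decay : (expR (kappa * t))^-1 <= (expR (kappa * s))^-1.
Proof. by rewrite lef_pV2 ?posrE ?expR_gt0// ler_expR ler_wpM2l// ltW. Qed.

Let sigma_Ft : sigma_algebra setT (Ft s).
Proof. by have [/(_ s)] := filtF; rewrite s0 (le_trans (ltW st))// => /(_ isT)[]. Qed.

Let Ft_sub : Ft s `<=` measurable.
Proof. by apply: (filtration_measurable filtF); rewrite s0 (le_trans (ltW st)). Qed.

Let vE w : A w -> \sum_i v w i ^+ 2 = \sum_i x w i ^+ 2 +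
  2 * h * (\sum_i x w i * f w i) + h ^+ 2 * \sum_i f w i ^+ 2.
Proof.
move=> Aw; rewrite !mulr_sumr -!big_split; apply: eq_bigr => i _ /=.
by rewrite /v indicE mem_set// mul1r; ring.
Qed.

Let v0 w : ~ A w -> \sum_i v w i ^+ 2 = 0.
Proof.
move=> Aw; rewrite big1// => i _.
by rewrite /v indicE memNset// mul0r expr0n.
Qed.

(** On [A] both |x| and |f| are at most K / tau, so |x + h f| <= K (1 + h) / tau, and h <=
    tau0^8. *)
Let vV w : \sum_i v w i ^+ 2 <= V ^+ 2.
Proof.
have [Aw|Aw] := pselect (A w); last by rewrite v0// sqr_ge0.
rewrite vE//.
have cs := sum_cauchy_schwarz (x w) (f w).
have xK' := xK Aw; have fK' := fK Aw.
rewrite -mulr_suml in xK'; rewrite -mulr_suml in fK'.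
set x2 := \sum_i x w i ^+ 2 in cs xK' *; set f2 := \sum_i f w i ^+ 2 in cs fK' *.
set p := \sum_i _ * _ in cs *.
have x20 : 0 <= x2 by rewrite sumr_ge0// => i _; rewrite sqr_ge0.
have f20 : 0 <= f2 by rewrite sumr_ge0// => i _; rewrite sqr_ge0.
have pK : p * tau ^+ 2 <= K ^+ 2.
  apply: le_trans (ler_norm _) _.
  rewrite -ler_sqr ?nnegrE ?sqr_ge0// real_normK ?num_real// exprMn.
  apply: (@le_trans _ _ ((x2 * tau ^+ 2) * (f2 * tau ^+ 2))).
    rewrite (_ : x2 * _ * _ = (x2 * f2) * (tau ^+ 2) ^+ 2); last by ring.
    by rewrite ler_wpM2r ?sqr_ge0.
  by rewrite [leRHS]expr2; apply: ler_pM => //; rewrite mulr_ge0 ?sqr_ge0.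
have hT : h <= tau0 ^+ 8.
  by apply: le_trans ht _; rewrite lerXn2r ?nnegrE// ltW// (lt_le_trans t0).
rewrite /V expr_div_n ler_pdivlMr ?exprn_gt0// exprMn.
apply: (@le_trans _ _ (K ^+ 2 * (1 + h) ^+ 2)).
  have -> : (x2 + 2 * h * p + h ^+ 2 * f2) * tau ^+ 2 =
    x2 * tau ^+ 2 + 2 * h * (p * tau ^+ 2) + h ^+ 2 * (f2 * tau ^+ 2) by ring.
  have -> : K ^+ 2 * (1 + h) ^+ 2 = K ^+ 2 + 2 * h * K ^+ 2 + h ^+ 2 * K ^+ 2.
    by ring.
  rewrite lerD ?lerD ?ler_wpM2l ?sqr_ge0// mulr_ge0// ltW//.
rewrite ler_wpM2l ?sqr_ge0// lerXn2r ?nnegrE ?lerD2l// addr_ge0// ?ltW//.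
by rewrite (lt_le_trans h0).
Qed.

Let nt_le w : nt w = \sum_i (expR (h * lamI i) * (x w i + \1_A w * (h * f w i +
    incr (S w i) w / (1 + \sum_k incr (S w k) w ^+ 2)))) ^+ 2 ->
  nt w <= \sum_i (x w i + \1_A w * (h * f w i +
    incr (S w i) w / (1 + \sum_k incr (S w k) w ^+ 2))) ^+ 2.
Proof.
move=> ->; apply: ler_sum => i _; rewrite exprMn -[leRHS]mul1r ler_wpM2r ?sqr_ge0//.
by rewrite expr_le1 ?expR_ge0// -expR0 ler_expR mulr_ge0_le0// ltW.
Qed.

Let TE w := truncated_exp q (v w) (fun i => incr (S w i) w).

(** On [A] the exponential is bounded by the product of the [Ft s]-measurable [g] and the tamed
    factor [TE]. Off [A] only the semigroup acts, and neither the norm nor the weight in front of it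
    increases. *)
Let Mt_le : {ae P, forall w, Mt w <= (1 - \1_A w) * Ms w + g w * TE w}.
Proof.
move: ntE; apply: filterS => w /nt_le ntw.
rewrite /g indicE; have [Aw|Aw] := pselect (A w).
  rewrite mem_set// subrr mul0r add0r mul1r /TE /truncated_exp -expRD ler_expR.
  rewrite /Mt indicE mem_set// mul1r.
  move: ntw; rewrite indicE mem_set//; under eq_bigr do rewrite mul1r.
  set r := 1 + \sum_k _.
  have -> : \sum_i (x w i + (h * f w i + incr (S w i) w / r)) ^+ 2 =
      \sum_i v w i ^+ 2 +
      \sum_i (2 * v w i * (incr (S w i) w / r) + (incr (S w i) w / r) ^+ 2).
    rewrite -big_split; apply: eq_bigr => i _ /=.
    by rewrite /v indicE mem_set// mul1r; ring.
  set n1 := \sum_i _; set n2 := \sum_i _ => ntw.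
  rewrite mulrDl (mulrAC eps) -/q.
  have H1 : q * nt w <= q * (n1 + n2) by rewrite ler_wpM2l.
  have H2 : sg / expR (kappa * t) <= sg / expR (kappa * s) by rewrite ler_wpM2l.
  have H3 : q * h * (2 * b1 + vth) <= delta.
    by apply: le_trans delta_ge; rewrite /q le_eqVlt; apply/orP; left; apply/eqP; ring.
  lra.
rewrite memNset// subr0 mul1r !mul0r addr0 /Mt /Ms ler_expR indicE memNset//.
rewrite mul0r addr0 lerB//; move: ntw; rewrite indicE memNset//.
under eq_bigr do rewrite mul0r addr0.
set n := \sum_i _ => nn.
have n0 : 0 <= n by rewrite sumr_ge0// => i _; rewrite sqr_ge0.
apply: (@le_trans _ _ ((sg + eps * n) / expR (kappa * t))).
  by rewrite ler_wpM2r ?invr_ge0 ?expR_ge0// lerD2l ler_wpM2l.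
by rewrite ler_wpM2l// addr_ge0// mulr_ge0.
Qed.

Let g_bound_le w : (1 - \1_A w) * Ms w +
    g w * one_step_bound s t q V vth (\sum_i v w i ^+ 2) <=
  expR (C * h * tau) * Ms w.
Proof.
have C0 : 0 <= C * h * tau.
  rewrite !mulr_ge0 ?(ltW h0) ?(ltW t0)// step_constant_ge0//.
  by rewrite (le_trans (ltW t0)).
rewrite /g indicE; have [Aw|Aw] := pselect (A w).
  rewrite mem_set// subrr mul0r add0r mul1r -!expRD ler_expR.
  have xK' := xK Aw; have fK' := fK Aw.
  rewrite -mulr_suml in xK'; rewrite -mulr_suml in fK'.
  have x20 : 0 <= \sum_i x w i ^+ 2 by rewrite sumr_ge0// => i _; rewrite sqr_ge0.
  have f20 : 0 <= \sum_i f w i ^+ 2 by rewrite sumr_ge0// => i _; rewrite sqr_ge0.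
  have qe : q <= eps.
    rewrite /q ler_pdivrMr ?expR_gt0// ler_peMr// (le_trans _ (expR_ge1Dx _))//.
    by rewrite lerDl mulr_ge0// (le_trans s0)// ltW.
  (* Decay of the weight: exp(-kappa s) = exp(-kappa t) exp(kappa h) >= exp(-kappa t) (1 + kappa
     h). *)
  have qQ : q * (1 + h * kappa) <= eps / expR (kappa * s).
    rewrite /q -mulrA ler_wpM2l// ler_pdivrMl ?expR_gt0// -expRN -expRD.
    have -> : kappa * t + - (kappa * s) = h * kappa by ring.
    exact: expR_ge1Dx.
  have := step_exponent_le vth0 b10 b20 K0 t0 tt0 h0 ht q0 qe qQ x20 xK' f20 fK'
    (xf Aw) (vE Aw).
  rewrite -/V -/C mulrDl (mulrAC eps).
  by set a1 := truncation_error _ _ _ _; lra.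
rewrite memNset// subr0 mul1r !mul0r addr0 -[leLHS]mul1r ler_wpM2r ?expR_ge0//.
by rewrite (le_trans _ (expR_ge1Dx _))// lerDl.
Qed.

Let mv i : measurable_for (Ft s) (v ^~ i).
Proof.
apply: measurable_funM; first exact: measurable_for_indic.
by apply: measurable_funD; [exact: mx|apply: measurable_funM => //; exact: mf].
Qed.

Let mg : measurable_for (Ft s) g.
Proof.
apply: measurable_funM; first exact: measurable_for_indic.
apply: measurableT_comp => //; apply: measurable_funD.
  by apply: measurable_funB => //; apply: measurable_funB => //; exact: macc.
apply: measurable_funM => //; apply: measurable_sum => i.
by apply: measurable_funX; exact: mv.
Qed.

Let mMs : measurable_for (Ft s) Ms.
Proof.
apply: measurableT_comp => //; apply: measurable_funB; last exact: macc.
apply: measurable_funM => //; apply: measurable_funD => //.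
apply: measurable_funM => //; apply: measurable_sum => i.
by apply: measurable_funX; exact: mx.
Qed.

Let sub f' := @measurable_for_sub R d Omega (Ft s) sigma_Ft f' Ft_sub.

Let mMt : measurable_fun setT Mt.
Proof.
apply: measurableT_comp => //; apply: measurable_funB.
  by apply: measurable_funM => //; apply: measurable_funD => //; exact: measurable_funM.
apply: measurable_funD; first exact: sub.
apply: measurable_funM => //; apply: sub; exact: measurable_for_indic.
Qed.

Let mTE : measurable_fun setT TE.
Proof.
apply: measurable_truncated_exp => i; first exact: sub.
apply: measurable_sum => j; apply: measurable_funM; first by apply: sub.
by apply: measurable_funB; apply: (measurable_wiener filtF wienerW);
  rewrite ?s0 ?tT ?(le_trans (ltW st))// (le_trans s0)// ltW.
Qed.

Lemma one_step_expectation_le :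
  (\int[P]_w (Mt w)%:E <= (expR (C * h * tau))%:E * \int[P]_w (Ms w)%:E)%E.
Proof.
have g0 w : 0 <= g w by rewrite mulr_ge0// expR_ge0.
have i0 w : 0 <= 1 - (\1_A w : R).
  by rewrite indicE; case: (w \in A); rewrite ?subrr// subr0.
have mi : measurable_fun setT (fun w => 1 - (\1_A w : R)).
  by apply: measurable_funB => //; apply: sub; exact: measurable_for_indic.
have mi' : measurable_fun setT (fun w => ((1 - \1_A w) * Ms w)%:E).
  by apply/measurable_EFinP; apply: measurable_funM => //; exact: sub.
have mgT : measurable_fun setT (fun w => (g w * TE w)%:E).
  by apply/measurable_EFinP; apply: measurable_funM => //; exact: sub.
have mb : measurable_fun setT
    (fun w => (g w * one_step_bound s t q V vth (\sum_i v w i ^+ 2))%:E).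
  apply/measurable_EFinP; apply: measurable_funM; first exact: sub.
  rewrite /one_step_bound.
  apply: measurableT_comp => //; apply: measurable_funD => //.
  apply: measurable_funD => //; apply: measurable_funM => //.
  by apply: measurable_sum => i; apply: measurable_funX; exact: sub.
have i0' w : setT w -> (0 <= ((1 - \1_A w) * Ms w)%:E)%E.
  by move=> _; rewrite lee_fin mulr_ge0// expR_ge0.
apply: (@le_trans _ _ (\int[P]_w (((1 - \1_A w) * Ms w)%:E + (g w * TE w)%:E))%E).
  apply: ae_ge0_le_integral => //.
  - by move=> w _; rewrite lee_fin expR_ge0.
  - exact/measurable_EFinP.
  - by move=> w _; rewrite adde_ge0 ?i0'// lee_fin mulr_ge0// expR_ge0.
  - exact: emeasurable_funD.
  - by move: Mt_le; apply: filterS => w + _; rewrite -EFinD lee_fin.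
have le2 : (\int[P]_w (g w * TE w)%:E <=
    \int[P]_w (g w * one_step_bound s t q V vth (\sum_i v w i ^+ 2))%:E)%E.
  apply: (integral_truncated_exp_le filtF hilbU wienerW s0 st tT ou q0 V0 vth0) => //.
  - exact/(measurable_forP sigma_Ft).
  - by move=> i; exact/(measurable_forP sigma_Ft).
  - by move=> i j; exact/(measurable_forP sigma_Ft).
rewrite ge0_integralD//; last by move=> w _; rewrite lee_fin mulr_ge0// expR_ge0.
apply: (le_trans (leeD2l _ le2)).
rewrite -ge0_integralD//; last by move=> w _; rewrite lee_fin mulr_ge0// expR_ge0.
apply: (@le_trans _ _ (\int[P]_w ((expR (C * h * tau))%:E * (Ms w)%:E))%E);
  last first.
  rewrite ge0_integralZl//.
  - by apply/measurable_EFinP; exact: sub.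
  - by move=> w _; rewrite lee_fin expR_ge0.
apply: ge0_le_integral => //.
- by move=> w _; rewrite adde_ge0 ?i0'// lee_fin mulr_ge0// expR_ge0.
- exact: emeasurable_funD.
- by apply: emeasurable_funM => //; apply/measurable_EFinP; exact: sub.
- by move=> w _; rewrite -EFinD -EFinM lee_fin.
Qed.

End one_step.

(** * Time grids *)

Section grids.
Context {R : realType}.

Lemma seq_max_exists (s : seq R) : s != [::] ->
  exists2 m, m \in s & forall x, x \in s -> x <= m.
Proof.
elim: s => // a s IH _; have [->|/IH[m ms mmax]] := eqVneq s [::].
  by exists a; rewrite ?inE// => x; rewrite inE => /eqP ->.
exists (Num.max a m).
  by rewrite inE; case: leP => _; rewrite ?eqxx// ms orbT.
by move=> x; rewrite inE le_max => /predU1P[->|/mmax ->]; rewrite ?lexx// orbT.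
Qed.

Lemma finite_max_exists (A : set R) : finite_set A -> A !=set0 ->
  exists2 m, A m & forall x, A x -> x <= m.
Proof.
move=> /finite_seqP[s ->] [x /= xs]; have [|m ms mmax] := @seq_max_exists s.
  by case: s xs.
by exists m.
Qed.

Lemma sup_max (A : set R) m : A m -> (forall x, A x -> x <= m) -> sup A = m.
Proof.
move=> Am mmax; apply/eqP; rewrite eq_le; apply/andP; split.
  by apply: ge_sup; [exists m|exact: mmax].
by apply: ub_le_sup => //; exists m; exact: mmax.
Qed.

Context (T : R) (T0 : 0 < T) (th : set R) (gth : grid T th).

Let th_fin : finite_set th. Proof. by case: gth. Qed.
Let th_sub x : th x -> 0 <= x <= T.
Proof. by case: gth => _ sub _ _ /sub /=; rewrite in_itv. Qed.
Let th0 : th 0. Proof. by case: gth. Qed.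
Let thT : th T. Proof. by case: gth. Qed.

Lemma grid_ltP t : 0 < t <= T ->
  [/\ th (grid_lt th t), 0 <= grid_lt th t < t
    & forall x, th x -> x < t -> x <= grid_lt th t].
Proof.
move=> /andP[t0 tT]; rewrite /grid_lt gt_eqF//.
have [||m [/= mi thm] mmax] := @finite_max_exists (`[0, t[ `&` th).
- exact: finite_setIr.
- by exists 0; split => //=; rewrite in_itv /= lexx.
rewrite (sup_max _ mmax)//; move: mi; rewrite in_itv /= => mi; split => // x thx xt.
by apply: mmax; split => //=; rewrite in_itv /= xt; case/andP: (th_sub thx) => ->.
Qed.

Lemma grid_leE t r : 0 < t <= T -> grid_lt th t <= r < t ->
  grid_le th r = grid_lt th t.
Proof.
move=> tT /andP[sr rt]; have [ths /andP[s0 st] smax] := grid_ltP tT.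
rewrite /grid_le; case: eqP => [r0|_].
  by apply/eqP; rewrite eq_le s0 -r0.
apply: sup_max; first by split => //=; rewrite in_itv /= s0.
move=> x [/= + thx]; rewrite in_itv /= => /andP[_ xr].
by apply: smax => //; exact: le_lt_trans rt.
Qed.

Let mesh_set := [set x | exists a b, [/\ th a, th b, 0 < x, x = b - a
                             & th `&` `]a, b[ = set0]].

Let mesh_ub : ubound mesh_set T.
Proof.
move=> _ [a [b [/th_sub/andP[a0 _] /th_sub/andP[_ bT] _ -> _]]].
by rewrite lerBlDr (le_trans bT)// lerDl.
Qed.

(** [t] need not be a grid point: it is at most the grid point following [grid_lt th t], and the
    mesh dominates the gap between these two. That successor is found as a maximum of negatives. *)
Lemma grid_step_le_mesh t : 0 < t <= T -> t - grid_lt th t <= mesh th.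
Proof.
move=> tT; have [ths /andP[s0 st] smax] := grid_ltP tT.
set s := grid_lt th t in ths s0 st smax *.
have [||m [x [thx sx] <-] mmax] :=
    @finite_max_exists (-%R @` (th `&` [set x | s < x])).
- by apply: finite_image; exact: finite_setIl.
- by exists (- T), T => //; split => //=; case/andP: tT => _; exact: lt_le_trans.
have tx : t <= x by rewrite leNgt; apply/negP => /(smax _ thx); rewrite leNgt sx.
apply: (@le_trans _ _ (x - s)); first by rewrite lerD2r.
apply: ub_le_sup; first by exists T; exact: mesh_ub.
exists s, x; split => //; first by rewrite subr_gt0.
apply/seteqP; split => // y [thy /=]; rewrite in_itv /= => /andP[sy yx].
have : - y <= - x by apply: mmax; exists y.
by rewrite lerN2 leNgt yx.
Qed.

Lemma mesh_gt0 : 0 < mesh th.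
Proof.
have TT : 0 < T <= T by rewrite T0 lexx.
have [_ /andP[_ sT] _] := grid_ltP TT.
by apply: lt_le_trans (grid_step_le_mesh TT); rewrite subr_gt0.
Qed.

Lemma mesh_le : mesh th <= T.
Proof.
apply: ge_sup mesh_ub; have TT : 0 < T <= T by rewrite T0 lexx.
have [ths /andP[s0 sT] smax] := grid_ltP TT.
exists (T - grid_lt th T), (grid_lt th T), T; split => //.
  by rewrite subr_gt0.
apply/seteqP; split => // y [thy /=]; rewrite in_itv /= => /andP[sy yT].
by have := smax _ thy yT; rewrite leNgt sy.
Qed.

(** Induction on the number of grid points strictly below [t]. It drops because [grid_lt th t] lies
    below [t] but not below itself. *)
Lemma grid_ind (Q : R -> Prop) : Q 0 ->
  (forall t, 0 < t <= T -> Q (grid_lt th t) -> Q t) ->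
  forall t, 0 <= t <= T -> Q t.
Proof.
move=> Q0 Qstep t tT.
have [n] := ubnP #|` fset_set (th `&` [set x | x < t])|.
elim: n t tT => // n IH t /andP[t0 tT] cn.
have [<-//|t_neq0] := eqVneq 0 t.
have tT' : 0 < t <= T by rewrite lt_neqAle t_neq0 t0.
apply: Qstep => //; have [ths /andP[s0 st] smax] := grid_ltP tT'.
apply: IH; first by rewrite s0 (le_trans (ltW st)).
rewrite ltnS in cn; apply: leq_trans cn; apply: fproper_ltn_card.
rewrite fproperE; apply/andP; split.
  apply/fsubsetP => x.
  rewrite !in_fset_set; [|exact: finite_setIl|exact: finite_setIl].
  by rewrite !inE => -[thx xs]; split => //=; exact: lt_trans st.
apply/negP => /fsubsetP/(_ (grid_lt th t)).
rewrite !in_fset_set; [|exact: finite_setIl|exact: finite_setIl].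
by rewrite !inE /= ltxx => /(_ (conj ths st))[].
Qed.

Section piecewise_integral.
Context (a c : R -> R) (c_cont : continuous c).
Local Notation mu := (@lebesgue_measure R).
Let phi r := a (grid_le th r) * c r.

Let integrable_c (x y : R) : mu.-integrable `[x, y] (EFin \o c).
Proof.
apply: continuous_compact_integrable; first exact: segment_compact.
by apply: continuous_subspaceT => r; exact: c_cont.
Qed.

Let phiE t r : 0 < t <= T -> grid_lt th t < r < t ->
  phi r = a (grid_lt th t) * c r.
Proof.
by move=> tT /andP[sr rt]; rewrite /phi (grid_leE tT)// rt ltW.
Qed.

Let itvU t : 0 < t <= T ->
  `[0, t[%classic = `[0, grid_lt th t]%classic `|` `]grid_lt th t, t[%classic.
Proof.
move=> /grid_ltP[_ /andP[s0 st] _].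
by rewrite -itv_bndbnd_setU// bnd_simp.
Qed.

Let integrable_c_oo (x y : R) : mu.-integrable `]x, y[ (EFin \o c).
Proof.
apply: integrableS (integrable_c x y) => // r /=.
by rewrite !in_itv /= => /andP[/ltW -> /ltW ->].
Qed.

Let integrable_piece t : 0 < t <= T ->
  mu.-integrable `]grid_lt th t, t[ (EFin \o phi).
Proof.
move=> tT; set s := grid_lt th t.
have ic : mu.-integrable `]s, t[ (fun r => (a s)%:E * (EFin \o c) r)%E.
  exact: integrableZl.
apply: eq_integrable ic => // r /set_mem /=; rewrite in_itv /= => sr.
by rewrite (phiE tT sr) EFinM.
Qed.

Let integrable_setU (A B : set R) (f : R -> R) : measurable A -> measurable B ->
  mu.-integrable A (EFin \o f) -> mu.-integrable B (EFin \o f) ->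
  [disjoint A & B] -> mu.-integrable (A `|` B) (EFin \o f).
Proof.
move=> mA mB /integrableP[mfA fA] /integrableP[mfB fB] AB.
have mf : measurable_fun (A `|` B) (EFin \o f) by apply/measurable_funU.
apply/integrableP; split => //; rewrite ge0_integral_setU//.
  by rewrite lte_add_pinfty.
exact: measurableT_comp.
Qed.

Lemma integrable_grid t : 0 <= t <= T -> mu.-integrable `[0, t] (EFin \o phi).
Proof.
have set1 (x : R) : mu.-integrable [set x] (EFin \o phi).
  apply/integrableP; split; first exact: measurable_fun_set1.
  by rewrite integral_set1.
move: t; apply: grid_ind => [|t tT IH]; first by rewrite set_itv1.
have [_ /andP[s0 st] _] := grid_ltP tT.
(* The endpoint is split off: if [t] is a grid point, [grid_le th] jumps there, and the product
   formula holds only inside the interval. *)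
have -> : `[0, t]%classic = `[0, t[%classic `|` [set t].
  rewrite -set_itv1 -itv_bndbnd_setU// bnd_simp//.
  by case/andP: tT => /ltW.
apply: integrable_setU => //.
  rewrite itvU//; apply: integrable_setU => //; first exact: integrable_piece.
  apply/disj_setPS => r /= []; rewrite !in_itv /= => /andP[_ rs] /andP[sr _].
  by move: sr; rewrite ltNge rs.
by apply/disj_setPS => r /= []; rewrite in_itv /= => /andP[_ rt] rE; move: rt; rewrite rE ltxx.
Qed.

Lemma Rintegral_grid_step t : 0 < t <= T ->
  (\int[mu]_(r in `[0, t]) phi r = \int[mu]_(r in `[0, grid_lt th t]) phi r +
    a (grid_lt th t) * \int[mu]_(r in `[grid_lt th t, t]) c r)%R.
Proof.
move=> tT; have [_ /andP[s0 st] _] := grid_ltP tT.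
have tT' : 0 <= t <= T by case/andP: tT => /ltW -> ->.
have it := integrable_grid tT'.
have it' : mu.-integrable `[0, t[ (EFin \o phi).
  apply: integrableS it => // r /=.
  by rewrite !in_itv /= => /andP[-> /ltW ->].
rewrite -Rintegral_itv_bndo_bndc// itvU//.
rewrite Rintegral_setU//; first last.
- apply/disj_setPS => r /= []; rewrite !in_itv /= => /andP[_ rs] /andP[sr _].
  by move: sr; rewrite ltNge rs.
- by rewrite -itvU.
congr (_ + _); set s := grid_lt th t.
transitivity (\int[mu]_(r in `]s, t[) (a s * c r)).
  by apply: eq_Rintegral => r /set_mem /=; rewrite in_itv /= => sr; rewrite (phiE tT sr).
rewrite RintegralZl//; congr (_ * _).
rewrite Rintegral_itv_bndo_bndc// Rintegral_itv_obnd_cbnd//.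
apply: integrableS (integrable_c s t) => // r /=.
by rewrite !in_itv /= => /andP[/ltW -> ->].
Qed.

End piecewise_integral.
End grids.

(** * Exponential moments of the scheme *)

Section finite_projection.
Context {R : realType} (V : completeNormedModType R) (ip : {dot V for idfun}).
Hypothesis hilb : hilbert ip.
Context (S : set V) (oS : forall h k, S h -> S k -> ip h k = (h == k)%:R).
Context (A : {fset V}) (AS : [set` A] `<=` S).
Local Notation e := (fun i : A => fsval i).
Local Notation PA := (onb_proj ip [set` A]).

Lemma ip_onb_proj i x : ip (e i) (PA x) = ip (e i) x.
Proof.
rewrite onb_proj_fset.
exact: (@ip_sum_orthonormal _ _ ip _ e (orthonormal_fset oS AS) (fun i => ip (e i) x)).
Qed.

Lemma ip_onb_proj_notin h x : S h -> h \notin A -> ip h (PA x) = 0.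
Proof.
move=> Sh hA; rewrite onb_proj_fset linear_sumr big1// => i _ /=.
rewrite linearZr_LR /= (oS Sh (AS (fsvalP i))).
suff /negbTE -> : h != e i by rewrite mulr0.
by apply: contraNneq hA => ->; exact: fsvalP.
Qed.

Lemma onb_proj_id x : onb_proj ip [set` A] (PA x) = PA x.
Proof.
by rewrite onb_proj_fset; under eq_bigr do rewrite ip_onb_proj; rewrite onb_proj_fset.
Qed.

Lemma onb_proj_mem i : PA (e i) = e i.
Proof.
have o := orthonormal_fset oS AS.
rewrite onb_proj_fset (bigD1 i)//= o eqxx scale1r big1 ?addr0// => j ji.
by rewrite o (negbTE ji) scale0r.
Qed.

Lemma onb_proj_notin h : S h -> h \notin A -> PA h = 0.
Proof.
move=> Sh hA; rewrite onb_proj_fset big1// => i _.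
rewrite (oS (AS (fsvalP i)) Sh).
suff /negbTE -> : e i != h by rewrite scale0r.
by apply: contraNneq hA => <-; exact: fsvalP.
Qed.

Lemma norm_onb_proj_sq x : `|PA x| ^+ 2 = \sum_i ip (e i) x ^+ 2.
Proof.
rewrite onb_proj_fset.
exact: (norm_sum_orthonormal hilb (orthonormal_fset oS AS)).
Qed.

Lemma ip_onb_projr x y : ip x (PA y) = \sum_i ip (e i) x * ip (e i) y.
Proof.
rewrite onb_proj_fset linear_sumr; apply: eq_bigr => i _ /=.
by rewrite linearZr_LR /= (ipC ip x) mulrC.
Qed.

Lemma norm_onb_proj_le x : `|PA x| <= `|x|.
Proof.
rewrite -ler_sqr ?nnegrE// norm_onb_proj_sq.
exact: (bessel hilb (orthonormal_fset oS AS)).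
Qed.

Lemma ip_diag_op_proj lam (phi : R -> R) i x :
  ip (e i) (diag_op ip S lam phi (PA x)) = phi (lam (e i)) * ip (e i) x.
Proof.
rewrite (diag_op_span lam phi AS); last by move=> h Sh hA; exact: ip_onb_proj_notin.
rewrite (@ip_sum_orthonormal _ _ ip _ e (orthonormal_fset oS AS)
  (fun i => phi (lam (e i)) * ip (e i) (PA x))).
by rewrite ip_onb_proj.
Qed.

Lemma onb_projZ a x : PA (a *: x) = a *: PA x.
Proof.
rewrite !onb_proj_fset scaler_sumr; apply: eq_bigr => i _.
by rewrite linearZr_LR /= scalerA.
Qed.

Lemma onb_projD x y : PA (x + y) = PA x + PA y.
Proof.
rewrite !onb_proj_fset -big_split; apply: eq_bigr => i _ /=.
by rewrite linearDr scalerDl.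
Qed.

End finite_projection.

Section step_integral.
Context {R : realType} {d : measure_display} {Omega : measurableType d}.
Context (U H : completeNormedModType R) (UU : set U).
Context (B : {fset U}) (BU : [set` B] `<=` UU) (W : R -> U -> Omega -> R).

Lemma step_integral_fset (Phi : Omega -> U -> H) s t w :
  (forall u, UU u -> u \notin B -> Phi w u = 0) ->
  step_integral UU W s t Phi w =
  \sum_(j : B) (W t (fsval j) w - W s (fsval j) w) *: Phi w (fsval j).
Proof.
move=> Phi0; rewrite /step_integral -(fsbig_widen [set` B])//; last first.
  by move=> u [UUu /= /negP uB]; rewrite /= Phi0// scaler0.
rewrite fsbig_finite//= set_fsetK.
exact: (big_seq_fsetE _ B predT (fun u => (W t u w - W s u w) *: Phi w u)).
Qed.

End step_integral.

Section scheme.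
Context {R : realType}.
Context (H : completeNormedModType R) (ipH : {dot H for idfun}).
Hypothesis hilbH : hilbert ipH.
Context (U : completeNormedModType R) (ipU : {dot U for idfun}).
Hypothesis hilbU : hilbert ipU.
Context (HH : set H) (oH : forall h k, HH h -> HH k -> ipH h k = (h == k)%:R).
Context (UU : set U) (oU : forall h k, UU h -> UU k -> ipU h k = (h == k)%:R).
Context (T : R) (T0 : 0 < T) (gamma : R).
Context (lam : H -> R) (lam_lt0 : forall h, HH h -> lam h < 0).
Context {d : measure_display} {Omega : measurableType d}.
Context (P : probability Omega R) (Ft : R -> set_system Omega).
Hypothesis filtF : filtration T Ft.
Context (W : R -> U -> Omega -> R) (wienerW : cylindrical_wiener P T Ft W).
Local Notation expA := (semigroup ipH HH lam).
Local Notation Hg := (interp_space ipH HH lam gamma).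
Local Notation BorelHg := (norm_borel Hg (interp_norm ipH HH lam gamma)).
Local Notation intdW := (step_integral (H := H) UU W).
Context (F : H -> H) (F_meas : measurable_wrt Hg BorelHg <<s open >> F).
Context (B : H -> U -> H) (B_HS : forall x, Hg x -> hs_op UU (B x)).
Hypothesis B_meas : measurable_wrt Hg BorelHg
  (norm_borel (hs_op UU) (hs_norm UU)) B.
Context (vth : R) (B_le : forall x, Hg x -> hs_norm UU (B x) ^+ 2 <= vth).
Context (eps b1 b2 : R) (eps0 : 0 < eps) (vth0 : 0 <= vth)
  (b10 : 0 <= b1) (b20 : 0 <= b2).
Context (th : set R) (gth : grid T th).
Context (A : {fset H}) (AH : [set` A] `<=` HH).
Context (BJ : {fset U}) (BU : [set` BJ] `<=` UU).
Local Notation PI := (onb_proj ipH [set` A]).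
Local Notation PJ := (onb_proj ipU [set` BJ]).
Context (D : set H) (D_meas : BorelHg D).
Context (y : R -> Omega -> H).
Hypothesis y_val : forall t w, 0 <= t <= T -> exists z, y t w = PI z.
Hypothesis y_meas : forall t, 0 <= t <= T ->
  measurable_wrt setT (Ft t) BorelHg (y t).
Hypothesis y_eq : forall t, 0 < t <= T ->
  {ae P, forall w,
    let s := grid_lt th t in
    let ys := y s in
    let ind (x : H) : R := \1_D x in
    y t w =
      expA (t - s) (ys w + (ind (ys w) * (t - s)) *: PI (F (ys w)))
      + (1 + `|intdW s t (fun w' => PI \o B (ys w') \o PJ) w| ^+ 2)^-1
        *: intdW s t
             (fun w' u =>
                expA (t - s) (ind (ys w') *: PI (B (ys w') (PJ u)))) w}.

Let e (i : A) : H := fsval i.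
Let u (j : BJ) : U := fsval j.
Let ou : forall i j, ipU (u i) (u j) = (i == j)%:R := orthonormal_fset oU BU.
Let eH i : HH (e i). Proof. by apply: AH; exact: fsvalP. Qed.

Let y_proj t w : 0 <= t <= T -> PI (y t w) = y t w.
Proof. by move=> /(y_val w)[z ->]; rewrite (onb_proj_id oH AH). Qed.

Let y_norm t w : 0 <= t <= T -> `|y t w| ^+ 2 = \sum_i ipH (e i) (y t w) ^+ 2.
Proof. by move=> tT; rewrite -{1}(y_proj w tT) (norm_onb_proj_sq hilbH oH AH). Qed.

Let y_Hg t w : 0 <= t <= T -> Hg (y t w).
Proof.
move=> /(y_val w)[z ->]; apply: (@diag_dom_span _ _ _ _ _ _ A) => h hH hA.
exact: (ip_onb_proj_notin oH AH).
Qed.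

Let sigma_Ft t : 0 <= t <= T -> sigma_algebra setT (Ft t).
Proof. by move=> tT; have [/(_ t tT)[]] := filtF. Qed.

Let measurable_comp t (f : H -> R) : 0 <= t <= T ->
  measurable_wrt Hg BorelHg (@measurable _ (measurableTypeR R)) f ->
  measurable_for (Ft t) (fun w => f (y t w)).
Proof.
move=> tT mf; apply/(measurable_forP (sigma_Ft tT)) => E mE.
have := measurable_wrt_trans (y_meas tT) mf (fun w _ => y_Hg w tT).
by apply; exists E => //; rewrite setTI.
Qed.

Let measurable_y t i : 0 <= t <= T -> measurable_for (Ft t) (fun w => ipH (e i) (y t w)).
Proof.
by move=> tT; apply: measurable_comp => //; exact: (measurable_ip_interp hilbH oH).
Qed.

Let measurable_Fy t i : 0 <= t <= T ->
  measurable_for (Ft t) (fun w => ipH (e i) (F (y t w))).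
Proof.
move=> tT; apply: (@measurable_comp _ (fun x => ipH (e i) (F x))) => //.
apply: (measurable_wrt_trans F_meas (Y := setT)) => //.
by apply: measurable_wrt_continuous; exact: ip_continuous.
Qed.

Let measurable_By t i j : 0 <= t <= T ->
  measurable_for (Ft t) (fun w => ipH (e i) (B (y t w) (u j))).
Proof.
move=> tT; apply: (@measurable_comp _ (fun x => ipH (e i) (B x (u j)))) => //.
rewrite -[X in measurable_wrt _ _ _ X]/((fun L : U -> H => ipH (e i) (L (u j))) \o B).
apply: (measurable_wrt_trans B_meas) B_HS.
have UUj : UU (u j) by exact: BU (fsvalP j).
exact: (measurable_ip_hs hilbH UUj).
Qed.

Let measurable_Dy t : 0 <= t <= T -> Ft t [set w | D (y t w)].
Proof.
move=> tT; have := y_meas tT; apply.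
by exists D => //; rewrite setTI.
Qed.

(** Bessel's inequality in [H] for each [u j]; the finite family [u] is part of the basis that
    computes the Hilbert-Schmidt norm, which is finite by [B_HS]. *)
Let B_coord_le x : Hg x -> \sum_i \sum_j ipH (e i) (B x (u j)) ^+ 2 <= vth.
Proof.
move=> Hx; apply: le_trans (B_le Hx); rewrite exchange_big /=.
apply: (@le_trans _ _ (\sum_j `|B x (u j)| ^+ 2)).
  by apply: ler_sum => j _; exact: (bessel hilbH (orthonormal_fset oH AH)).
have [_ _ B2] := B_HS Hx.
have B0 : (0 <= hs_normsq UU (B x))%E.
  by apply: esum_ge0 => v _; rewrite lee_fin sqr_ge0.
rewrite sqr_sqrtr ?fine_ge0// -lee_fin fineK ?ge0_fin_numE//.
apply: esum_ge; exists [set` BJ]; first by split.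
rewrite fsbig_finite//= set_fsetK sumEFin lee_fin.
by rewrite (big_seq_fsetE _ BJ predT (fun v => `|B x v| ^+ 2)).
Qed.

(** The recursion in coordinates. The [e i] are eigenvectors, so the semigroup acts by scalar
    factors, and [PJ] kills all basis vectors outside [BJ], so both stochastic integrals are finite
    sums. *)
Let nt_eq t : 0 < t <= T -> let s := grid_lt th t in
  {ae P, forall w, `|y t w| ^+ 2 =
  \sum_i (expR ((t - s) * lam (e i)) * (ipH (e i) (y s w) +
    \1_[set w | D (y s w)] w * ((t - s) * ipH (e i) (F (y s w)) +
    increment W s t u (fun j => ipH (e i) (B (y s w) (u j))) w /
    (1 + \sum_k increment W s t u (fun j => ipH (e k) (B (y s w) (u j))) w ^+ 2))))
    ^+ 2}.
Proof.
move=> tT s; move: (y_eq tT); apply: filterS => w /=; rewrite -/s.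
have [_ /andP[s0 st] _] := grid_ltP gth tT.
have sT : 0 <= s <= T by rewrite s0 (le_trans (ltW st))//; case/andP: tT.
have tT' : 0 <= t <= T by case/andP: tT => /ltW -> ->.
set ind := \1_D (y s w).
have indE : \1_[set w | D (y s w)] w = ind by rewrite /ind !indicE.
have Blin : linear (B (y s w)) by have [] := B_HS (y_Hg w sT).
have B0 : B (y s w) 0 = 0.
  have := Blin (-1) 0 0; rewrite scaler0 addr0 scaleN1r.
  by rewrite addNr => ->.
have PI0 : PI 0 = 0 by rewrite -[X in PI X](scale0r 0) onb_projZ scale0r.
have PJu j : PJ (u j) = u j by exact: (onb_proj_mem oU BU).
have PJ0 v : UU v -> v \notin BJ -> PJ v = 0 by exact: (onb_proj_notin oU BU).
set S := fun i j => ipH (e i) (B (y s w) (u j)).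
set Z := fun i => increment W s t u (S i) w.
rewrite (step_integral_fset BU); last first.
  by move=> v UUv vB; rewrite /= PJ0// B0 PI0.
rewrite (step_integral_fset BU); last first.
  move=> v UUv vB; rewrite PJ0// B0 PI0 scaler0 -[X in expA _ X]PI0.
  by rewrite /semigroup (diag_op_span _ _ AH) ?big1// => [i _|h hH hA];
    rewrite PI0 linear0r ?mulr0 ?scale0r.
rewrite /= => yE; rewrite y_norm//; apply: eq_bigr => i _; congr (_ ^+ 2).
have ipZ a z : ipH (e i) (a *: z) = a * ipH (e i) z by rewrite linearZr_LR.
have ipD x z : ipH (e i) (x + z) = ipH (e i) x + ipH (e i) z by rewrite linearDr.
have expAi z : ipH (e i) (expA (t - s) (PI z)) =
  expR ((t - s) * lam (e i)) * ipH (e i) z.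
  exact: (ip_diag_op_proj oH AH lam (fun l => expR ((t - s) * l))).
rewrite yE.
have -> : (1 + `|\sum_(j : BJ) (W t (fsval j) w - W s (fsval j) w) *:
    PI (B (y s w) (PJ (fsval j)))| ^+ 2) = 1 + \sum_k Z k ^+ 2.
  congr (1 + _).
  have -> : \sum_(j : BJ) (W t (fsval j) w - W s (fsval j) w) *:
      PI (B (y s w) (PJ (fsval j))) =
      PI (\sum_(j : BJ) (W t (fsval j) w - W s (fsval j) w) *: B (y s w) (u j)).
    rewrite (big_morph _ (onb_projD ipH A) PI0); apply: eq_bigr => j _.
    by rewrite onb_projZ PJu.
  rewrite (norm_onb_proj_sq hilbH oH AH); apply: eq_bigr => k _; congr (_ ^+ 2).
  rewrite linear_sumr; apply: eq_bigr => j _ /=.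
  by rewrite linearZr_LR /= mulrC.
have -> : y s w + (ind * (t - s)) *: PI (F (y s w)) =
    PI (y s w + (ind * (t - s)) *: F (y s w)).
  by rewrite onb_projD onb_projZ y_proj.
rewrite ipD ipZ linear_sumr /= expAi.
have -> : \sum_(j : BJ) ipH (e i) ((W t (fsval j) w - W s (fsval j) w) *:
    expA (t - s) (ind *: PI (B (y s w) (PJ (fsval j))))) =
    expR ((t - s) * lam (e i)) * ind * Z i.
  rewrite /Z /increment mulr_sumr; apply: eq_bigr => j _.
  by rewrite ipZ -onb_projZ expAi ipZ -/(u j) PJu /S; ring.
rewrite ipD ipZ indE -/(S i) -/(Z i); ring.
Qed.

Local Notation kappa := (2%:R * (b2 + eps * vth)).
Let rate (r : R) : R := eps * (2%:R * b1 + vth) / expR (kappa * r).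
Let acc t w := \int[lebesgue_measure]_(r in `[0%R, t])
  (\1_D (y (grid_le th r) w) * rate r).

Let rate_cont : continuous rate.
Proof.
move=> r; apply: cvgMr => /=; apply: cvgV; first by rewrite gt_eqF// expR_gt0.
apply: continuous_comp; last exact: continuous_expR.
by apply: cvgMr.
Qed.

Let acc_step t w : 0 < t <= T -> let s := grid_lt th t in
  acc t w = acc s w + \1_[set w | D (y s w)] w *
    \int[lebesgue_measure]_(r in `[s, t]) rate r.
Proof.
move=> tT /=.
exact: (Rintegral_grid_step gth (fun r => \1_D (y r w)) rate_cont tT).
Qed.

Let rate_integral_ge s t : 0 <= s <= t ->
  rate t * (t - s) <= \int[lebesgue_measure]_(r in `[s, t]) rate r.
Proof.
move=> /andP[s0 st].
have -> : rate t * (t - s) = \int[lebesgue_measure]_(r in `[s, t]) rate t.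
  rewrite Rintegral_cst//; congr (_ * _).
  have := lebesgue_measure_itv `[s, t]; rewrite /= lte_fin => ->.
  move: st; rewrite le_eqVlt => /predU1P[->|->]//.
  by rewrite ltxx subrr.
apply: le_Rintegral => //.
- apply: continuous_compact_integrable; first exact: segment_compact.
  by apply: continuous_subspaceT => r; exact: cvg_cst.
- apply: continuous_compact_integrable; first exact: segment_compact.
  by apply: continuous_subspaceT.
move=> r /=; rewrite in_itv /= => /andP[sr rt].
rewrite /rate ler_wpM2l//.
  by rewrite mulr_ge0 ?(ltW eps0)// addr_ge0// mulr_ge0.
rewrite lef_pV2 ?posrE ?expR_gt0// ler_expR ler_wpM2l//.
by rewrite mulr_ge0// addr_ge0// mulr_ge0// ltW.
Qed.

Let measurable_for_mono s t (f : Omega -> R) : 0 <= s <= t -> t <= T ->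
  measurable_for (Ft s) f -> measurable_for (Ft t) f.
Proof.
move=> /andP[s0 st] tT /(measurable_forP _) mf.
apply/(measurable_forP (sigma_Ft _)); first by rewrite (le_trans s0).
move=> E mE; have [_ /(_ s t s0 st tT)] := filtF; apply.
by apply: mf mE; apply: sigma_Ft; rewrite s0 (le_trans st).
Qed.

Let rate_ge0 r : 0 <= rate r.
Proof.
by rewrite divr_ge0 ?expR_ge0// mulr_ge0 ?(ltW eps0)// addr_ge0// mulr_ge0.
Qed.

Lemma scheme_weight_ge0 t w : 0 <= acc t w.
Proof.
by apply: Rintegral_ge0 => r _; apply: mulr_ge0.
Qed.

Lemma scheme_weight_le t w : 0 <= t <= T ->
  acc t w <= eps * (2%:R * b1 + vth) * T.
Proof.
move=> tT; have c0 : 0 <= eps * (2%:R * b1 + vth).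
  by rewrite mulr_ge0 ?(ltW eps0)// addr_ge0// mulr_ge0.
apply: (@le_trans _ _ (eps * (2%:R * b1 + vth) * t)); last first.
  by rewrite ler_wpM2l//; case/andP: tT.
have -> : eps * (2%:R * b1 + vth) * t =
    \int[lebesgue_measure]_(r in `[0, t]) (eps * (2%:R * b1 + vth)).
  rewrite Rintegral_cst//; congr (_ * _).
  have := lebesgue_measure_itv `[0, t]; rewrite /= lte_fin => ->.
  have /andP[+ _] := tT; rewrite le_eqVlt => /predU1P[<-|->]/=; last by rewrite subr0.
  by rewrite ltxx.
apply: le_Rintegral => //.
- exact: (integrable_grid gth (fun r => \1_D (y r w)) rate_cont tT).
- apply: continuous_compact_integrable; first exact: segment_compact.
  by apply: continuous_subspaceT => r; exact: cvg_cst.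
move=> r /=; rewrite in_itv /= => /andP[r0 _].
apply: (@le_trans _ _ (rate r)).
  by rewrite -[leRHS]mul1r ler_wpM2r// indicE; case: (_ \in _).
rewrite /rate ler_pdivrMr ?expR_gt0// ler_peMr// (le_trans _ (expR_ge1Dx _))//.
by rewrite lerDl mulr_ge0// mulr_ge0// addr_ge0// mulr_ge0// ltW.
Qed.

(** Over one step the integral is an indicator known at time [s] times a deterministic number, so
    adaptedness follows by induction along the grid. *)
Let measurable_for_weight t : 0 <= t <= T -> measurable_for (Ft t) (acc t).
Proof.
move: t; apply: (grid_ind gth).
  have -> : acc 0 = cst 0.
    by apply/funext => w; rewrite /acc set_itv1 Rintegral_set1.
  exact: measurable_cst.
move=> t tT; set s := grid_lt th t => macc.
have [_ /andP[s0 st] _] := grid_ltP gth tT; rewrite -/s in s0 st.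
have [t_gt0 t_le] := andP tT.
have sT : 0 <= s <= T by rewrite s0 (le_trans (ltW st)).
rewrite (_ : acc t = fun w => acc s w + \1_[set w | D (y s w)] w *
    \int[lebesgue_measure]_(r in `[s, t]) rate r); last first.
  by apply/funext => w; exact: acc_step.
apply: (@measurable_for_mono s) => //; first by rewrite s0 ltW.
apply: measurable_funD => //; apply: measurable_funM => //.
exact: (measurable_for_indic (sigma_Ft sT) (measurable_Dy sT)).
Qed.

Lemma measurable_scheme_weight t : 0 <= t <= T -> measurable_fun setT (acc t).
Proof.
move=> tT; apply: (measurable_for_sub (sigma_Ft tT)).
  exact: (filtration_measurable filtF).
exact: measurable_for_weight.
Qed.

Lemma measurable_scheme_norm t : 0 <= t <= T ->
  measurable_fun setT (fun w => `|y t w| ^+ 2).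
Proof.
move=> tT; rewrite (_ : (fun w => _) = fun w => \sum_i ipH (e i) (y t w) ^+ 2).
  apply: measurable_sum => i; apply: measurable_funX.
  apply: (measurable_for_sub (sigma_Ft tT)) => //.
    exact: (filtration_measurable filtF).
  exact: measurable_y.
by apply/funext => w; rewrite y_norm.
Qed.

Context (K tau0 tau sg : R) (K0 : 0 <= K) (t0 : 0 < tau) (tt0 : tau <= tau0).
Hypothesis mesh_tau : mesh th <= tau ^+ 8.
Hypothesis sg0 : 0 <= sg.
Hypothesis D_norm : forall x, D x -> `|x| ^+ 2 * tau ^+ 2 <= K ^+ 2.
Hypothesis D_drift : forall x, D x -> `|PI (F x)| ^+ 2 * tau ^+ 2 <= K ^+ 2.
Hypothesis D_ip : forall x, D x -> ipH x (PI (F x)) <= b1 + b2 * `|x| ^+ 2.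
Let M t w := expR ((sg + eps * `|y t w| ^+ 2) / expR (kappa * t) - acc t w).
Let C := step_constant eps vth b1 b2 K tau0.

(** The factors exp(C (t-s) tau) of the single steps multiply to exp(C t tau), however many grid
    points there are. *)
Lemma scheme_moment_le t : 0 <= t <= T ->
  (\int[P]_w (M t w)%:E <= (expR (C * t * tau))%:E *
     \int[P]_w (expR (sg + eps * `|y 0 w| ^+ 2))%:E)%E.
Proof.
move: t; apply: (grid_ind gth).
  have acc0 w : acc 0 w = 0 by rewrite /acc set_itv1 Rintegral_set1.
  rewrite mulr0 mul0r expR0 mul1e le_eqVlt; apply/orP; left; apply/eqP.
  by apply: eq_integral => w _; rewrite /M acc0 mulr0 expR0 divr1 subr0.
move=> t tT; set s := grid_lt th t => IH.
have [_ /andP[s0 st] _] := grid_ltP gth tT; rewrite -/s in s0 st.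
have [t_gt0 t_le] := andP tT.
have sT : 0 <= s <= T by rewrite s0 (le_trans (ltW st)).
have tT' : 0 <= t <= T by rewrite ltW.
set delta := \int[lebesgue_measure]_(r in `[s, t]) rate r.
have accE w : acc t w = acc s w + \1_[set w | D (y s w)] w * delta.
  exact: acc_step.
have := one_step_expectation_le (delta := delta) filtF hilbU wienerW s0 st t_le
  ou (ltW eps0) vth0 b10 b20 K0 t0 tt0 _ sg0 _ (fun i => measurable_y i sT)
  (fun i => measurable_Fy i sT) (fun i j => measurable_By i j sT)
  (measurable_Dy sT) (measurable_for_weight sT) (measurable_scheme_norm tT')
  _ _ _ _ _ (nt_eq tT).
move=> step.
have MtE : (\int[P]_w (M t w)%:E = \int[P]_w (expR ((sg + eps * `|y t w| ^+ 2) /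
    expR (kappa * t) - (acc s w + \1_[set w | D (y s w)] w * delta)))%:E)%E.
  by apply: eq_integral => w _; rewrite /M accE.
have MsE : (\int[P]_w (M s w)%:E = \int[P]_w (expR ((sg + eps *
    \sum_i ipH (e i) (y s w) ^+ 2) / expR (kappa * s) - acc s w))%:E)%E.
  by apply: eq_integral => w _; rewrite /M y_norm.
rewrite MtE.
apply: le_trans (step _ _ _ _ _ _ _) _.
- by apply: le_trans mesh_tau; exact: (grid_step_le_mesh gth).
- apply: le_trans (rate_integral_ge _); last by rewrite s0 ltW.
  by rewrite /rate mulrAC.
- by move=> i; rewrite ltW// lam_lt0.
- by move=> w /D_norm; rewrite y_norm// mulr_suml.
- by move=> w /D_drift; rewrite (norm_onb_proj_sq hilbH oH AH) mulr_suml.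
- by move=> w /D_ip; rewrite (ip_onb_projr ipH) y_norm.
- move=> w; exact: B_coord_le (y_Hg w sT).
rewrite -MsE; apply: (@le_trans _ _ ((expR (C * (t - s) * tau))%:E *
    ((expR (C * s * tau))%:E * \int[P]_w (expR (sg + eps * `|y 0 w| ^+ 2))%:E))%E).
  by rewrite lee_wpmul2l// lee_fin expR_ge0.
rewrite muleA -EFinM -expRD -!mulrDl -mulrDr subrK //.
Qed.

End scheme.

(** * Approximation by finite-dimensional projections *)

Section projections_onto_finite_spans.
Context {R : realType} (V : completeNormedModType R) (ip : {dot V for idfun}).
Hypothesis hilb : hilbert ip.
Context (S : set V) (onbS : orthonormal_basis ip S).
Hypothesis sepV : separable_space V.

Let oS : forall h k, S h -> S k -> ip h k = (h == k)%:R.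
Proof. by case: onbS. Qed.

Lemma norm_sub_onb_proj_le (A : {fset V}) x v : [set` A] `<=` S ->
  (exists a : V -> R, v = \sum_(h <- A) a h *: h) ->
  `|x - onb_proj ip [set` A] x| <= `|x - v|.
Proof.
move=> AS [a ->]; rewrite onb_proj_fset.
have -> : \sum_(h <- A) a h *: h = \sum_(i : A) a (fsval i) *: fsval i.
  exact: (big_seq_fsetE _ A predT (fun h => a h *: h)).
exact: (norm_sub_proj_le hilb (orthonormal_fset oS AS)).
Qed.

Lemma span_subset (A B : {fset V}) v : (A `<=` B)%fset ->
  (exists a : V -> R, v = \sum_(h <- A) a h *: h) ->
  exists a : V -> R, v = \sum_(h <- B) a h *: h.
Proof.
move=> AB [a ->]; exists (fun h => if h \in A then a h else 0).
rewrite -(big_fset_incl _ AB) /=; last by move=> h _ /negbTE ->; rewrite scale0r.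
by rewrite [LHS]big_seq [RHS]big_seq; apply: eq_bigr => h ->.
Qed.

Lemma span_approx x (r : R) : 0 < r -> exists A : {fset V}, exists v,
  [/\ [set` A] `<=` S, exists a : V -> R, v = \sum_(h <- A) a h *: h
    & `|x - v| < r].
Proof.
move=> r0; have [_ /seteqP[_ /(_ x Logic.I)]] := onbS.
move=> /(_ (ball x r) (nbhsx_ballx _ _ r0))[v [[J [Jfin JS] [a ->]] xv]].
exists (fset_set J), (\sum_(h \in J) a h *: h); split.
- by rewrite fset_setK.
- by exists a; rewrite fsbig_finite.
- by rewrite -ball_normE in xv.
Qed.

(** Fatou's lemma needs a sequence of finite sets. Each member of a dense sequence is approximated
    to every precision 1/(k+1) from the span of some finite [J]. The union over pairs below [n]
    contains any given such set eventually, and the projection is the best approximation from its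
    span. *)
Lemma onb_proj_dense : exists A : nat -> {fset V},
  (forall n, [set` A n] `<=` S) /\
  forall x, onb_proj ip [set` A n] x @[n --> \oo] --> x.
Proof.
have [Q Qc Qd] := sepV.
have [g gP] : exists g : nat -> V, Q `<=` range g.
  have /pfcard_geP[Q0|[g]] := Qc.
    by exists (fun=> 0); rewrite Q0.
  by exists g => x /(@surj _ _ _ _ g)[n _ <-]; exists n.
have /choice[J JP] (p : nat * nat) : exists A : {fset V}, [set` A] `<=` S /\
    exists2 v, exists a : V -> R, v = \sum_(h <- A) a h *: h
    & `|g p.1 - v| < p.2.+1%:R^-1.
  have [|A [v [AS sp gv]]] := @span_approx (g p.1) p.2.+1%:R^-1.
    by rewrite invr_gt0.
  by exists A; split => //; exists v.
pose A n := (\bigcup_(p <- [seq (i, j) | i <- iota 0 n, j <- iota 0 n]) J p)%fset.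
have AS n : [set` A n] `<=` S.
  move=> h /= /bigfcupP[p _ hJ]; have [JS _] := JP p; exact: JS.
exists A; split => // x; apply/cvgrPdist_lt => e e0.
have e2 : 0 < e / 2 by rewrite divr_gt0.
have [y [gx [n _ gn]]] : (ball x (e / 2) `&` range g) !=set0.
  have [||z [xz /gP zg]] := Qd (ball x (e / 2)).
  - by exists x; exact: ballxx.
  - exact: ball_open.
  by exists z.
rewrite -gn -ball_normE /= in gx.
have [k /= ke] : exists k : nat, k.+1%:R^-1 < e / 2 :> R.
  have [N _ H] := near_infty_natSinv_lt (PosNum e2).
  by exists N; exact: (H N (leqnn N)).
have [_ [v Jv gv]] := JP (n, k).
exists (maxn n k).+1 => // N /= nkN.
have nN : (n < N)%N by apply: leq_trans nkN; rewrite ltnS leq_maxl.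
have kN : (k < N)%N by apply: leq_trans nkN; rewrite ltnS leq_maxr.
apply: le_lt_trans (norm_sub_onb_proj_le _ (AS N) (span_subset _ Jv)) _.
  apply: bigfcup_sup => //.
  by apply/allpairsP; exists (n, k); rewrite /= !mem_iota.
rewrite (splitr e) (_ : x - v = (x - g n) + (g n - v)).
  by apply: le_lt_trans (ler_normD _ _) _; rewrite ltrD// (lt_trans gv).
by rewrite addrA subrK.
Qed.

End projections_onto_finite_spans.

(** * Powers of the mesh and the chain of inequalities *)

Section mesh_powers.
Context {R : realType}.

Lemma powR_eighth (m : R) : 0 <= m -> (m `^ 8^-1) ^+ 8 = m.
Proof.
move=> m0; rewrite -powR_mulrn ?powR_ge0// -powRrM mulVf ?powRr1//.
Qed.

Lemma powR_eighthK (a : R) : 0 <= a -> (a ^+ 8) `^ 8^-1 = a.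
Proof. by move=> a0; rewrite -powR_mulrn// -powRrM mulfV ?powRr1. Qed.

(** The left side is m^(1/4 - p), which is nondecreasing in m because p <= 1/4. *)
Lemma powR_mesh_le (m T p : R) : 0 < m -> m <= T -> p <= 4^-1 ->
  m `^ (- p) * (m `^ 8^-1) ^+ 2 <= T `^ (4^-1 - p).
Proof.
move=> m0 mT p4.
rewrite -powR_mulrn ?powR_ge0// -powRrM -powRD; last by rewrite (gt_eqF m0) implybT.
rewrite (_ : - p + 8^-1 * 2%:R = 4^-1 - p); last by field.
apply: ge0_ler_powR; rewrite ?subr_ge0// nnegrE ?ltW//.
exact: lt_le_trans mT.
Qed.

End mesh_powers.

Theorem corollary3p4 (R : realType)
  (H : completeNormedModType R) (ipH : {dot H for idfun})
  (hilbH : hilbert ipH) (sepH : separable_space H)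
  (U : completeNormedModType R) (ipU : {dot U for idfun})
  (hilbU : hilbert ipU) (sepU : separable_space U)
  (HH : set H) (HH0 : HH !=set0) (onbH : orthonormal_basis ipH HH)
  (UU : set U) (UU0 : UU !=set0) (onbU : orthonormal_basis ipU UU)
  (T : R) (T0 : 0 < T) (gamma : R) (gamma0 : 0 <= gamma)
  (delta : R) (delta0 : 0 <= delta) (delta1 : delta < 14%:R^-1)
  (lam : H -> R) (lam0 : (ereal_sup [set (lam h)%:E | h in HH] < 0)%E)
  (d : measure_display) (Omega : measurableType d) (P : probability Omega R)
  (Ft : R -> set_system Omega) (filtF : filtration T Ft)
  (W : R -> U -> Omega -> R) (wienerW : cylindrical_wiener P T Ft W) :
  let expA := semigroup ipH HH lam in
  let Hg := interp_space ipH HH lam gamma in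
  let normHg := interp_norm ipH HH lam gamma in
  let BorelHg := norm_borel Hg normHg in
  let PI := onb_proj ipH in
  let PJ := onb_proj ipU in
  let intdW := step_integral (H := H) UU W in
  forall (xi : Omega -> H) (xi_Hg : forall w, Hg (xi w))
    (xi_meas : measurable_wrt setT (Ft 0) BorelHg xi)
    (F : H -> H) (F_meas : measurable_wrt Hg BorelHg <<s open >> F)
    (B : H -> U -> H) (B_HS : forall x, Hg x -> hs_op UU (B x))
    (B_meas : measurable_wrt Hg BorelHg
                (norm_borel (hs_op UU) (hs_norm UU)) B)
    (D : set H -> R -> set H)
    (D_meas : forall (I : set H) (h : R), I `<=` HH -> 0 < h <= T ->
       BorelHg (D I h))
    (vtheta : R)
    (vtheta_ge : (ereal_sup [set (hs_norm UU (B x) ^+ 2)%:E | x in Hg]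
                   <= vtheta%:E)%E)
    (b1 b2 : R) (b1_ge0 : 0 <= b1) (b2_ge0 : 0 <= b2)
    (eps : R) (eps_gt0 : 0 < eps)
    (vsig : R) (vsig_gt0 : 0 < vsig)
    (vsig_lt : vsig < (1 - 14%:R * delta) / 4%:R)
    (c : R)
    (c_ge : 2%:R * Num.max 1 (Num.max (eps * b1)
              (Num.max (eps * Num.sqrt vtheta) eps)) <= c)
    (xi_exp : ('E_P[fun w => expR (eps * `|xi w| ^+ 2)] < +oo)%E)
    (D_hyp : forall (h : R) (I : set H) (J : set U) (x : H),
       0 < h <= T -> fsets HH I -> fsets UU J -> D I h x ->
       [/\ D I h `<=`
             [set v | Num.sqrt vtheta + eps * `|v| ^+ 2 <= c * h `^ (- vsig)],
           Num.max `|PI I (F x)| (hs_norm UU (PI I \o B x \o PJ J))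
             <= c * h `^ (- delta)
         & ipH x (PI I (F x)) <= b1 + b2 * `|x| ^+ 2])
    (Y : set R -> set H -> set U -> R -> Omega -> H)
    (Y_val : forall th I J, grid T th -> fsets HH I -> fsets UU J ->
       forall t w, 0 <= t <= T -> (PI I @` Hg) (Y th I J t w))
    (Y_adapted : forall th I J, grid T th -> fsets HH I -> fsets UU J ->
       forall t, 0 <= t <= T ->
       measurable_wrt setT (Ft t) BorelHg (Y th I J t))
    (Y_cont : forall th I J, grid T th -> fsets HH I -> fsets UU J ->
       forall w t, 0 <= t <= T ->
       normHg (Y th I J s w - Y th I J t w)
         @[s --> within `[0, T] (nbhs t)] --> 0)
    (Y_eq : forall th I J, grid T th -> fsets HH I -> fsets UU J ->
       forall t, 0 < t <= T ->
       (forall w, Y th I J 0 w = PI I (xi w)) /\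
       {ae P, forall w,
         let s := grid_lt th t in
         let y := Y th I J s in
         let ind (x : H) : R := \1_(D I (mesh th)) x in
         Y th I J t w =
           expA (t - s) (y w + (ind (y w) * (t - s)) *: PI I (F (y w)))
           + (1 + `|intdW s t
                     (fun w' => PI I \o B (y w') \o PJ J) w| ^+ 2)^-1
             *: intdW s t
                  (fun w' u =>
                     expA (t - s) (ind (y w') *: PI I (B (y w') (PJ J u)))) w}),
  let E th I J t :=
    ('E_P[fun w =>
       expR ((Num.sqrt vtheta + eps * `|Y th I J t w| ^+ 2)
               / expR (2%:R * (b2 + eps * vtheta) * t)
             - \int[lebesgue_measure]_(s in `[0%R, t])
                 (\1_(D I (mesh th)) (Y th I J (grid_le th s) w)
                  * (eps * (2%:R * b1 + vtheta)
                     / expR (2%:R * (b2 + eps * vtheta) * s))))])%E in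
  let E' th I J t :=
    ('E_P[fun w => expR (eps * `|Y th I J t w| ^+ 2
                         / expR (2%:R * (b2 + eps * vtheta) * t))])%E in
  let supIJt := esup_grid T (fsets HH) (fsets UU) in
  [/\ (limsup_mesh T (supIJt E)
         <= 'E_P[fun w => expR (Num.sqrt vtheta + eps * `|xi w| ^+ 2)])%E,
      ('E_P[fun w => expR (Num.sqrt vtheta + eps * `|xi w| ^+ 2)]
         <= ereal_sup [set supIJt E th | th in grid T])%E,
      (ereal_sup [set supIJt E th | th in grid T]
         <= (expR (Num.sqrt vtheta))%:E
            * ereal_sup [set supIJt E' th | th in grid T])%E
    & ((expR (Num.sqrt vtheta))%:E
         * ereal_sup [set supIJt E' th | th in grid T] < +oo)%E].
Proof.
(* These thresholds match the square of the eighth root of the mesh, which is its fourth root. *)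
have delta_le : 2 * delta <= 4^-1 by lra.
have vsig_le (v : R) : v < (1 - 14%:R * delta) / 4%:R -> v <= 4^-1 by lra.
move=> expA Hg normHg BorelHg PI PJ intdW xi xi_Hg xi_meas F F_meas B B_HS B_meas
  D D_meas vth vtheta_ge b1 b2 b10 b20 eps eps0 vsig vsig0 vsig_lt c c_ge xi_exp
  D_hyp Y Y_val Y_adapted Y_cont Y_eq E E' supIJt.
have [oH _] := onbH; have [oU _] := onbU.
have lam_lt0 h : HH h -> lam h < 0.
  move=> hH; rewrite -lte_fin; apply: le_lt_trans lam0.
  by apply: ereal_sup_ubound; exists h.
have B_le x : Hg x -> hs_norm UU (B x) ^+ 2 <= vth.
  move=> Hx; rewrite -lee_fin; apply: le_trans vtheta_ge.
  by apply: ereal_sup_ubound; exists x.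
have vth0 : 0 <= vth.
  apply: le_trans (sqr_ge0 _) (B_le 0 _).
  by apply: (@diag_dom_span _ _ _ _ _ _ fset0) => h _ _; rewrite linear0r.
set sg := Num.sqrt vth in D_hyp E *.
have sg0 : 0 <= sg by exact: sqrtr_ge0.
have T_ge0 := ltW T0.
have c_gt0 : 0 < c.
  by apply: lt_le_trans c_ge; rewrite mulr_gt0// lt_max ltr01.
(* The last two summands bound |x|^2 tau^2 and |P_I F(x)|^2 tau^2 on the truncation sets; the 1
   ensures K <= K^2. *)
pose K := 1 + c / eps * T `^ (4^-1 - vsig) + c ^+ 2 * T `^ (4^-1 - 2 * delta).
pose tau0 := T `^ 8^-1.
have tau00 : 0 <= tau0 by exact: powR_ge0.
have K1a : 0 <= c / eps * T `^ (4^-1 - vsig).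
  by rewrite mulr_ge0 ?powR_ge0// divr_ge0// ltW.
have K1b : 0 <= c ^+ 2 * T `^ (4^-1 - 2 * delta).
  by rewrite mulr_ge0 ?powR_ge0// sqr_ge0.
have K0 : 0 <= K by rewrite !addr_ge0.
have KK x : x <= K -> x <= K ^+ 2.
  by move=> /le_trans; apply; rewrite expr2 ler_peMr// /K -addrA lerDl addr_ge0.
pose C := step_constant eps vth b1 b2 K tau0.
have C0 : 0 <= C by apply: step_constant_ge0 => //; exact: ltW.
pose E0 I := (\int[P]_w (expR (sg + eps * `|PI I (xi w)| ^+ 2))%:E)%E.
pose Exi := (\int[P]_w (expR (sg + eps * `|xi w| ^+ 2))%:E)%E.
pose tau th := (mesh th : R) `^ 8^-1.
have [A [AH Acvg]] := onb_proj_dense hilbH onbH sepH.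
have mcoord h : HH h -> measurable_fun setT (fun w => ipH h (xi w)).
  move=> hH _ S mS; have [/(_ 0)] := filtF.
  rewrite lexx T_ge0 => /(_ isT)[_ sub] _; apply: sub.
  apply: (measurable_wrt_trans xi_meas
    (measurable_ip_interp (r := gamma) hilbH oH lam_lt0 hH)); last by exists S.
  by move=> w _; exact: xi_Hg.
have mPxi (I : {fset H}) : [set` I] `<=` HH ->
    measurable_fun setT (fun w => `|PI [set` I] (xi w)| ^+ 2).
  move=> IH; rewrite (_ : (fun w => _) =
      fun w => \sum_(i : I) ipH (fsval i) (xi w) ^+ 2).
    apply: measurable_sum => i; apply: measurable_funX; apply: mcoord.
    by apply: IH; exact: fsvalP.
  by apply/funext => w; rewrite /PI (norm_onb_proj_sq hilbH oH IH).
have Ncvg w : `|PI [set` A n] (xi w)| ^+ 2 @[n --> \oo] --> `|xi w| ^+ 2.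
  by apply: cvgM; apply: cvg_norm; exact: Acvg.
(* [xi] is measurable for the norm of H_gamma, which gives its coordinates; its norm in [H] is the
   limit of the norms of finite projections. *)
have mxi : measurable_fun setT (fun w => `|xi w| ^+ 2).
  by apply: (measurable_fun_cvg (fun n => mPxi _ (AH n))) => w _; exact: Ncvg.
have ExiE : ('E_P[fun w => expR (sg + eps * `|xi w| ^+ 2)] = Exi)%E.
  by rewrite unlock.
have Exi_fin : (Exi < +oo)%E.
  have -> : Exi = ((expR sg)%:E * 'E_P[fun w => expR (eps * `|xi w| ^+ 2)])%E.
    rewrite unlock -ge0_integralZl ?lee_fin ?expR_ge0//.
    - by apply: eq_integral => w _; rewrite -EFinM -expRD.
    - by apply/measurable_EFinP; apply: measurableT_comp => //; exact: measurable_funM.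
  by rewrite lte_mul_pinfty// lee_fin expR_ge0.
have Exi0 : (0 <= Exi)%E by apply: integral_ge0 => w _; rewrite lee_fin expR_ge0.
have fsetE (V : choiceType) (S I : set V) : fsets S I ->
    exists2 B : {fset V}, [set` B] `<=` S & I = [set` B].
  by move=> [fI IS]; exists (fset_set I); rewrite fset_setK.
have E0_le I : fsets HH I -> (E0 I <= Exi)%E.
  move=> /fsetE[AI AIH ->]; apply: ge0_le_integral => //.
  - apply/measurable_EFinP; apply: measurableT_comp => //.
    by apply: measurable_funD => //; apply: measurable_funM => //; exact: mPxi.
  - apply/measurable_EFinP; apply: measurableT_comp => //.
    by apply: measurable_funD => //; exact: measurable_funM.
  move=> w _; rewrite lee_fin ler_expR lerD2l ler_pM2l// lerXn2r ?nnegrE//.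
  exact: (norm_onb_proj_le hilbH oH AIH).
have Y0 th I J w : grid T th -> fsets HH I -> fsets UU J ->
    Y th I J 0 w = PI I (xi w).
  (* The initial condition accompanies the recursion at each t in (0,T]; it is read off at [T]. *)
  by move=> gth IH JU; have [] := Y_eq th I J gth IH JU T; rewrite ?T0 ?lexx.
have Yex th I J t w : grid T th -> fsets HH I -> fsets UU J -> 0 <= t <= T ->
    exists z, Y th I J t w = PI I z.
  by move=> gth IH JU /(Y_val th I J gth IH JU t w)[z _ <-]; exists z.
have meshT th : grid T th -> 0 < mesh th <= T.
  by move=> gth; rewrite (mesh_gt0 T0 gth) (mesh_le T0 gth).
have key th I J t : grid T th -> fsets HH I -> fsets UU J -> 0 <= t <= T ->
    (E th I J t <= (expR (C * t * tau th))%:E * E0 I)%E.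
  move=> gth IH JU tT; have mT := meshT th gth; have /andP[m0 m1] := mT.
  have [AI AIH IE] := fsetE _ _ _ IH; have [BJ BU JE] := fsetE _ _ _ JU.
  have ID : I `<=` HH by case: IH.
  have tau_gt0 : 0 < tau th by exact: powR_gt0.
  have tau_le : tau th <= tau0.
    by apply: ge0_ler_powR; rewrite ?nnegrE ?invr_ge0 ?(ltW m0).
  have mesh_tau : mesh th <= tau th ^+ 8 by rewrite powR_eighth// ltW.
  have dn x : D I (mesh th) x -> `|x| ^+ 2 * tau th ^+ 2 <= K ^+ 2.
    move=> Dx; have [/(_ x Dx) /= xc _ _] := D_hyp _ _ _ _ mT IH JU Dx.
    apply: KK; apply: (@le_trans _ _ (c / eps * (mesh th `^ (- vsig) * tau th ^+ 2))).
      rewrite mulrA ler_wpM2r ?sqr_ge0// mulrAC ler_pdivlMr// mulrC.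
      by apply: le_trans xc; rewrite lerDr.
    apply: (@le_trans _ _ (c / eps * T `^ (4^-1 - vsig))).
      rewrite ler_wpM2l ?divr_ge0 ?(ltW c_gt0) ?(ltW eps0)//.
      by apply: powR_mesh_le => //; exact: vsig_le.
    by rewrite /K addrAC lerDr addr_ge0.
  have dd x : D I (mesh th) x -> `|PI I (F x)| ^+ 2 * tau th ^+ 2 <= K ^+ 2.
    move=> Dx; have [_ + _] := D_hyp _ _ _ _ mT IH JU Dx.
    rewrite ge_max => /andP[Fc _].
    apply: KK; apply: (@le_trans _ _ (c ^+ 2 *
        (mesh th `^ (- (2 * delta)) * tau th ^+ 2))).
      rewrite mulrA ler_wpM2r ?sqr_ge0//.
      have -> : mesh th `^ (- (2 * delta)) = (mesh th `^ (- delta)) ^+ 2.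
        by rewrite -powR_mulrn ?powR_ge0// -powRrM mulNr mulrC.
      by rewrite -exprMn lerXn2r ?nnegrE// mulr_ge0 ?powR_ge0 ?(ltW c_gt0).
    apply: (@le_trans _ _ (c ^+ 2 * T `^ (4^-1 - 2 * delta))).
      by rewrite ler_wpM2l ?sqr_ge0// powR_mesh_le.
    by rewrite /K lerDr addr_ge0.
  have di x : D I (mesh th) x -> ipH x (PI I (F x)) <= b1 + b2 * `|x| ^+ 2.
    by move=> Dx; have [] := D_hyp _ _ _ _ mT IH JU Dx.
  have yE t' (tT' : 0 < t' <= T) := (Y_eq th I J gth IH JU t' tT').2.
  have yv t' w := Yex th I J t' w gth IH JU.
  have ya := Y_adapted th I J gth IH JU.
  have Dm := D_meas I (mesh th) ID mT.
  have E0E : (E0 I = \int[P]_w (expR (sg + eps * `|Y th I J 0 w| ^+ 2))%:E)%E.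
    by apply: eq_integral => w _; rewrite Y0.
  rewrite E0E {E0E} /E unlock.
  move: {IH JU} (Y th I J) yE yv ya => y; rewrite {}IE {}JE in ID Dm dn dd di *.
  move=> yE yv ya.
  exact: (scheme_moment_le hilbH hilbU oH oU lam_lt0 filtF wienerW F_meas B_HS
    B_meas B_le eps0 vth0 b10 b20 gth AIH BU Dm yv ya yE K0 tau_gt0 tau_le
    mesh_tau sg0 dn dd di tT).
pose n2 th I J t w := `|Y th I J t w| ^+ 2.
pose acc th I J t w := \int[lebesgue_measure]_(s in `[0%R, t])
  (\1_(D I (mesh th)) (Y th I J (grid_le th s) w) *
   (eps * (2%:R * b1 + vth) / expR (2%:R * (b2 + eps * vth) * s))).
have mn th I J t : grid T th -> fsets HH I -> fsets UU J -> 0 <= t <= T ->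
    measurable_fun setT (n2 th I J t).
  move=> gth IH JU; have [AI AIH IE] := fsetE _ _ _ IH.
  have ya := Y_adapted th I J gth IH JU.
  apply: (measurable_scheme_norm hilbH oH lam_lt0 filtF AIH _ ya) => t' w.
  by rewrite -IE; exact: Yex.
have macc th I J t : grid T th -> fsets HH I -> fsets UU J -> 0 <= t <= T ->
    measurable_fun setT (acc th I J t).
  move=> gth IH JU; apply: (measurable_scheme_weight filtF vth eps b1 b2 gth
    _ (Y_adapted th I J gth IH JU)).
  by apply: D_meas; [case: IH|exact: meshT].
have decay t : 0 <= t -> 1 <= expR (2%:R * (b2 + eps * vth) * t).
  move=> t0; apply: le_trans (expR_ge1Dx _); rewrite lerDl.
  by rewrite mulr_ge0// mulr_ge0// addr_ge0// mulr_ge0// ltW.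
have mE th I J t : grid T th -> fsets HH I -> fsets UU J -> 0 <= t <= T ->
    measurable_fun setT (fun w => expR ((sg + eps * n2 th I J t w) /
      expR (2%:R * (b2 + eps * vth) * t) - acc th I J t w)).
  move=> gth IH JU tT; apply: measurableT_comp => //; apply: measurable_funB.
    apply: measurable_funM => //; apply: measurable_funD => //.
    by apply: measurable_funM => //; exact: mn.
  exact: macc.
have mE' th I J t : grid T th -> fsets HH I -> fsets UU J -> 0 <= t <= T ->
    measurable_fun setT (fun w => expR (eps * n2 th I J t w /
      expR (2%:R * (b2 + eps * vth) * t))).
  move=> gth IH JU tT; apply: measurableT_comp => //; apply: measurable_funM => //.
  by apply: measurable_funM => //; exact: mn.
have EE' th I J t : grid T th -> fsets HH I -> fsets UU J -> 0 <= t <= T ->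
    (E th I J t <= (expR sg)%:E * E' th I J t)%E.
  move=> gth IH JU tT; rewrite /E /E' unlock -ge0_integralZl ?lee_fin ?expR_ge0//.
  - apply: ge0_le_integral => //.
    + by apply/measurable_EFinP; exact: mE.
    + by apply: emeasurable_funM => //; apply/measurable_EFinP; exact: mE'.
    move=> w _; rewrite -EFinM lee_fin -expRD ler_expR mulrDl.
    have acc0 := @scheme_weight_ge0 R H _ _ vth eps b1 b2 eps0 vth0 b10 th
      (D I (mesh th)) (Y th I J) t w.
    rewrite lerBlDr -addrA lerD// ?lerDl//.
    rewrite ler_pdivrMr ?expR_gt0// ler_peMr// decay//; by case/andP: tT.
  - by apply/measurable_EFinP; exact: mE'.
(* The reverse comparison, used for finiteness: the integral in the exponent is at most eps (2 b1 +
   vth) T. *)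
have E'E th I J t : grid T th -> fsets HH I -> fsets UU J -> 0 <= t <= T ->
    (E' th I J t <= (expR (eps * (2%:R * b1 + vth) * T))%:E * E th I J t)%E.
  move=> gth IH JU tT; rewrite /E /E' unlock -ge0_integralZl ?lee_fin ?expR_ge0//.
  - apply: ge0_le_integral => //.
    + by apply/measurable_EFinP; exact: mE'.
    + by apply: emeasurable_funM => //; apply/measurable_EFinP; exact: mE.
    move=> w _; rewrite -EFinM lee_fin -expRD ler_expR.
    have acc_le := scheme_weight_le eps0 vth0 b10 b20 gth (D I (mesh th))
      (Y th I J) w tT.
    rewrite (mulrDl sg) addrCA -[leLHS]addr0 lerD ?subr_ge0// lerDr.
    by rewrite divr_ge0 ?expR_ge0.
  - by apply/measurable_EFinP; exact: mE.
have sup_le (f : set R -> set H -> set U -> R -> \bar R) th M :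
    (forall I J t, fsets HH I -> fsets UU J -> 0 <= t <= T ->
      (f th I J t <= M)%E) -> (supIJt f th <= M)%E.
  move=> fM; apply: ge_ereal_sup => _ [I IH <-].
  apply: ge_ereal_sup => _ [J JU <-]; apply: ge_ereal_sup => _ [t /= + <-].
  by rewrite in_itv /= => tT; exact: fM.
have le_sup (f : set R -> set H -> set U -> R -> \bar R) th I J t :
    fsets HH I -> fsets UU J -> 0 <= t <= T -> (f th I J t <= supIJt f th)%E.
  move=> IH JU tT; apply: le_trans (ereal_sup_ubound _); last by exists I.
  apply: le_trans (ereal_sup_ubound _); last by exists J.
  by apply: ereal_sup_ubound; exists t => //=; rewrite in_itv.
have key_sup th rho : grid T th -> tau th <= rho ->
    (supIJt E th <= (expR (C * T * rho))%:E * Exi)%E.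
  move=> gth trho; apply: sup_le => I J t IH JU tT.
  apply: le_trans (key _ _ _ _ gth IH JU tT) _.
  apply: lee_pmul; last exact: E0_le.
  - by rewrite lee_fin expR_ge0.
  - by apply: integral_ge0 => w _; rewrite lee_fin expR_ge0.
  rewrite lee_fin ler_expR ler_pM ?mulr_ge0 ?powR_ge0//; first by case/andP: tT.
  by rewrite ler_wpM2l//; case/andP: tT.
rewrite ExiE; split.
- have [x xE] : exists x : R, Exi = x%:E.
    by exists (fine Exi); rewrite fineK// ge0_fin_numE.
  have cv : (expR (C * T * n.+1%:R^-1) * x)%:E @[n --> \oo] --> Exi.
    rewrite xE; apply: cvg_EFin; first exact: nearW.
    have cx : expR (C * T * n.+1%:R^-1) * x @[n --> \oo] --> expR (C * T * 0) * x.
      apply: cvgM; last exact: cvg_cst.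
      apply: (continuous_cvg _ (@continuous_expR R _)).
      by apply: cvgM; [exact: cvg_cst|exact: cvg_harmonic].
    by rewrite mulr0 expR0 mul1r in cx.
  rewrite -(cvg_lim _ cv)//; apply: lime_ge.
    by apply/cvg_ex; exists Exi.
  apply: nearW => n; apply: le_trans (ereal_inf_lbound _) _.
    (* The eighth root of such a mesh is at most 1/(n+1), and the resulting factor exp(C T / (n+1))
       tends to 1. *)
    exists (n.+1%:R^-1 ^+ 8); last by [].
    by rewrite /= exprn_gt0// invr_gt0.
  apply: ge_ereal_sup => _ [th [gth mth] <-].
  rewrite EFinM -xE; apply: key_sup => //.
  rewrite -[leRHS]powR_eighthK ?invr_ge0//.
  by apply: ge0_ler_powR; rewrite ?nnegrE ?invr_ge0 ?exprn_ge0 ?invr_ge0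
    ?(ltW (mesh_gt0 T0 gth)).
- apply: (@integral_cvg_le _ _ _ P
    (fun n w => expR (sg + eps * `|PI [set` A n] (xi w)| ^+ 2))).
  + move=> n; apply: measurableT_comp => //; apply: measurable_funD => //.
    by apply: measurable_funM => //; exact: mPxi.
  + by move=> n w; exact: expR_ge0.
  + move=> w; apply: (continuous_cvg _ (@continuous_expR R _)).
    by apply: cvgD; [exact: cvg_cst|apply: cvgM; [exact: cvg_cst|exact: Ncvg]].
  (* At t = 0 the quantity depends on [I] alone, so the coarsest grid and empty [J] serve as
     witnesses. *)
  move=> n; pose th := [set 0; T] : set R.
  have gth : grid T th.
    split; [| |by left|by right].
    - exact: finite_set2.
    - by move=> x [->|->] /=; rewrite in_itv /= ?lexx ?T_ge0.
  have IH : fsets HH [set` A n] by split; [exact: finite_fset|exact: AH].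
  have JU : fsets UU set0 by split.
  have T00 : (0 : R) <= 0 <= T by rewrite lexx T_ge0.
  apply: le_trans (ereal_sup_ubound _); last by exists th.
  apply: le_trans (le_sup E th _ _ _ IH JU T00).
  rewrite /E unlock le_eqVlt; apply/orP; left; apply/eqP.
  apply: eq_integral => w _; rewrite Y0// set_itv1 Rintegral_set1 mulr0 expR0.
  by rewrite divr1 subr0.
- apply: ge_ereal_sup => _ [th gth <-]; apply: sup_le => I J t IH JU tT.
  apply: le_trans (EE' _ _ _ _ gth IH JU tT) _.
  rewrite lee_wpmul2l ?lee_fin ?expR_ge0//.
  apply: le_trans (ereal_sup_ubound _); last by exists th.
  exact: (le_sup E' th).
rewrite lte_mul_pinfty ?lee_fin ?expR_ge0//.
apply: (@le_lt_trans _ _ ((expR (eps * (2%:R * b1 + vth) * T))%:E *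
    ((expR (C * T * tau0))%:E * Exi))%E).
  apply: ge_ereal_sup => _ [th gth <-]; apply: sup_le => I J t IH JU tT.
  apply: le_trans (E'E _ _ _ _ gth IH JU tT) _.
  rewrite lee_wpmul2l ?lee_fin ?expR_ge0//.
  apply: le_trans (le_sup E th _ _ _ IH JU tT) _; apply: key_sup => //.
  by apply: ge0_ler_powR; rewrite ?nnegrE ?invr_ge0 ?(ltW (mesh_gt0 T0 gth)) ?mesh_le.
rewrite lte_mul_pinfty ?lee_fin ?expR_ge0//.
by rewrite lte_mul_pinfty ?lee_fin ?expR_ge0.
Qed.
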